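(* Let $p_1,p_2,q_1,q_2\in\mathbb{R}$ satisfy $|p_1|\ne|p_2|$, $|q_1|\ne|q_2|$ and $\max\{p_1^2,p_2^2\}+\max\{q_1^2,q_2^2\}<1$, and let $\mathbf{a}_1\mathbf{a}_2\mathbf{a}_3\mathbf{b}_1\mathbf{b}_2\mathbf{b}_3$ be the flexible octahedron in $\mathbb{S}^3$ given by $$\begin{aligned} \mathbf{a}_1&=\Bigl(\tfrac{p_1}{\cos\theta},\delta_1\sqrt{1-\tfrac{p_1^2}{\cos^2\theta}},0,0\Bigr),& \mathbf{b}_1&=\Bigl(\tfrac{p_2}{\cos\theta},\delta_2\sqrt{1-\tfrac{p_2^2}{\cos^2\theta}},0,0\Bigr),\\ \mathbf{a}_2&=\Bigl(0,0,\tfrac{q_1}{\sin\theta},\varepsilon_1\sqrt{1-\tfrac{q_1^2}{\sin^2\theta}}\Bigr),& \mathbf{b}_2&=\Bigl(0,0,\tfrac{q_2}{\sin\theta},\varepsilon_2\sqrt{1-\tfrac{q_2^2}{\sin^2\theta}}\Bigr),\\ \mathbf{a}_3&=(\cos\theta,0,\sin\theta,0),&\mathbf{b}_3&=(\cos\theta,0,-\sin\theta,0). \end{aligned}$$ Let $\mathbf{a}_1'\mathbf{a}_2'\mathbf{a}_3'\mathbf{b}_1'\mathbf{b}_2'\mathbf{b}_3'$ be an octahedron obtained from it by replacing some (any, possibly empty, set) of its vertices with their antipodes. Then the oriented volume of the octahedron $\mathbf{a}_1'\mathbf{a}_2'\mathbf{a}_3'\mathbf{b}_1'\mathbf{b}_2'\mathbf{b}_3'$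 is nonconstant on any arbitrarily small segment of the configuration curve $\Gamma$. Thus the octahedron $\mathbf{a}_1\mathbf{a}_2\mathbf{a}_3\mathbf{b}_1\mathbf{b}_2\mathbf{b}_3$ provides a counterexample to the Modified Bellows Conjecture in $\mathbb{S}^3$.
   Context: **Setting.** $\mathbb{S}^3$ is the unit sphere in $\mathbb{E}^4$. In the formulae, $\delta_1,\delta_2,\varepsilon_1,\varepsilon_2\in\{-1,1\}$ and $\theta\in[\theta_{\min},\theta_{\max}]$, $\theta_{\min}=\arcsin(\max\{|q_1|,|q_2|\})$, $\theta_{\max}=\arccos(\max\{|p_1|,|p_2|\})$. An octahedron with vertices $\mathbf{a}_i,\mathbf{b}_i$ ($i=1,2,3$) has as edges all pairs of vertices except $\{\mathbf{a}_i,\mathbf{b}_i\}$ and 8 faces $\mathbf{u}_1\mathbf{u}_2\mathbf{u}_3$, $\mathbf{u}_i\in\{\mathbf{a}_i,\mathbf{b}_i\}$; it is oriented so that $\mathbf{a}_1\mathbf{a}_2\mathbf{a}_3$ is positively oriented. All edge lengths of the octahedron given by the formulae are independent of $\theta$ and of the signs. **Configuration curve.** $\Gamma$ is the set of all octahedra given by the formulae above, for all $\theta\in[\theta_{\min},\theta_{\max}]$ and all signs $\delta_1,\delta_2,\varepsilon_1,\varepsilon_2$, considered up to rotations of $\mathbb{S}^3$ (equivalently, it is the corresponding curve in $(\mathbb{RP}^1)^{12}$ whose coordinates are the tangents of the halves of the oriented dihedral angles at the 12 edges, i.e. the unique essential one-dimensional irreducible component of the configuration space of octahedra with the given edge lengths).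 Simultaneous reversal of all four signs is realized by a rotation. $\Gamma$ is a disjoint union of two topological circles, distinguished by a sign: if, say, $|p_1|<|p_2|$ and $|q_1|<|q_2|$, the two circles correspond to $\delta_1\varepsilon_1=1$ and $\delta_1\varepsilon_1=-1$, and along each of them $\delta_2$ changes when $\theta=\theta_{\max}$ and $\varepsilon_2$ changes when $\theta=\theta_{\min}$. A segment of $\Gamma$ is an arc of $\Gamma$ of positive length. The oriented volume of the octahedron $\mathbf{a}_1'\mathbf{a}_2'\mathbf{a}_3'\mathbf{b}_1'\mathbf{b}_2'\mathbf{b}_3'$ is regarded as a function on $\Gamma$. **Oriented volume.** For a spherical tetrahedron with linearly independent vertices, $V_{\mathrm{or}}(\mathbf{c}_1,\mathbf{c}_2,\mathbf{c}_3,\mathbf{c}_4)=\operatorname{sgn}\det(\mathbf{c}_1,\mathbf{c}_2,\mathbf{c}_3,\mathbf{c}_4)$ times its volume. The (generalized) oriented volume of an octahedron is the sum $\sum V_{\mathrm{or}}(\mathbf{o},\mathbf{v}_0,\mathbf{v}_1,\mathbf{v}_2)$ over all positively oriented faces $\mathbf{v}_0\mathbf{v}_1\mathbf{v}_2$, where $\mathbf{o}\in\mathbb{S}^3$ is any point for which all these tetrahedra are non-degenerate; it is well defined as an element of $\mathbb{R}/2\pi^2\mathbb{Z}$. **Modified Bellows Conjecture:** for a flexible polyhedron $P(u)$ in $\mathbb{S}^n$, $n\ge3$, one can replace some vertices of $P(u)$ with their antipodes so that the oriented volume of the obtained flexible polyhedron is constant during the flexion. *)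

(* Defs.v *)
From HB Require Import structures.
From mathcomp Require Import all_boot all_order all_algebra.
From mathcomp Require Import all_classical all_reals all_analysis.
Import Order.TTheory GRing.Theory Num.Theory.
Import numFieldNormedType.Exports.

Set Implicit Arguments.
Unset Strict Implicit.
Unset Printing Implicit Defensive.

Local Open Scope classical_set_scope.
Local Open Scope ring_scope.

Section SphericalGeometry.
Context {R : realType}.

Definition vec4 (x y z w : R) : 'rV[R]_4 := \row_(i < 4) [:: x; y; z; w]`_i.

(* [`|u|] is the sup norm on row vectors, hence an explicit Euclidean product. *)
Definition dotv (u v : 'rV[R]_4) : R := (u *m v^T) 0 0.

Definition sphere3 : set 'rV[R]_4 := [set u | dotv u u = 1].

Definition sphere_dist (u v : 'rV[R]_4) : R := acos (dotv u v).

Definition lebesgue4 : set (R * R * R * R) -> \bar R :=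
  ((lebesgue_measure \x lebesgue_measure) \x lebesgue_measure
    \x lebesgue_measure)%E.

(* In polar coordinates the cone over [A] inside the unit ball of E^4 has
   Lebesgue measure int_0^1 r^3 vol(A) dr = vol(A) / 4. *)
Definition spherical_volume (A : set 'rV[R]_4) : R :=
  4 * fine (lebesgue4 [set x : R * R * R * R | exists r u,
    [/\ 0 <= r <= 1, A u & vec4 x.1.1.1 x.1.1.2 x.1.2 x.2 = r *: u]]).

(* The vertices of a spherical tetrahedron are the rows of [C]. *)
Definition spherical_tetrahedron (C : 'M[R]_4) : set 'rV[R]_4 :=
  [set u | sphere3 u /\
    exists t : 'rV[R]_4, (forall i, 0 <= t 0 i) /\ u = t *m C].

Definition oriented_volume_tetra (C : 'M[R]_4) : R :=
  Num.sg (\det C) * spherical_volume (spherical_tetrahedron C).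

End SphericalGeometry.

Section Octahedra.
Context {R : realType}.

(* The rows are a_1, a_2, a_3, b_1, b_2, b_3, in this order. *)
Definition octahedron := 'M[R]_(3 + 3, 4).

Implicit Types P Q : octahedron.

(* A face u_1 u_2 u_3 is encoded by [e : 'I_3 -> bool]: u_i is b_i if [e i]
   and a_i otherwise. *)
Definition face P (e : {ffun 'I_3 -> bool}) : 'M[R]_(3, 4) :=
  \matrix_(i < 3) row (if e i then rshift 3 i else lshift 3 i) P.

(* Adjacent faces induce opposite orientations on their common edge, so
   (u_1, u_2, u_3) is positive iff it contains an even number of b's;
   otherwise two vertices are exchanged. *)
Definition positive_face P (e : {ffun 'I_3 -> bool}) : 'M[R]_(3, 4) :=
  if odd (\sum_i e i)%N then xrow 0 1 (face P e) else face P e.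

Definition tetra_over (o : 'rV[R]_4) P (e : {ffun 'I_3 -> bool}) : 'M[R]_4 :=
  col_mx o (positive_face P e).

Definition generic_apex P (o : 'rV[R]_4) : Prop :=
  sphere3 o /\ forall e, \det (tetra_over o P e) != 0.

(* An element of R / 2 pi^2 Z is represented as a coset, i.e. a subset of R. *)
Definition oriented_volume P : set R :=
  [set v | exists (o : 'rV[R]_4) (k : int), generic_apex P o /\
    v = \sum_(e : {ffun 'I_3 -> bool})
          oriented_volume_tetra (tetra_over o P e) + k%:~R * (2 * pi ^+ 2)].

Definition antipodes (A : {set 'I_(3 + 3)}) P : octahedron :=
  \matrix_(i < 3 + 3) (if i \in A then - row i P else row i P).

Definition edge (i j : 'I_(3 + 3)) : bool := i != j %[mod 3].

Definition edge_length P (i j : 'I_(3 + 3)) : R :=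
  sphere_dist (row i P) (row j P).

Definition isometric P Q : Prop :=
  exists A : 'M[R]_4, A *m A^T = 1%:M /\ Q = P *m A.

Definition rotation_equivalent P Q : Prop :=
  exists A : 'M[R]_4, [/\ A *m A^T = 1%:M, \det A = 1 & Q = P *m A].

Definition rotation_equivb P Q : bool := `[< rotation_equivalent P Q >].

Lemma rotation_equivb_refl : reflexive rotation_equivb.
Proof.
move=> P; apply/asboolP; exists 1%:M.
by rewrite trmx1 !mulmx1 det1.
Qed.

Lemma rotation_equivb_sym : symmetric rotation_equivb.
Proof.
suff H P Q : rotation_equivb P Q -> rotation_equivb Q P.
  by move=> P Q; apply/idP/idP; exact: H.
move=> /asboolP[A [AA dA ->]]; apply/asboolP; exists A^T.
by rewrite trmxK det_tr -mulmxA AA mulmx1 (mulmx1C AA).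
Qed.

Lemma rotation_equivb_trans : transitive rotation_equivb.
Proof.
move=> Q P S /asboolP[A [AA dA ->]] /asboolP[B [BB dB ->]]; apply/asboolP.
exists (A *m B); rewrite det_mulmx dA dB mulr1 mulmxA; split=> //.
by rewrite trmx_mul mulmxA -(mulmxA A) BB mulmx1.
Qed.

Canonical rotation_equiv := EquivRel rotation_equivb
  rotation_equivb_refl rotation_equivb_sym rotation_equivb_trans.

Definition octahedron_class : topologicalType :=
  quotient_topology {eq_quot rotation_equiv}%qT.

Definition class_of P : octahedron_class :=
  (\pi_({eq_quot rotation_equiv}) P)%qT.

(* An arc of positive length in [G]: a homeomorphic copy of [0, 1]
   ([octahedron_class] is Hausdorff). *)
Definition segment (G S : set octahedron_class) : Prop :=
  exists c : R -> octahedron_class,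
    [/\ {within `[0, 1], continuous c}, set_inj `[0, 1] c,
        S = c @` `[0, 1] & S `<=` G].

(* A flexible octahedron in S^3, with parameter running over [a, b]. *)
Definition flexible (a b : R) (P : R -> octahedron) : Prop :=
  [/\ a < b,
      {within `[a, b], continuous P},
      {in `[a, b], forall u, (forall i, sphere3 (row i (P u))) /\
                             (forall e, row_free (face (P u) e))},
      {in `[a, b] &, forall u v i j, edge i j ->
         edge_length (P u) i j = edge_length (P v) i j} &
      {in `[a, b] &, forall u v, u != v -> ~ isometric (P u) (P v)}].

Definition satisfies_modified_bellows (a b : R) (P : R -> octahedron) : Prop :=
  exists (A : {set 'I_(3 + 3)}) (V : set R),
    {in `[a, b], forall u, oriented_volume (antipodes A (P u)) = V}.

Definition modified_bellows_counterexample (a b : R) (P : R -> octahedron) :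
    Prop :=
  flexible a b P /\ ~ satisfies_modified_bellows a b P.

End Octahedra.
Arguments octahedron R : clear implicits.
Arguments octahedron_class R : clear implicits.

Section TheOctahedron.
Context {R : realType}.
Variables p1 p2 q1 q2 : R.

Definition theta_min : R := asin (Num.max `|q1| `|q2|).
Definition theta_max : R := acos (Num.max `|p1| `|p2|).

(* The sign delta_1 is (-1) ^+ d1, and similarly for the other ones. *)
Definition flex_octahedron (d1 d2 e1 e2 : bool) (theta : R) : octahedron R :=
  let c := cos theta in let s := sin theta in
  let a1 := vec4 (p1 / c) ((-1) ^+ d1 * Num.sqrt (1 - p1 ^+ 2 / c ^+ 2)) 0 0 in
  let b1 := vec4 (p2 / c) ((-1) ^+ d2 * Num.sqrt (1 - p2 ^+ 2 / c ^+ 2)) 0 0 in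
  let a2 := vec4 0 0 (q1 / s) ((-1) ^+ e1 * Num.sqrt (1 - q1 ^+ 2 / s ^+ 2)) in
  let b2 := vec4 0 0 (q2 / s) ((-1) ^+ e2 * Num.sqrt (1 - q2 ^+ 2 / s ^+ 2)) in
  let a3 := vec4 c 0 s 0 in
  let b3 := vec4 c 0 (- s) 0 in
  col_mx (\matrix_(i < 3) [:: a1; a2; a3]`_i) (\matrix_(i < 3) [:: b1; b2; b3]`_i).

Definition flex_octahedra : set (octahedron R) :=
  [set P | exists (d1 d2 e1 e2 : bool) (theta : R),
    theta_min <= theta <= theta_max /\ P = flex_octahedron d1 d2 e1 e2 theta].

Definition Gamma : set (octahedron_class R) := class_of @` flex_octahedra.

(* [f] is seen as a function on [Gamma] through representatives; it must take
   different values at two points of [S], whatever the representatives. *)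
Definition nonconstant_on (T : Type) (S : set (octahedron_class R))
    (f : octahedron R -> T) : Prop :=
  exists x y, [/\ S x, S y & forall P Q, flex_octahedra P -> flex_octahedra Q ->
    class_of P = x -> class_of Q = y -> f P <> f Q].

End TheOctahedron.

(* Main.v *)
(* Choose the point o on the bisector of a_3' b_3': it is the first coordinate
   vector up to sign, or the third one if exactly one end of this diagonal has
   been replaced with its antipode. The tetrahedra o u_1 u_2 a_3' and
   o u_1 u_2 b_3' then add up to u_1 u_2 a_3' b_3'. Changing the signs of two
   coordinates is an isometry that fixes u_1, takes u_2 to its antipode and
   exchanges a_3 and b_3; hence it takes u_1 u_2 a_3 b_3 to its complement in the
   lune bounded by the three faces through u_2, and by Girard's formula the
   volume of u_1 u_2 a_3 b_3 is
     (pi / 2) (arctan z - arctan (p z / r)),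
   z = sqrt ((sin^2 theta - q^2) / (cos^2 theta - p^2)), r = sqrt (1 - q^2),
   where p is one of the p_i and q is one of the q_j, up to sign. The volume of
   the octahedron is a signed sum of four such terms, whose derivative in
   cos^2 theta is algebraic and vanishes only at roots of a nonzero polynomial.
   Hence every value is taken countably often. The oriented volume modulo
   2 pi^2 is a countable set of real numbers, since changing o adds only
   multiples of the volume of S^3; therefore it is constant on no uncountable
   subset of the configuration curve. *)
From HB Require Import structures.
Require Import Defs.
From mathcomp Require Import all_boot all_order all_algebra perm.
From mathcomp Require Import all_classical all_reals all_analysis.
From mathcomp Require Import measurable_realfun ring lra.
Import Order.TTheory GRing.Theory Num.Theory.
Import numFieldNormedType.Exports.
Set Implicit Arguments.
Unset Strict Implicit.
Unset Printing Implicit Defensive.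
Local Open Scope classical_set_scope.
Local Open Scope ring_scope.

(** * Measure-preserving maps of products *)

(** The measure on E^4 is an iterated product of one-dimensional Lebesgue measures, so its
    invariance under rotations is built from Fubini: sign changes and shears preserve it, and a
    plane rotation is a product of three shears. Volumes are kept as multiples of the measure of the
    unit ball, whose value never has to be computed: whatever it is, its integer multiples form a
    countable set. Representatives of one point of Gamma may differ in their signs, and a segment
    may pass through the ends of the parameter interval, where the tetrahedra over the chosen apex
    degenerate. Counting avoids following the curve: the sixteen choices of signs are treated
    separately, the ends give finitely many classes, and a segment is uncountable. The two
    hypotheses on absolute values enter when the polynomial is shown to be nonzero, each excluding
    one way for it to vanish. When exactly one of a_3, b_3 is replaced, the p_i and q_j exchange
    roles and the variable becomes sin^2 theta. *)

Section MeasurePreserving.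
Local Open Scope ereal_scope.

Definition preserving d (T : measurableType d) (R : realType)
    (mu : set T -> \bar R) (f : T -> T) :=
  measurable_fun setT f /\ forall A, measurable A -> mu (f @^-1` A) = mu A.

Lemma preserving_translation (R : realType) (a : R) :
  preserving (@lebesgue_measure R) (fun x => x + a)%R.
Proof.
have mf : measurable_fun setT (fun x : R => x + a)%R.
  by apply: measurable_funD => //; exact: measurable_id.
split=> // A mA.
suff : pushforward (@lebesgue_measure R) (fun x : R => x + a)%R A = lebesgue_measure A by [].
symmetry; apply: (lebesgue_measure_unique (mu := pushforward (@lebesgue_measure R)
   (fun x : measurableTypeR R => (x + a)%R : measurableTypeR R))) => // _ [[u v] _ <-] /=.
rewrite /pushforward.
have -> : ((fun x : R => (x + a)%R) @^-1` `]u, v] = `](u - a)%R, (v - a)%R])%classic.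
  by apply/seteqP; split => x /=; rewrite !in_itv /= ltrBlDr lerBrDr.
rewrite !lebesgue_measure_itv /= !lte_fin ltrD2r; case: ifP => // _.
by rewrite -!EFinB; congr EFin; rewrite opprB addrA subrK.
Qed.

Lemma preserving_opp (R : realType) : preserving (@lebesgue_measure R) (-%R)%R.
Proof.
have mf : measurable_fun setT (-%R : R -> R)%R by exact: oppr_measurable.
split=> // A mA.
suff : pushforward (@lebesgue_measure R) (-%R)%R A = lebesgue_measure A by [].
symmetry; apply: (lebesgue_measure_unique (mu := pushforward (@lebesgue_measure R)
   (-%R : measurableTypeR R -> measurableTypeR R)%R)) => // _ [[u v] _ <-] /=.
rewrite /pushforward.
have -> : (-%R @^-1` `]u, v] = `[(- v)%R, (- u)%R[ :> set R)%classic.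
  by apply/seteqP; split => x /=; rewrite !in_itv /= lerNl ltrNr andbC.
rewrite !lebesgue_measure_itv /= !lte_fin ltrN2; case: ifP => // _.
by rewrite -!EFinB; congr EFin; rewrite opprK addrC.
Qed.

Lemma preserving_comp d (T : measurableType d) (R : realType)
    (mu : set T -> \bar R) f g :
  preserving mu f -> preserving mu g -> preserving mu (f \o g).
Proof.
move=> [mf fP] [mg gP]; split; first exact: measurableT_comp.
move=> A mA; rewrite comp_preimage gP ?fP //.
by rewrite -[X in measurable X]setTI; exact: mf.
Qed.

(* Canonical inference finds the sigma-finiteness of [m1 \x m2] only for
   subprobabilities, hence this alias. *)
Section SigmaFiniteProduct.
Context d1 d2 (T1 : measurableType d1) (T2 : measurableType d2) (R : realType).
Variable m1 : {sigma_finite_measure set T1 -> \bar R}.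
Variable m2 : {sigma_finite_measure set T2 -> \bar R}.

Definition sigma_finite_product : set (T1 * T2)%type -> \bar R := m1 \x m2.

HB.instance Definition _ := Measure.on sigma_finite_product.

Let sigma_finite_productT : sigma_finite setT sigma_finite_product.
Proof.
have [F FT Ffin] := sigma_finiteT m1; have [G GT Gfin] := sigma_finiteT m2.
(* The rectangles are enumerated through codes of pairs; a number that codes no pair gives the empty
   set. *)
exists (fun k => if unpickle k is Some (i, j) then F i `*` G j else set0).
  apply/seteqP; split=> // -[x y] _.
  have : setT x by []; have : setT y by [].
  rewrite FT GT => -[j _ Gy] [i _ Fx]; exists (pickle (i, j)) => //=.
  by rewrite pickleK.
move=> k; case: unpickle => [[i j]|]; last by rewrite measure0.
have [mF Foo] := Ffin i; have [mG Goo] := Gfin j.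
split; first exact: measurableX.
by rewrite [X in X < _]product_measure1E // lte_mul_pinfty // ge0_fin_numE.
Qed.

HB.instance Definition _ := Measure_isSigmaFinite.Build _ _ _
  sigma_finite_product sigma_finite_productT.

End SigmaFiniteProduct.

Section Fibres.
Context d1 d2 (T1 : measurableType d1) (T2 : measurableType d2) (R : realType).
Variable m1 : {sigma_finite_measure set T1 -> \bar R}.
Variable m2 : {sigma_finite_measure set T2 -> \bar R}.

(** The product measure integrates the measures of the sections, and each section is only moved by
    the preserving map [phi x]. *)
Lemma preserving_snd (phi : T1 -> T2 -> T2) :
  measurable_fun setT (fun z => phi z.1 z.2) ->
  (forall x, preserving m2 (phi x)) ->
  preserving (m1 \x m2) (fun z => (z.1, phi z.1 z.2)).
Proof.
move=> mphi phiP; split.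
  exact: measurable_fun_pair.
move=> A mA; apply: eq_integral => x _ /=.
rewrite -((phiP x).2 (xsection A x)); last exact: measurable_xsection.
by congr (m2 _); apply/seteqP; split=> y /=; rewrite /xsection /= !inE.
Qed.

(** The other order of integration gives access to sections along the first factor. *)
Lemma product_measure12 A : measurable A -> (m1 \x m2) A = (m1 \x^ m2) A.
Proof.
by move=> mA; apply: product_measure_unique => //= ? ? ? ?;
  rewrite product_measure2E.
Qed.

Lemma preserving_fst (phi : T2 -> T1 -> T1) :
  measurable_fun setT (fun z => phi z.2 z.1) ->
  (forall y, preserving m1 (phi y)) ->
  preserving (m1 \x m2) (fun z => (phi z.2 z.1, z.2)).
Proof.
move=> mphi phiP.
have mf : measurable_fun setT (fun z : T1 * T2 => (phi z.2 z.1, z.2)).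
  exact: measurable_fun_pair.
split=> // A mA; rewrite !product_measure12 //; last first.
  by rewrite -[X in measurable X]setTI; exact: mf.
apply: eq_integral => y _ /=.
rewrite -((phiP y).2 (ysection A y)); last exact: measurable_ysection.
by congr (m1 _); apply/seteqP; split=> x /=; rewrite /ysection /= !inE.
Qed.

Lemma preserving_lift2 (g : T1 * T2 -> T2) : measurable_fun setT g ->
  (forall x, preserving m2 (fun y => g (x, y))) ->
  preserving (m1 \x m2) (fun z => (z.1, g z)).
Proof.
move=> mg gP.
have -> : (fun z => (z.1, g z)) = (fun z => (z.1, g (z.1, z.2))).
  by apply/funext => -[].
apply: (preserving_snd (phi := fun x y => g (x, y))) => //.
by have -> : (fun z => g (z.1, z.2)) = g by apply/funext => -[].
Qed.

Lemma preserving_lift1 (g : T1 * T2 -> T1) : measurable_fun setT g ->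
  (forall y, preserving m1 (fun x => g (x, y))) ->
  preserving (m1 \x m2) (fun z => (g z, z.2)).
Proof.
move=> mg gP.
have -> : (fun z => (g z, z.2)) = (fun z => (g (z.1, z.2), z.2)).
  by apply/funext => -[].
apply: (preserving_fst (phi := fun y x => g (x, y))) => //.
by have -> : (fun z => g (z.1, z.2)) = g by apply/funext => -[].
Qed.

End Fibres.
Arguments preserving_lift1 {d1 d2 T1 T2 R m1 m2 g}.
Arguments preserving_lift2 {d1 d2 T1 T2 R m1 m2 g}.

(** Integration of a linear identity between indicator functions. The cuttings, Girard's formula and
    the five-term relation below all come from it. *)
Lemma sum_measure_indic d (T : measurableType d) (R : realType)
    (m : {measure set T -> \bar R}) (D : set T) (I : finType) (c : I -> R)
    (b : I -> T -> bool) (n : R) :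
  measurable D -> m D < +oo -> (forall i, measurable [set x | b i x]) ->
  (forall x, D x -> (\sum_i c i * (b i x)%:R = n)%R) ->
  (\sum_i c i * fine (m ([set x | b i x] `&` D)) = n * fine (m D))%R.
Proof.
move=> mD Dfin mb sumb.
have int1 i : m.-integrable D (EFin \o \1_[set x | b i x]).
  apply/integrableP; split.
    by apply/measurable_EFinP; exact: measurable_indic.
  apply: le_lt_trans Dfin; rewrite -[leRHS]mul1e -integral_cst //.
  apply: ge0_le_integral => //.
    by apply: measurableT_comp => //; apply/measurable_EFinP; exact: measurable_indic.
  by move=> x _; rewrite /= lee_fin indicE ger0_norm // lern1 leq_b1.
(* Integrability is carried through the induction because additivity of the integral requires it. *)
have intc (r : seq I) : m.-integrable D
    (EFin \o (fun x => \sum_(i <- r) c i * \1_[set y | b i y] x)%R) /\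
  (\sum_(i <- r) c i * fine (m ([set x | b i x] `&` D)) = (\int[m]_(x in D)
    (\sum_(i <- r) c i * \1_[set y | b i y] x)))%R.
  elim: r => [|i r [IHi IHe]].
    split; first by under eq_fun do rewrite big_nil; exact: integrable0.
    by rewrite big_nil; under eq_Rintegral do rewrite big_nil;
      rewrite Rintegral_cst // mul0r.
  have ici : m.-integrable D (EFin \o (fun x => c i * \1_[set y | b i y] x)%R).
    have -> : EFin \o (fun x => c i * \1_[set y | b i y] x)%R =
        (fun x => (c i)%:E * (EFin \o \1_[set y | b i y]) x).
      by apply/funext => x; rewrite /= EFinM.
    exact: integrableZl.
  split.
    have -> : EFin \o (fun x => \sum_(j <- i :: r) c j * \1_[set y | b j y] x)%R
      = (EFin \o (fun x => c i * \1_[set y | b i y] x)%R)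
        \+ (EFin \o (fun x => \sum_(j <- r) c j * \1_[set y | b j y] x)%R).
      by apply/funext => x /=; rewrite big_cons EFinD.
    exact: integrableD.
  rewrite big_cons; under eq_Rintegral do rewrite big_cons.
  rewrite RintegralD // RintegralZl // -IHe; congr (_ * _ + _)%R.
  by rewrite /Rintegral integral_indic.
have [_ ->] := intc (index_enum I).
rewrite -Rintegral_cst //; apply: eq_Rintegral => x; rewrite inE => Dx.
rewrite -(sumb _ Dx); apply: eq_bigr => i _.
rewrite indicE; congr (_ * _%:R)%R; congr nat_of_bool.
by apply/idP/idP; rewrite inE.
Qed.

Section FourFactors.
Context d1 d2 d3 d4 (T1 : measurableType d1) (T2 : measurableType d2)
  (T3 : measurableType d3) (T4 : measurableType d4) (R : realType).
Variable m1 : {sigma_finite_measure set T1 -> \bar R}.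
Variable m2 : {sigma_finite_measure set T2 -> \bar R}.
Variable m3 : {sigma_finite_measure set T3 -> \bar R}.
Variable m4 : {sigma_finite_measure set T4 -> \bar R}.

Let measurable11 : measurable_fun setT (fun x : T1 * T2 * T3 => x.1.1).
Proof. exact: measurableT_comp measurable_fst measurable_fst. Qed.

Let measurable12 : measurable_fun setT (fun x : T1 * T2 * T3 => x.1.2).
Proof. exact: measurableT_comp measurable_snd measurable_fst. Qed.

Let measurable_fst_comp d (T : measurableType d) (f : T1 * T2 * T3 -> T) :
  measurable_fun setT f ->
  measurable_fun setT (fun x : T1 * T2 * T3 * T4 => f x.1).
Proof. by move=> mf; exact: measurableT_comp mf measurable_fst. Qed.

Let m12 : {sigma_finite_measure set (T1 * T2)%type -> \bar R} := sigma_finite_product m1 m2.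
Let m123 : {sigma_finite_measure set (T1 * T2 * T3)%type -> \bar R} := sigma_finite_product m12 m3.

(** The product is nested to the left, so the map is reached by freezing the fourth coordinate, then
    the third, then the second. *)
Lemma preserving_coord1 (g : T1 * T2 * T3 * T4 -> T1) : measurable_fun setT g ->
  (forall x y z, preserving m1 (fun t => g (t, x, y, z))) ->
  preserving (m1 \x m2 \x m3 \x m4) (fun x => (g x, x.1.1.2, x.1.2, x.2)).
Proof.
move=> mg gP; apply: (@preserving_lift1 _ _ _ _ _ m123 m4
  (fun x => (g x, x.1.1.2, x.1.2))).
  apply: measurable_fun_pair; last exact: measurable_fst_comp.
  apply: measurable_fun_pair => //.
  exact: (@measurable_fst_comp _ _ (fun x => x.1.2)).
move=> z; apply: (@preserving_lift1 _ _ _ _ _ m12 m3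
  (fun x => (g (x, z), x.1.2))).
  by apply: measurable_fun_pair => //; exact: measurable_fun_pair1.
move=> y; apply: (@preserving_lift1 _ _ _ _ _ m1 m2 (fun x => g (x, y, z))) => //.
by apply: (measurable_fun_pair1 (f := fun x => g (x, z)));
  exact: measurable_fun_pair1.
Qed.

Lemma preserving_coord2 (g : T1 * T2 * T3 * T4 -> T2) : measurable_fun setT g ->
  (forall x y z, preserving m2 (fun t => g (x, t, y, z))) ->
  preserving (m1 \x m2 \x m3 \x m4) (fun x => (x.1.1.1, g x, x.1.2, x.2)).
Proof.
move=> mg gP; apply: (@preserving_lift1 _ _ _ _ _ m123 m4
  (fun x => (x.1.1.1, g x, x.1.2))).
  apply: measurable_fun_pair; last exact: measurable_fst_comp.
  apply: measurable_fun_pair => //.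
  exact: (@measurable_fst_comp _ _ (fun x => x.1.1)).
move=> z; apply: (@preserving_lift1 _ _ _ _ _ m12 m3
  (fun x => (x.1.1, g (x, z)))).
  by apply: measurable_fun_pair => //; exact: measurable_fun_pair1.
move=> y; apply: (@preserving_lift2 _ _ _ _ _ m1 m2 (fun x => g (x, y, z))) => //.
by apply: (measurable_fun_pair1 (f := fun x => g (x, z)));
  exact: measurable_fun_pair1.
Qed.

Lemma preserving_coord3 (g : T1 * T2 * T3 * T4 -> T3) : measurable_fun setT g ->
  (forall x y z, preserving m3 (fun t => g (x, y, t, z))) ->
  preserving (m1 \x m2 \x m3 \x m4) (fun x => (x.1.1, g x, x.2)).
Proof.
move=> mg gP; apply: (@preserving_lift1 _ _ _ _ _ m123 m4
  (fun x => (x.1.1, g x))).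
  by apply: measurable_fun_pair => //; exact: measurable_fst_comp.
move=> z; apply: (@preserving_lift2 _ _ _ _ _ m12 m3 (fun x => g (x, z))).
  exact: measurable_fun_pair1.
by move=> [x y]; exact: gP.
Qed.

Lemma preserving_coord4 (g : T1 * T2 * T3 * T4 -> T4) : measurable_fun setT g ->
  (forall x y z, preserving m4 (fun t => g (x, y, z, t))) ->
  preserving (m1 \x m2 \x m3 \x m4) (fun x => (x.1, g x)).
Proof.
by move=> mg gP; apply: (@preserving_lift2 _ _ _ _ _ m123 m4 g) => // -[[x y] z]; exact: gP.
Qed.

End FourFactors.
End MeasurePreserving.

(** * Linear maps and Lebesgue measure on E^4 *)

Section LinearVolume.
Context {R : realType}.
Implicit Types (E : set 'rV[R]_4) (A B : 'M[R]_4).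
Local Notation R4 := (measurableTypeR R * measurableTypeR R *
  measurableTypeR R * measurableTypeR R)%type.

Definition vec4_of (x : R4) : 'rV[R]_4 := vec4 x.1.1.1 x.1.1.2 x.1.2 x.2.
Definition of_vec4 (v : 'rV[R]_4) : R4 := (v 0 0, v 0 1, v 0 2, v 0 3).

Lemma ord4P (P : 'I_4 -> Prop) : P 0 -> P 1 -> P 2 -> P 3 -> forall i, P i.
Proof.
move=> P0 P1 P2 P3 [[|[|[|[|//]]]] h].
- by have -> : Ordinal h = 0 by apply/val_inj.
- by have -> : Ordinal h = 1 by apply/val_inj.
- by have -> : Ordinal h = 2 by apply/val_inj.
- by have -> : Ordinal h = 3 by apply/val_inj.
Qed.

Lemma sum4 (V : nmodType) (F : 'I_4 -> V) :
  \sum_i F i = F 0 + F 1 + F 2 + F 3.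
Proof.
rewrite !big_ord_recr big_ord0 /= add0r.
by congr (F _ + F _ + F _ + F _); apply/val_inj.
Qed.

Lemma of_vec4K v : vec4_of (of_vec4 v) = v.
Proof. by apply/rowP; apply: ord4P; rewrite /vec4_of /vec4 !mxE. Qed.

Lemma mulmx_col_coord (v : 'rV[R]_4) A i : (v *m A) 0 i = (v *m col i A) 0 0.
Proof. by rewrite !mxE; apply: eq_bigr => k _; rewrite mxE. Qed.

Definition measurable4 E := measurable (vec4_of @^-1` E).
Definition mu4 E : \bar R := lebesgue4 (vec4_of @^-1` E).

Lemma measurable_vec4_of i : measurable_fun setT (fun x => vec4_of x 0 i).
Proof.
have m11 : measurable_fun setT (fun x : R4 => x.1.1).
  exact: measurableT_comp.
have m1 : measurable_fun setT (fun x : R4 => x.1) by exact: measurable_fst.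
move: i; apply: ord4P; rewrite /vec4_of /vec4;
  under eq_fun do rewrite mxE /=.
- exact: (measurableT_comp measurable_fst m11).
- exact: (measurableT_comp measurable_snd m11).
- exact: (measurableT_comp measurable_snd m1).
- exact: measurable_snd.
Qed.

Lemma measurable_linform (f : 'cV[R]_4) :
  measurable_fun setT (fun x => (vec4_of x *m f) 0 0).
Proof.
under eq_fun do rewrite mxE.
apply: measurable_sum => i; apply: measurable_funM => //.
exact: measurable_vec4_of.
Qed.

Lemma measurable_mulmx A : measurable_fun setT (fun x => of_vec4 (vec4_of x *m A)).
Proof.
have mA i : measurable_fun setT (fun x => (vec4_of x *m A) 0 i).
  by under eq_fun do rewrite mulmx_col_coord; exact: measurable_linform.
rewrite /of_vec4; do 3! [apply: measurable_fun_pair; last exact: mA].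
exact: mA.
Qed.

Lemma measurable4_mul E A : measurable4 E -> measurable4 [set x | E (x *m A)].
Proof.
rewrite /measurable4 => mE.
have -> : vec4_of @^-1` [set x | E (x *m A)] =
    (fun x => of_vec4 (vec4_of x *m A)) @^-1` (vec4_of @^-1` E).
  by apply/seteqP; split=> x /=; rewrite of_vec4K.
by rewrite -[X in measurable X]setTI; exact: measurable_mulmx.
Qed.

Definition volume_preserving A :=
  forall E, measurable4 E -> mu4 [set x | E (x *m A)] = mu4 E.

Lemma volume_preservingM A B :
  volume_preserving A -> volume_preserving B -> volume_preserving (A *m B).
Proof.
move=> pA pB E mE; rewrite -(pB _ mE) -(pA _ (measurable4_mul B mE)).
by congr mu4; apply/seteqP; split=> x /=; rewrite mulmxA.
Qed.

Lemma preserving_affine (e : bool) (b : R) :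
  preserving (@lebesgue_measure R) (fun t => (-1) ^+ e * t + b).
Proof.
case: e; last first.
  by under eq_fun do rewrite expr0 mul1r; exact: preserving_translation.
under eq_fun do rewrite expr1 mulN1r.
exact: (preserving_comp (preserving_translation b) (@preserving_opp R)).
Qed.

(** Only the [i]-th coordinate changes, and on each line parallel to that axis the map is a sign
    change followed by a translation. Reflections and shears are both of this form. *)
Lemma volume_preserving_coord A (i : 'I_4) (e : bool) :
  (forall k l, k != i -> A l k = (l == k)%:R) -> A i i = (-1) ^+ e ->
  volume_preserving A.
Proof.
move=> Ak Aii E mE.
pose g := fun x => (vec4_of x *m A) 0 i.
have mg : measurable_fun setT g.
  by rewrite /g; under eq_fun do rewrite mulmx_col_coord; exact: measurable_linform.
have Ak' k x : k != i -> (vec4_of x *m A) 0 k = vec4_of x 0 k.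
  move=> ki; rewrite mxE (bigD1 k) //= Ak // eqxx mulr1 big1 ?addr0 // => l lk.
  by rewrite Ak // (negPf lk) mulr0.
suff [_ pr] : preserving (@lebesgue4 R) (fun x => of_vec4 (vec4_of x *m A)).
  rewrite /mu4 -[RHS]pr //; congr lebesgue4.
  by apply/seteqP; split=> x /=; rewrite of_vec4K.
have gE x : g x = \sum_l vec4_of x 0 l * A l i by rewrite /g mxE.
pose lam : {sigma_finite_measure set (measurableTypeR R) -> \bar R} :=
  @lebesgue_measure R.
move: i Aii g mg Ak' gE {Ak}; apply: ord4P => Aii g mg Ak' gE.
- have -> : (fun x => of_vec4 (vec4_of x *m A)) = (fun x => (g x, x.1.1.2, x.1.2, x.2)).
    by apply/funext => x; rewrite /of_vec4 (Ak' 1) // (Ak' 2) // (Ak' 3) //;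
    congr (_, _, _, _); rewrite // /vec4_of /vec4 mxE.
  apply: (@preserving_coord1 _ _ _ _ _ _ _ _ R lam lam lam lam g mg) => a b c.
  have -> : (fun t => g (t, a, b, c)) = (fun t => (-1) ^+ e * t +
      (a * A 1 0 + b * A 2 0 + c * A 3 0)).
    by apply/funext => t; rewrite gE sum4 Aii /vec4_of /vec4 !mxE /=; ring.
  exact: preserving_affine.
- have -> : (fun x => of_vec4 (vec4_of x *m A)) = (fun x => (x.1.1.1, g x, x.1.2, x.2)).
    by apply/funext => x; rewrite /of_vec4 (Ak' 0) // (Ak' 2) // (Ak' 3) //;
    congr (_, _, _, _); rewrite // /vec4_of /vec4 mxE.
  apply: (@preserving_coord2 _ _ _ _ _ _ _ _ R lam lam lam lam g mg) => a b c.
  have -> : (fun t => g (a, t, b, c)) = (fun t => (-1) ^+ e * t +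
      (a * A 0 1 + b * A 2 1 + c * A 3 1)).
    by apply/funext => t; rewrite gE sum4 Aii /vec4_of /vec4 !mxE /=; ring.
  exact: preserving_affine.
- have -> : (fun x => of_vec4 (vec4_of x *m A)) = (fun x => (x.1.1, g x, x.2)).
    by apply/funext => -[[[a b] c] d]; rewrite /of_vec4 (Ak' 0) // (Ak' 1) // (Ak' 3) //;
    congr (_, _, _, _); rewrite // /vec4_of /vec4 mxE.
  apply: (@preserving_coord3 _ _ _ _ _ _ _ _ R lam lam lam lam g mg) => a b c.
  have -> : (fun t => g (a, b, t, c)) = (fun t => (-1) ^+ e * t +
      (a * A 0 2 + b * A 1 2 + c * A 3 2)).
    by apply/funext => t; rewrite gE sum4 Aii /vec4_of /vec4 !mxE /=; ring.
  exact: preserving_affine.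
- have -> : (fun x => of_vec4 (vec4_of x *m A)) = (fun x => (x.1, g x)).
    by apply/funext => -[[[a b] c] d]; rewrite /of_vec4 (Ak' 0) // (Ak' 1) // (Ak' 2) //;
    congr (_, _, _, _); rewrite // /vec4_of /vec4 mxE.
  apply: (@preserving_coord4 _ _ _ _ _ _ _ _ R lam lam lam lam g mg) => a b c.
  have -> : (fun t => g (a, b, c, t)) = (fun t => (-1) ^+ e * t +
      (a * A 0 3 + b * A 1 3 + c * A 2 3)).
    by apply/funext => t; rewrite gE sum4 Aii /vec4_of /vec4 !mxE /=; ring.
  exact: preserving_affine.
Qed.

End LinearVolume.

(** * Orthogonal transformations of E^4 *)

Section BallMeasure.
Context {R : realType}.
Implicit Types (E : set 'rV[R]_4) (A B : 'M[R]_4) (u v w f g x : 'rV[R]_4).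

Lemma dotvE u v : dotv u v = \sum_k u 0 k * v 0 k.
Proof. by rewrite /dotv mxE; apply: eq_bigr => k _; rewrite mxE. Qed.

Lemma dotvC u v : dotv u v = dotv v u.
Proof. by rewrite !dotvE; apply: eq_bigr => k _; rewrite mulrC. Qed.

Lemma dotvDl u v w : dotv (u + v) w = dotv u w + dotv v w.
Proof. by rewrite /dotv mulmxDl mxE. Qed.

Lemma dotvZl a u w : dotv (a *: u) w = a * dotv u w.
Proof. by rewrite /dotv -scalemxAl mxE. Qed.

Lemma dotvNl u w : dotv (- u) w = - dotv u w.
Proof. by rewrite /dotv mulNmx mxE. Qed.

Lemma dotv0l w : dotv 0 w = 0.
Proof. by rewrite /dotv mul0mx mxE. Qed.

Lemma dotv_ge0 u : 0 <= dotv u u.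
Proof. by rewrite dotvE sumr_ge0 // => k _; rewrite -expr2 sqr_ge0. Qed.

Lemma dotv_eq0 u : (dotv u u == 0) = (u == 0).
Proof.
apply/eqP/eqP => [|->]; last by rewrite dotv0l.
rewrite dotvE => /psumr_eq0P u0; apply/rowP => k; rewrite mxE.
have /eqP := u0 (fun k _ => sqr_ge0 (u 0 k)) k isT.
by rewrite mulf_eq0 orbb => /eqP.
Qed.

Definition dot_preserving A := forall u v, dotv (u *m A) (v *m A) = dotv u v.

(** Preservation of volume is bundled with orthogonality because it is obtained only for products of
    explicit rotations and reflections. *)
Definition isometry4 A := volume_preserving A /\ dot_preserving A.

Lemma isometry4M A B : isometry4 A -> isometry4 B -> isometry4 (A *m B).
Proof.
move=> [vA dA] [vB dB]; split; first exact: volume_preservingM.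
by move=> u v; rewrite !mulmxA dB dA.
Qed.

Lemma isometry4_1 : isometry4 1%:M.
Proof.
split; last by move=> u v; rewrite !mulmx1.
by move=> E _; congr mu4; apply/seteqP; split=> x /=; rewrite mulmx1.
Qed.

Definition flip_coord (i : 'I_4) : 'M[R]_4 :=
  diag_mx (\row_k (if k == i then -1 else 1)).

Lemma mulmx_diag u (d : 'rV[R]_4) k : (u *m diag_mx d) 0 k = u 0 k * d 0 k.
Proof.
rewrite mxE (bigD1 k) //= !mxE eqxx mulr1n big1 ?addr0 // => l lk.
by rewrite !mxE (negPf lk) mulr0n mulr0.
Qed.

Lemma isometry4_flip i : isometry4 (flip_coord i).
Proof.
split.
  apply: (@volume_preserving_coord R _ i true) => [k l ki|]; rewrite !mxE ?eqxx //.
  by case: (eqVneq l k) => [->|_]; rewrite ?(negPf ki) ?mulr1n ?mulr0n.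
move=> u v; rewrite !dotvE; apply: eq_bigr => k _; rewrite !mulmx_diag mxE.
by case: ifP => _; rewrite ?mulr1 // mulrACA mulrNN !mulr1.
Qed.

Lemma flip_coordE i u k :
  (u *m flip_coord i) 0 k = if k == i then - u 0 k else u 0 k.
Proof. by rewrite mulmx_diag mxE; case: ifP => _; rewrite ?mulrN ?mulr1. Qed.

Definition shear (i j : 'I_4) a : 'M[R]_4 := 1%:M + a *: delta_mx i j.

Lemma volume_preserving_shear i j a : i != j -> volume_preserving (shear i j a).
Proof.
move=> ij; apply: (@volume_preserving_coord R _ j false) => [k l kj|].
  by rewrite !mxE (negPf kj) andbF mulr0 addr0.
by rewrite !mxE eqxx (eq_sym j i) (negPf ij) mulr0 addr0.
Qed.

Definition givens (i j : 'I_4) c s : 'M[R]_4 :=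
  1%:M + (c - 1) *: (delta_mx i i + delta_mx j j)
  + s *: (delta_mx i j - delta_mx j i).

Lemma mulmx_delta u (i j : 'I_4) : u *m delta_mx i j = u 0 i *: delta_mx 0 j.
Proof.
apply/rowP => k; rewrite !mxE (bigD1 i) //= mxE eqxx big1 ?addr0 // => l li.
by rewrite mxE (negPf li) mulr0.
Qed.

Lemma givensE i j c s u k : i != j -> (u *m givens i j c s) 0 k =
  if k == i then c * u 0 i - s * u 0 j
  else if k == j then s * u 0 i + c * u 0 j else u 0 k.
Proof.
move=> ij; rewrite /givens !mulmxDr -!scalemxAr !mulmxDr mulmxN mulmx1.
rewrite !mulmx_delta !mxE.
case: (eqVneq k i) => [->|ki]; first by rewrite (negPf ij) /=; ring.
by case: (eqVneq k j) => [->|kj] /=; ring.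
Qed.

Lemma shearE i j a u k :
  (u *m shear i j a) 0 k = if k == j then u 0 j + a * u 0 i else u 0 k.
Proof.
rewrite /shear mulmxDr -scalemxAr mulmx1 mulmx_delta !mxE.
by case: (eqVneq k j) => [->|_] /=; rewrite ?mulr1 ?mulr0 ?addr0.
Qed.

Lemma mulmx_rowP A B : (forall u, u *m A = u *m B) -> A = B.
Proof.
by move=> AB; apply/row_matrixP => i; rewrite !rowE AB.
Qed.

(** The constant [s / (1 + c)] is the tangent of half the rotation angle, which is infinite for the
    half turn. *)
Lemma givens_shear i j c s : i != j -> 1 + c != 0 -> c ^+ 2 + s ^+ 2 = 1 ->
  givens i j c s = shear i j (s / (1 + c)) *m shear j i (- s)
                   *m shear i j (s / (1 + c)).
Proof.
move=> ij c1 cs; set a := s / (1 + c).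
have as1 : a * s = 1 - c.
  apply: (mulIf c1); rewrite /a mulrAC divfK // -expr2.
  by apply: (addrI (c ^+ 2)); rewrite cs; ring.
have ac : a * c = s - a.
  by rewrite /a; field.
have aas : a * a * s = 2 * a - s by rewrite -mulrA as1 mulrBr ac; ring.
apply: mulmx_rowP => u; apply/rowP => k; rewrite !mulmxA givensE // !shearE.
rewrite !eqxx (negPf ij) (eq_sym j i) (negPf ij).
case: (eqVneq k i) => [->|ki]; rewrite ?(negPf ij); first by ring: as1.
by case: (eqVneq k j) => // _; ring: aas as1.
Qed.

Lemma isometry4_givens i j c s : i != j -> c ^+ 2 + s ^+ 2 = 1 ->
  isometry4 (givens i j c s).
Proof.
move=> ij cs; split; last first.
  move=> u v; rewrite !dotvE (bigD1 i) //= [RHS](bigD1 i) //=.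
  rewrite (bigD1 j) ?(eq_sym j) //= [in RHS](bigD1 j) ?(eq_sym j) //=.
  rewrite !addrA; congr (_ + _).
    rewrite !givensE // !eqxx (eq_sym j) (negPf ij).
    transitivity ((c ^+ 2 + s ^+ 2) * (u 0 i * v 0 i + u 0 j * v 0 j)); first by ring.
    by rewrite cs mul1r.
  by apply: eq_bigr => k /andP[/negPf ki /negPf kj]; rewrite !givensE // ki kj.
have [c1|c1] := eqVneq (1 + c) 0; last first.
  rewrite givens_shear //; apply: volume_preservingM; first apply: volume_preservingM;
  by apply: volume_preserving_shear; rewrite // eq_sym.
(* The half turn, excluded from the factorisation into shears, is the square of this quarter
   turn. *)
have half : volume_preserving (givens i j 0 1).
  rewrite givens_shear ?addr0 ?oner_eq0 //; last by rewrite expr0n expr1n add0r.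
  apply: volume_preservingM; first apply: volume_preservingM;
  by apply: volume_preserving_shear; rewrite // eq_sym.
suff -> : givens i j c s = givens i j 0 1 *m givens i j 0 1.
  exact: volume_preservingM.
have cE : c = -1 by lra.
have sE : s = 0 by move: cs; rewrite cE => s2; apply/eqP; rewrite -sqrf_eq0; apply/eqP; lra.
apply: mulmx_rowP => u; apply/rowP => k; rewrite !mulmxA !givensE //.
rewrite cE sE !eqxx (eq_sym j) (negPf ij).
by case: ifP => _; [|case: ifP => _]; ring.
Qed.

(* [A] is a Givens rotation. *)
Lemma isometry4_annihilate i j u : i != j -> exists A,
  [/\ isometry4 A, (u *m A) 0 j = 0, 0 <= (u *m A) 0 i,
      (forall v k, k != i -> k != j -> (v *m A) 0 k = v 0 k) &
      forall v, v 0 i = 0 -> v 0 j = 0 -> v *m A = v].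
Proof.
move=> ij; pose r := Num.sqrt (u 0 i ^+ 2 + u 0 j ^+ 2).
have r2 : r ^+ 2 = u 0 i ^+ 2 + u 0 j ^+ 2 by rewrite sqr_sqrtr // addr_ge0 ?sqr_ge0.
have [r0|rn0] := eqVneq r 0.
  exists 1%:M; rewrite mulmx1; split => //; first exact: isometry4_1.
  - apply/eqP; rewrite -sqrf_eq0; move/eqP: r2.
    by rewrite r0 expr0n eq_sym paddr_eq0 ?sqr_ge0 // => /andP[].
  - move/eqP: r2; rewrite r0 expr0n eq_sym paddr_eq0 ?sqr_ge0 // sqrf_eq0.
    by move=> /andP[/eqP -> _].
  - by move=> v k _ _; rewrite mulmx1.
  - by move=> v _ _; rewrite mulmx1.
exists (givens i j (u 0 i / r) (- (u 0 j / r))); split.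
- apply: isometry4_givens => //; rewrite sqrrN !expr_div_n -mulrDl -r2.
  by rewrite divff // expf_neq0.
- by rewrite givensE // eqxx (eq_sym j) (negPf ij); field.
- rewrite givensE // eqxx.
  have -> : u 0 i / r * u 0 i - - (u 0 j / r) * u 0 j = r.
    transitivity ((u 0 i ^+ 2 + u 0 j ^+ 2) / r); first by ring.
    by rewrite -r2 expr2 mulfK.
  exact: sqrtr_ge0.
- by move=> v k /negPf ki /negPf kj; rewrite givensE // ki kj.
- move=> v vi vj; apply/rowP => k; rewrite givensE // vi vj !mulr0 subr0 addr0.
  by case: eqVneq => [->|_] //; case: eqVneq => [->|_].
Qed.

Lemma isometry4_axis f : exists2 A, isometry4 A &
  exists2 r, 0 <= r & f *m A = vec4 0 r 0 0.
Proof.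
have [A [iA A0 A1 Ak _]] := @isometry4_annihilate 1 0 f isT.
have [B [iB B2 B1 Bk _]] := @isometry4_annihilate 1 2 (f *m A) isT.
have [C [iC C3 C1 Ck _]] := @isometry4_annihilate 1 3 (f *m A *m B) isT.
exists (A *m B *m C); first by apply: isometry4M => //; exact: isometry4M.
exists ((f *m A *m B *m C) 0 1) => //; rewrite !mulmxA.
apply/rowP; apply: ord4P; rewrite [RHS]mxE //=.
- by rewrite Ck // Bk.
- by rewrite Ck.
Qed.

(** Normal form that makes a dihedral cone a planar matter. The rotations applied after [f] is on
    its axis act on coordinates where [f] vanishes, hence fix it. *)
Lemma isometry4_plane f g : exists A r a b, [/\ isometry4 A, 0 <= r, 0 <= a,
  f *m A = vec4 0 r 0 0 & g *m A = vec4 a b 0 0].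
Proof.
have [A iA [r r0 fA]] := isometry4_axis f.
have [B [iB B2 B0 Bk Bi]] := @isometry4_annihilate 0 2 (g *m A) isT.
have [C [iC C3 C0 Ck Ci]] := @isometry4_annihilate 0 3 (g *m A *m B) isT.
exists (A *m B *m C), r, ((g *m A *m B *m C) 0 0), ((g *m A *m B *m C) 0 1).
split => //; first by apply: isometry4M => //; exact: isometry4M.
  rewrite !mulmxA (Bi (f *m A)) ?fA ?mxE // Ci ?mxE //.
rewrite !mulmxA; apply/rowP; apply: ord4P; rewrite [RHS]mxE //=.
by rewrite Ck.
Qed.

End BallMeasure.

(** * Volumes of cones *)

Definition ball4 {R : realType} : set 'rV[R]_4 := [set x | dotv x x <= 1].

(* Locked to keep unification from unfolding the measure. *)
HB.lock Definition vol {R : realType} (E : set 'rV[R]_4) : R :=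
  fine (mu4 (E `&` ball4)).

Section BallVolume.
Context {R : realType}.
Implicit Types (E : set 'rV[R]_4) (A B : 'M[R]_4) (u v w f g x : 'rV[R]_4).
Local Notation R4 := (measurableTypeR R * measurableTypeR R *
  measurableTypeR R * measurableTypeR R)%type.

Lemma measurable_dotv f : measurable_fun setT (fun x : R4 => dotv f (vec4_of x)).
Proof.
under eq_fun do rewrite dotvC /dotv; exact: measurable_linform.
Qed.

Lemma measurable4_halfspace f : measurable4 [set x | 0 <= dotv f x].
Proof.
have := @measurable_dotv f measurableT _ (measurable_itv `[0, +oo[).
rewrite setTI /measurable4; congr (measurable _); apply/seteqP.
by split=> x /=; rewrite in_itv /= andbT.
Qed.

Lemma measurable4_ball : measurable4 (@ball4 R).
Proof.
have mb : measurable_fun setT (fun x : R4 => dotv (vec4_of x) (vec4_of x)).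
  under eq_fun do rewrite dotvE.
  by apply: measurable_sum => k; apply: measurable_funM; exact: measurable_vec4_of.
have := mb measurableT _ (measurable_itv `]-oo, 1]).
by rewrite setTI.
Qed.

Lemma measurable4T : measurable4 (setT : set 'rV[R]_4).
Proof. by rewrite /measurable4 preimage_setT. Qed.

Lemma measurable4I E F : measurable4 E -> measurable4 F -> measurable4 (E `&` F).
Proof. by move=> mE mF; rewrite /measurable4 preimage_setI; exact: measurableI. Qed.

Lemma measurable4C E : measurable4 E -> measurable4 (~` E).
Proof. by move=> mE; rewrite /measurable4 preimage_setC; exact: measurableC. Qed.

Lemma measurable4U E F : measurable4 E -> measurable4 F -> measurable4 (E `|` F).
Proof. by move=> mE mF; rewrite /measurable4 preimage_setU; exact: measurableU. Qed.

Lemma measurable4_bigcup (I : finType) (F : I -> set 'rV[R]_4) :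
  (forall i, measurable4 (F i)) -> measurable4 [set x | exists i, F i x].
Proof.
move=> mF; have -> : [set x | exists i, F i x] = \bigcup_(i in [set: I]) F i.
  by apply/seteqP; split=> x [i]; exists i.
rewrite /measurable4 preimage_bigcup.
by apply: fin_bigcup_measurable => [|i _]; [exact: finite_finset|exact: mF].
Qed.

Lemma measurable4_forall (I : finType) (F : I -> set 'rV[R]_4) :
  (forall i, measurable4 (F i)) -> measurable4 [set x | forall i, F i x].
Proof.
move=> mF; rewrite -(setCK [set _ | _]); apply: measurable4C.
have -> : ~` [set x | forall i, F i x] = [set x | exists i, (~` F i) x].
  by apply/seteqP; split=> x /=; [move/existsNP|move=> ?; exact/existsNP].
by apply: measurable4_bigcup => i; exact: measurable4C.
Qed.

Lemma mu4_box (a b : R) : a <= b ->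
  mu4 [set x | forall i, x 0 i \in `[a, b]] = ((b - a) ^+ 4)%:E.
Proof.
move=> ab; rewrite /mu4.
have -> : vec4_of @^-1` [set x | forall i, x 0 i \in `[a, b]] =
    `[a, b] `*` `[a, b] `*` `[a, b] `*` `[a, b].
  apply/seteqP; split=> -[[[x y] z] t] /=; rewrite /vec4_of.
    by move=> h; move: (h 0) (h 1) (h 2) (h 3); rewrite /vec4 !mxE.
  by move=> [[[h0 h1] h2] h3]; apply: ord4P; rewrite /vec4 !mxE.
have mab : measurable `[a, b] by exact: measurable_itv.
have vab : lebesgue_measure `[a, b] = (b - a)%:E.
  rewrite lebesgue_measure_itv /= lte_fin; case: ltP => [_|ba]; first by rewrite -EFinB.
  by have -> : b = a; [apply/le_anti; rewrite ab ba|rewrite subrr].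
have v2 : (@lebesgue_measure R \x @lebesgue_measure R)%E (`[a, b] `*` `[a, b]) =
    ((b - a) ^+ 2)%:E.
  by rewrite product_measure1E //= vab -EFinM.
have v3 : (@lebesgue_measure R \x @lebesgue_measure R \x @lebesgue_measure R)%E
    (`[a, b] `*` `[a, b] `*` `[a, b]) = ((b - a) ^+ 3)%:E.
  rewrite product_measure1E //; last exact: measurableX.
  by rewrite exprSr EFinM; congr (_ * _)%E; [exact: v2|exact: vab].
rewrite /lebesgue4 product_measure1E //; last by do 2 ?apply: measurableX.
by rewrite exprSr EFinM; congr (_ * _)%E; [exact: v3|exact: vab].
Qed.

Lemma mu4_le E F : measurable4 E -> measurable4 F -> E `<=` F -> (mu4 E <= mu4 F)%E.
Proof.
by move=> mE mF EF; apply: le_measure; rewrite ?inE // => x; exact: EF.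
Qed.

Lemma measurable4_box (a b : R) : measurable4 [set x | forall i, x 0 i \in `[a, b]].
Proof.
apply: measurable4_forall => i.
have := @measurable_vec4_of R i measurableT _ (measurable_itv `[a, b]).
by rewrite setTI.
Qed.

Lemma mu4_ball_fin : (mu4 (@ball4 R) < +oo)%E.
Proof.
apply: (@le_lt_trans _ _ (mu4 [set x | forall i, x 0 i \in `[(-1), 1]])).
  apply: mu4_le; [exact: measurable4_ball|exact: measurable4_box|].
  move=> x; rewrite /ball4 /= dotvE => x1 i; rewrite in_itv /=.
  rewrite -ler_norml -(@ler_pXn2r _ 2) ?nnegrE // expr1n real_normK ?num_real //.
  apply: le_trans x1; rewrite (bigD1 i) //= -expr2 lerDl sumr_ge0 // => k _.
  by rewrite -expr2 sqr_ge0.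
by rewrite mu4_box ?ltry //; lra.
Qed.

Lemma mu4_fin E : measurable4 E -> mu4 (E `&` ball4) \is a fin_num.
Proof.
move=> mE; rewrite ge0_fin_numE; last exact: measure_ge0.
apply: le_lt_trans mu4_ball_fin; apply: mu4_le; last by move=> x [].
  by apply: measurable4I => //; exact: measurable4_ball.
exact: measurable4_ball.
Qed.

Lemma vol_gt0 : 0 < vol (setT : set 'rV[R]_4).
Proof.
rewrite vol.unlock fine_gt0 //; apply/andP; split; last first.
  by rewrite -ge0_fin_numE ?mu4_fin ?measure_ge0 //; exact: measurable4T.
(* The farthest corner of this cube has norm 1, so the cube lies in the ball. *)
apply: (@lt_le_trans _ _ (mu4 [set x | forall i, x 0 i \in `[0, 2^-1]])).
  by rewrite mu4_box ?lte_fin ?exprn_gt0 ?subr0 ?invr_ge0 // invr_gt0.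
apply: mu4_le; [exact: measurable4_box| |].
  by apply: measurable4I; [exact: measurable4T|exact: measurable4_ball].
move=> x h; split => //; rewrite /ball4 /= dotvE sum4.
have {}h i : x 0 i * x 0 i <= 4^-1.
  have := h i; rewrite in_itv /= => /andP[h0 h1].
  have -> : (4^-1 : R) = 2^-1 * 2^-1 by field.
  by apply: ler_pM.
have := h 0; have := h 1; have := h 2; have := h 3; lra.
Qed.

Lemma vol_isometry A E : isometry4 A -> measurable4 E ->
  vol [set x | E (x *m A)] = vol E.
Proof.
move=> [vA dA] mE; rewrite vol.unlock -(vA (E `&` ball4)); last first.
  by apply: measurable4I => //; exact: measurable4_ball.
by congr (fine (mu4 _)); apply/seteqP; split=> x /= [Ex]; rewrite /ball4 /= dA.
Qed.

Lemma vol_ge0 E : 0 <= vol E.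
Proof. by rewrite vol.unlock fine_ge0 //; exact: measure_ge0. Qed.

Lemma vol_le E F : measurable4 E -> measurable4 F -> E `<=` F -> vol E <= vol F.
Proof.
move=> mE mF EF; rewrite vol.unlock; apply: fine_le; rewrite ?mu4_fin //.
apply: mu4_le; last by move=> x [/EF].
  by apply: measurable4I => //; exact: measurable4_ball.
by apply: measurable4I => //; exact: measurable4_ball.
Qed.

Definition hyperplane f : set 'rV[R]_4 := [set x | dotv f x = 0].

Lemma measurable4_hyperplane f : measurable4 (hyperplane f).
Proof.
have := @measurable_dotv f measurableT _ (measurable_set1 0).
by rewrite setTI.
Qed.

(** A rotation takes the normal to the second axis, where the hyperplane is a product with one
    factor reduced to a point. *)
Lemma vol_hyperplane f : f != 0 -> vol (hyperplane f) = 0.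
Proof.
move=> f0; have [A iA [r r0 fA]] := isometry4_axis f.
have rn0 : r != 0.
  apply: contra_neq f0 => r0'; apply/eqP; rewrite -dotv_eq0 -iA.2 fA r0'.
  by rewrite dotvE sum4 /vec4 !mxE /= !mul0r !addr0.
have -> : hyperplane f = [set x | hyperplane (f *m A) (x *m A)].
  by apply/seteqP; split=> x; rewrite /hyperplane /= iA.2.
rewrite vol_isometry //; last exact: measurable4_hyperplane.
suff h0 : mu4 (hyperplane (f *m A)) = 0%E.
  rewrite vol.unlock; suff -> : mu4 (hyperplane (f *m A) `&` ball4) = 0%E by [].
  apply/le_anti; rewrite -{1}h0 measure_ge0 andbT.
  apply: mu4_le; last by move=> x [].
    by apply: measurable4I; [exact: measurable4_hyperplane|exact: measurable4_ball].
  exact: measurable4_hyperplane.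
rewrite /mu4; have -> : vec4_of @^-1` hyperplane (f *m A) =
    setT `*` [set 0] `*` setT `*` setT.
  apply/seteqP; split=> -[[[x y] z] t] /=;
    rewrite /hyperplane /= fA dotvE sum4 /vec4_of /vec4 !mxE /= !mul0r !addr0 add0r.
    by move=> /eqP; rewrite mulf_eq0 (negPf rn0) => /eqP ->.
  by move=> [[[_ ->]]]; rewrite mulr0.
have v2 : (@lebesgue_measure R \x @lebesgue_measure R)%E (setT `*` [set 0]) = 0%E.
  by rewrite product_measure1E //= lebesgue_measure_set1 mule0.
have v3 : (@lebesgue_measure R \x @lebesgue_measure R \x @lebesgue_measure R)%E
    (setT `*` [set 0] `*` setT) = 0%E.
  rewrite product_measure1E //; last exact: measurableX.
  by apply/eqP; rewrite mule_eq0; apply/orP; left; apply/eqP; exact: v2.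
rewrite /lebesgue4 product_measure1E //; last by do 2 ?apply: measurableX.
by apply/eqP; rewrite mule_eq0; apply/orP; left; apply/eqP; exact: v3.
Qed.

Lemma vol_setU0 E Z : measurable4 E -> measurable4 Z -> vol Z = 0 ->
  vol (E `\` Z) = vol E.
Proof.
move=> mE mZ Z0.
have mB (F : set 'rV[R]_4) : measurable4 F -> measurable4 (F `&` ball4).
  by move=> mF; apply: measurable4I => //; exact: measurable4_ball.
have mu0 : mu4 (Z `&` ball4) = 0%E.
  by move/eqP: Z0; rewrite vol.unlock fine_eq0 ?mu4_fin // => /eqP.
rewrite vol.unlock; congr fine; apply/le_anti/andP; split.
  apply: mu4_le; [|exact: mB|by move=> x [[]]].
  by apply: mB; apply: measurable4I => //; exact: measurable4C.
apply: (@le_trans _ _ (mu4 (((E `\` Z) `&` ball4) `|` (Z `&` ball4)))).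
  apply: mu4_le; [exact: mB| |].
    apply: measurable4U; last exact: mB.
    by apply: mB; apply: measurable4I => //; exact: measurable4C.
  by move=> x [Ex Bx]; have [Zx|Zx] := pselect (Z x); [right|left].
rewrite /mu4 preimage_setU.
pose lam4 : {measure set R4 -> \bar R} := @lebesgue4 R.
rewrite -[leRHS]adde0 -mu0.
apply: (@measureU2 _ _ _ lam4); last exact: mB.
by apply: mB; apply: measurable4I => //; exact: measurable4C.
Qed.

(** The exceptional null set [Z] is needed because closed cones with a common facet overlap in it,
    and the indicator identities fail there. *)
Lemma vol_sum (I : finType) (c : I -> R) (b : I -> 'rV[R]_4 -> bool) (n : R)
    (Z : set 'rV[R]_4) :
  (forall i, measurable4 [set x | b i x]) -> measurable4 Z -> vol Z = 0 ->
  (forall x, ball4 x -> ~ Z x -> \sum_i c i * (b i x)%:R = n) ->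
  \sum_i c i * vol [set x | b i x] = n * vol setT.
Proof.
move=> mb mZ Z0 sumb.
pose lam4 : {measure set R4 -> \bar R} := @lebesgue4 R.
pose D := vec4_of @^-1` (ball4 `\` Z).
have mD : measurable D.
  by apply: measurable4I; [exact: measurable4_ball|exact: measurable4C].
have Dfin : (lam4 D < +oo)%E.
  apply: le_lt_trans mu4_ball_fin; apply: mu4_le; last by move=> x [].
    exact: mD.
  exact: measurable4_ball.
have volE (E : set 'rV[R]_4) : measurable4 E ->
    vol E = fine (lam4 (vec4_of @^-1` E `&` D)).
  move=> mE; rewrite -(vol_setU0 mE mZ Z0) vol.unlock; congr (fine (lebesgue4 _)).
  by apply/seteqP; split=> x [] => [[Ex Zx] Bx|Ex [Bx Zx]].
rewrite volE; last exact: measurable4T.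
under eq_bigr => i _ do rewrite volE //.
rewrite preimage_setT setTI; apply: sum_measure_indic => // x [Bx Zx].
by rewrite -(sumb _ Bx Zx).
Qed.

End BallVolume.

(** * Nonnegative additive functions on an interval *)

Section AdditiveLinear.
Context {R : realType}.

(** Nonnegativity makes [h] monotone; squeezing [a] between consecutive multiples of [L / n.+1]
    bounds the deviation from linearity by [h L / n.+1]. *)
Lemma nonneg_additive_linear (h : R -> R) (L : R) :
  (forall a, 0 < a <= L -> 0 <= h a) ->
  (forall a b, 0 < a -> 0 < b -> a + b <= L -> h (a + b) = h a + h b) ->
  forall a, 0 < a <= L -> h a = h L * (a / L).
Proof.
move=> h0 hD a /andP[a0 aL]; have L0 : 0 < L by exact: lt_le_trans aL.
have hmono u v : 0 < u -> u <= v -> v <= L -> h u <= h v.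
  move=> u0; rewrite le_eqVlt => /predU1P[->//|uv] vL.
  rewrite -[v](subrK u) addrC hD ?subr_gt0 //; last by rewrite addrC subrK.
  rewrite lerDl h0 // subr_gt0 uv /=; lra.
have hM k t : 0 < t -> k.+1%:R * t <= L -> h (k.+1%:R * t) = k.+1%:R * h t.
  move=> t0; elim: k => [|k IHk] kL; first by rewrite !mul1r.
  rewrite -[in LHS]natr1 mulrDl mul1r hD ?IHk //.
  - by rewrite -[in RHS]natr1; ring.
  - by apply: le_trans kL; rewrite ler_pM2r // ler_nat.
  - by rewrite mulr_gt0.
  - by apply: le_trans kL; rewrite -[in leRHS]natr1 mulrDl mul1r.
have [->|aneL] := eqVneq a L; first by rewrite divff ?mulr1 ?gt_eqF.
have {aL}aL : a < L by rewrite lt_neqAle aneL.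
have hL0 : 0 <= h L by rewrite h0 // L0 lexx.
have bound n : `|h a - h L * (a / L)| <= h L / n.+1%:R.
  pose t := L / n.+1%:R; have t0 : 0 < t by rewrite divr_gt0.
  have nt : n.+1%:R * t = L by rewrite mulrC divfK // pnatr_eq0.
  have ht : h t = h L / n.+1%:R.
    by rewrite -nt hM ?nt // mulrAC divff ?mul1r // pnatr_eq0.
  pose k := Num.truncn (a / t).
  have /andP[k1 k2] : k%:R <= a / t < k.+1%:R.
    by apply: truncn_itv; rewrite divr_ge0 ?ltW.
  have kt1 : k%:R * t <= a by rewrite -ler_pdivlMr.
  have kt2 : a < k.+1%:R * t by rewrite -ltr_pdivrMr.
  have kn : (k < n.+1)%N.
    rewrite -(ltr_nat R) -(ltr_pM2r t0) nt; exact: le_lt_trans kt1 aL.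
  have ktL : k.+1%:R * t <= L by rewrite -[leRHS]nt ler_pM2r // ler_nat.
  have up : h a <= k.+1%:R * h t by rewrite -hM //; apply: hmono => //; exact: ltW.
  have lo : k%:R * h t <= h a.
    case: (k) kt1 => [_|j jt]; first by rewrite mul0r h0 // a0 ltW.
    by rewrite -hM //; [apply: hmono => //; [rewrite mulr_gt0|exact: ltW]
                       |exact: le_trans jt (ltW aL)].
  have aL' : a / L = a / t / n.+1%:R.
    have gen (N : R) : N != 0 -> a / L = a / (L / N) / N.
      by move=> N0; field; rewrite N0 gt_eqF.
    by apply: gen; rewrite pnatr_eq0.
  have E : h L * (a / L) = h t * (a / t) by rewrite ht aL'; ring.
  have ht0 : 0 <= h t by rewrite ht divr_ge0.
  rewrite E -ht ler_norml; apply/andP; split.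
    have : h t * (a / t) <= h t * k.+1%:R by rewrite ler_wpM2l // ltW.
    by rewrite -natr1 mulrDr mulr1 => ?; lra.
  have : h t * k%:R <= h t * (a / t) by rewrite ler_wpM2l.
  by move: up; rewrite -natr1 mulrDl mul1r => ? ?; lra.
apply/eqP; rewrite -subr_eq0 -normr_le0.
apply/ler_addgt0Pl => e e0; rewrite addr0.
have [n hn] : exists n : nat, h L / e < n%:R.
  by exists (Num.truncn (h L / e)).+1; apply: truncnS_gt.
apply: le_trans (bound n) _; rewrite ler_pdivrMr // mulrC -ler_pdivrMr //.
by apply: ltW; apply: lt_le_trans hn _; rewrite ler_nat.
Qed.

End AdditiveLinear.

(** * Dihedral and trihedral cones *)

Section Wedges.
Context {R : realType}.
Implicit Types (A B : 'M[R]_4) (u v w f g x : 'rV[R]_4).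

(** On an explicit list [foldr] computes, so hypotheses and conclusion unfold to plain sums with
    coefficients. *)
Lemma vol_sum_seq (s : seq (R * ('rV[R]_4 -> bool))) (n : R) (Z : set 'rV[R]_4) :
  foldr (fun (t : R * ('rV[R]_4 -> bool)) P => measurable4 [set x | t.2 x] /\ P) True s ->
  measurable4 Z -> vol Z = 0 ->
  (forall x, ~ Z x ->
     foldr (fun (t : R * ('rV[R]_4 -> bool)) y => t.1 * (t.2 x)%:R + y) 0 s = n) ->
  foldr (fun (t : R * ('rV[R]_4 -> bool)) y => t.1 * vol [set x | t.2 x] + y) 0 s
  = n * vol setT.
Proof.
move=> ms mZ Z0 sums; pose t0 : R * ('rV[R]_4 -> bool) := (0, xpred0).
have foldrE (F : R * ('rV[R]_4 -> bool) -> R) :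
    foldr (fun t y => F t + y) 0 s = \sum_(i < size s) F (nth t0 s i).
  rewrite -(big_mkord xpredT (fun i => F (nth t0 s i))) -(big_nth t0 xpredT F).
  by rewrite unlock.
rewrite foldrE.
apply: (@vol_sum R _ (fun i : 'I_(size s) => (nth t0 s i).1)
  (fun i : 'I_(size s) => (nth t0 s i).2) n Z) => //.
  move=> [i /= si]; elim: s i si ms {sums foldrE} => [//|t s IHs] [|i] si [mt ms] //.
  exact: IHs.
by move=> x _ Zx; rewrite -(sums x Zx) foldrE.
Qed.

Lemma measurable4_bool2 (b c : 'rV[R]_4 -> bool) : measurable4 [set x | b x] ->
  measurable4 [set x | c x] -> measurable4 [set x | b x && c x].
Proof.
move=> mb mc; have -> : [set x | b x && c x] = [set x | b x] `&` [set x | c x].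
  by apply/seteqP; split=> x /= /andP.
exact: measurable4I.
Qed.

Lemma vol_setU_eq0 E F : measurable4 E -> measurable4 F -> vol E = 0 -> vol F = 0 ->
  vol (E `|` F : set 'rV[R]_4) = 0.
Proof.
move=> mE mF E0 F0; rewrite -[LHS](vol_setU0 (Z := E)) //; last exact: measurable4U.
apply/le_anti; rewrite vol_ge0 andbT -F0; apply: vol_le => //.
  by apply: measurable4I; [exact: measurable4U|exact: measurable4C].
by move=> x [[]].
Qed.

Lemma isometry4N : isometry4 (- 1%:M : 'M[R]_4).
Proof.
have -> : - 1%:M = flip_coord 0 *m flip_coord 1 *m flip_coord 2 *m flip_coord 3 :> 'M[R]_4.
  apply: mulmx_rowP => u; apply/rowP => k; rewrite !mulmxA !flip_coordE.
  by rewrite mulmxN mulmx1 mxE; move: k; apply: ord4P.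
by do 3! [apply: isometry4M; last exact: isometry4_flip]; exact: isometry4_flip.
Qed.

Lemma vol_opp E : measurable4 E -> vol [set x : 'rV[R]_4 | E (- x)] = vol E.
Proof.
move=> mE; rewrite -(vol_isometry isometry4N mE); congr vol.
by apply/seteqP; split=> x /=; rewrite mulmxN mulmx1.
Qed.

Section SignedSums.
Variables (Z : set 'rV[R]_4) (mZ : measurable4 Z) (Z0 : vol Z = 0).
Implicit Types b c d : 'rV[R]_4 -> bool.

Lemma vol_complement b c :
  measurable4 [set x | b x] -> measurable4 [set x | c x] ->
  (forall x, ~ Z x -> c x = ~~ b x) ->
  vol [set x | b x] + vol [set x | c x] = vol setT.
Proof.
move=> mb mc bc; have := @vol_sum_seq [:: (1, b); (1, c)] 1 Z.
rewrite /= !mul1r addr0; apply => // x Zx; rewrite bc //.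
by case: (b x); rewrite /= ?mulr1 ?mulr0 ?addr0 ?add0r.
Qed.

Lemma vol_disjoint b c d :
  measurable4 [set x | b x] -> measurable4 [set x | c x] ->
  measurable4 [set x | d x] ->
  (forall x, ~ Z x -> b x = c x + d x :> nat)%N ->
  vol [set x | b x] = vol [set x | c x] + vol [set x | d x].
Proof.
move=> mb mc md bcd; have := @vol_sum_seq [:: (1, b); (-1, c); (-1, d)] 0 Z.
rewrite /= mul0r !mul1r !mulN1r addr0 => H.
suff : vol [set x | b x] + (- vol [set x | c x] - vol [set x | d x]) = 0 by lra.
by apply: H => // x Zx; rewrite bcd // natrD !mulN1r; ring.
Qed.

(* Girard's argument: an octant and its opposite have the same volume. *)
Lemma vol_octant b c d : let o b x := b (- x) in
  measurable4 [set x | b x] -> measurable4 [set x | c x] ->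
  measurable4 [set x | d x] ->
  (forall x, ~ Z x -> [/\ o b x = ~~ b x, o c x = ~~ c x & o d x = ~~ d x]) ->
  vol [set x | [&& b x, c x & d x]] *+ 2 =
  vol setT - vol [set x | b x] - vol [set x | c x] - vol [set x | d x]
  + vol [set x | b x && c x] + vol [set x | b x && d x] + vol [set x | c x && d x].
Proof.
move=> o mb mc md opp.
pose t x := [&& b x, c x & d x].
have mt : measurable4 [set x | t x] by do 2?apply: measurable4_bool2.
have mo : measurable4 [set x | t (- x)].
  have := measurable4_mul (- 1%:M) mt; congr measurable4.
  by apply/seteqP; split=> x /=; rewrite mulmxN mulmx1.
have volo := vol_opp mt; simpl in volo.
(* Inclusion-exclusion: off [Z] the opposite octant is the complement of the union of [b], [c] and
   [d]. *)
have := @vol_sum_seq [:: (1, t); (1, fun x => t (- x)); (1, b); (1, c); (1, d);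
  (-1, fun x => b x && c x); (-1, fun x => b x && d x); (-1, fun x => c x && d x)]
  1 Z.
rewrite /= volo !mul1r !mulN1r -/t => H.
have {H} : vol [set x | t x] + (vol [set x | t x] + (vol [set x | b x] +
  (vol [set x | c x] + (vol [set x | d x] + (- vol [set x | b x && c x] +
  (- vol [set x | b x && d x] + (- vol [set x | c x && d x] + 0))))))) = vol setT.
  apply: H => //; first by do !split => //; exact: measurable4_bool2.
  move=> x Zx; have [] := opp _ Zx; rewrite /o /t => -> -> ->.
  by case: (b x); case: (c x); case: (d x); rewrite /=; ring.
by rewrite /t mulr2n; lra.
Qed.

End SignedSums.

Definition wedge f g := vol [set x | (0 <= dotv f x) && (0 <= dotv g x)].

Lemma measurable4_wedge f g :
  measurable4 [set x | (0 <= dotv f x) && (0 <= dotv g x)].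
Proof. by apply: measurable4_bool2; exact: measurable4_halfspace. Qed.

Lemma wedge_isometry A f g : isometry4 A -> wedge (f *m A) (g *m A) = wedge f g.
Proof.
move=> iA; rewrite /wedge -(vol_isometry iA (measurable4_wedge _ _)).
by congr vol; apply/seteqP; split=> x /=; rewrite !iA.2.
Qed.

Lemma wedgeZ c d f g : 0 < c -> 0 < d -> wedge (c *: f) (d *: g) = wedge f g.
Proof.
move=> c0 d0; congr vol; apply/seteqP; split=> x /=;
  by rewrite !dotvZl !pmulr_rge0.
Qed.

Lemma dotvNr u v : dotv u (- v) = - dotv u v.
Proof. by rewrite dotvC dotvNl dotvC. Qed.

Lemma halfspace_opp f x : ~ hyperplane f x ->
  (0 <= dotv f (- x)) = ~~ (0 <= dotv f x).
Proof.
rewrite /hyperplane /= dotvNr oppr_ge0 => /eqP.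
by case: (ltgtP 0 (dotv f x)).
Qed.

Lemma vol_halfspace f : f != 0 -> vol [set x | 0 <= dotv f x] = vol setT / 2.
Proof.
move=> f0; have mf := measurable4_halfspace f.
have mo : measurable4 [set x | 0 <= dotv f (- x)].
  by under eq_set do rewrite dotvNr -dotvNl; exact: measurable4_halfspace.
have := vol_complement (measurable4_hyperplane f) (vol_hyperplane f0) mf mo
  (@halfspace_opp f).
by have := vol_opp mf; simpl; lra.
Qed.

Lemma wedgexx f : f != 0 -> wedge f f = vol setT / 2.
Proof. by move=> f0; rewrite -(vol_halfspace f0) /wedge; under eq_set do rewrite andbb. Qed.

(** Chosen so that, for [0 < a <= pi], [wedge (dir pi) (dir a)] is the sector of polar angles from 0
    to [a] in the plane of the first two coordinates. *)
Definition dir (a : R) : 'rV[R]_4 := vec4 (sin a) (- cos a) 0 0.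

Lemma dotv_vec4 (a b c d : R) x :
  dotv (vec4 a b c d) x = a * x 0 0 + b * x 0 1 + c * x 0 2 + d * x 0 3.
Proof. by rewrite dotvE sum4 /vec4 !mxE. Qed.

Lemma dir_neq0 a : dir a != 0.
Proof.
rewrite -dotv_eq0 dotv_vec4 /dir /vec4 !mxE /= mulrNN.
rewrite !mul0r !addr0 -!expr2 addrC cos2Dsin2; exact: oner_neq0.
Qed.

(** The ray at angle [a] cuts the sector in two, and the rotation by [a] takes the sector of angle
    [b] to the second piece. *)
Lemma wedge_dirD a b : 0 < a -> 0 < b -> a + b <= pi ->
  wedge (dir pi) (dir (a + b)) = wedge (dir pi) (dir a) + wedge (dir pi) (dir b).
Proof.
move=> a0 b0 abpi.
have sa : 0 < sin a by apply: sin_gt0_pi => //; lra.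
have sb : 0 < sin b by apply: sin_gt0_pi => //; lra.
have sab : 0 <= sin (a + b) by apply: sin_ge0_pi => //; lra.
pose G : 'M[R]_4 := givens 0 1 (cos a) (sin a).
have iG : isometry4 G by apply: isometry4_givens => //; exact: cos2Dsin2.
have -> : wedge (dir pi) (dir b) = wedge (- dir a) (dir (a + b)).
  rewrite -(wedge_isometry _ _ iG); congr wedge; apply/rowP; apply: ord4P;
  rewrite /G givensE // /dir /vec4 ?sinpi ?cospi ?sinD ?cosD !mxE /=; ring.
apply: (vol_disjoint (measurable4_hyperplane (dir a))).
- by apply: vol_hyperplane; exact: dir_neq0.
- exact: measurable4_wedge.
- exact: measurable4_wedge.
- exact: measurable4_wedge.
move=> x; rewrite /hyperplane /= dotvNl.
(* Linear relation between three coplanar normals. On each side of the cut it makes one of the two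
   outer inequalities imply the other. *)
have : dotv (dir pi) x * sin b =
    dotv (dir (a + b)) x * sin a - dotv (dir a) x * sin (a + b).
  have cs := cos2Dsin2 a.
  rewrite /dir !dotv_vec4 sinpi cospi sinD cosD.
  transitivity ((cos a ^+ 2 + sin a ^+ 2) * sin b * x 0 1); last by ring.
  by rewrite cs; ring.
move: (dotv (dir pi) x) (dotv (dir a) x) (dotv (dir (a + b)) x) => y n m E.
move=> /eqP n0; rewrite oppr_ge0.
case: (ltgtP 0 n) n0 => //= n0 _; rewrite ?andbT ?andbF /=.
  have -> : ((0 <= y) && (0 <= m)) = (0 <= y).
    apply: andb_idr => y0; rewrite -(pmulr_lge0 _ sa).
    have : 0 <= y * sin b by rewrite mulr_ge0 // ltW.
    have : 0 <= n * sin (a + b) by rewrite mulr_ge0 // ltW.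
    by lra.
  by rewrite addn0.
have -> : ((0 <= y) && (0 <= m)) = (0 <= m).
  apply: andb_idl => m0; rewrite -(pmulr_lge0 _ sb) E subr_ge0.
  apply: (@le_trans _ _ 0); last by rewrite mulr_ge0 // ltW.
  by rewrite mulr_le0_ge0 // ltW.
by rewrite add0n.
Qed.

Lemma wedge_dir a : 0 <= a <= pi -> wedge (dir pi) (dir a) = vol setT * (a / (2 * pi)).
Proof.
move=> /andP[]; have p0 := pi_gt0 R; rewrite le_eqVlt => /predU1P[<- _|a0 api].
  rewrite mul0r mulr0; apply/le_anti; rewrite vol_ge0 andbT.
  rewrite -[leRHS](vol_hyperplane (dir_neq0 pi)).
  apply: vol_le; [exact: measurable4_wedge|exact: measurable4_hyperplane|].
  move=> x /= /andP[]; rewrite /hyperplane /= /dir !dotv_vec4 sinpi cospi sin0 cos0.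
  by move=> ? ?; lra.
have /= -> := @nonneg_additive_linear R (fun a => wedge (dir pi) (dir a)) pi
  (fun _ _ => vol_ge0 _) wedge_dirD a.
  rewrite wedgexx ?dir_neq0 //; move: pi p0 {api} => p p0.
  by field; rewrite gt_eqF.
by rewrite a0.
Qed.

(* The dihedral angle of a wedge is supplementary to the angle of its
   inner normals. *)
Lemma wedgeE f g : f != 0 -> g != 0 -> wedge f g = vol setT *
  (acos (- dotv f g / (Num.sqrt (dotv f f) * Num.sqrt (dotv g g))) / (2 * pi)).
Proof.
move=> f0 g0; have [A [r [a [b [iA r0 a0 fA gA]]]]] := isometry4_plane f g.
have ff : dotv f f = r ^+ 2.
  by rewrite -iA.2 fA dotv_vec4 /vec4 !mxE /=; ring.
have gg : dotv g g = a ^+ 2 + b ^+ 2.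
  by rewrite -iA.2 gA dotv_vec4 /vec4 !mxE /=; ring.
have fg : dotv f g = r * b.
  by rewrite -iA.2 fA gA dotv_vec4 /vec4 !mxE /=; ring.
have {}r0 : 0 < r.
  rewrite lt_neqAle r0 andbT; apply: contra_neq f0 => r0'.
  by apply/eqP; rewrite -dotv_eq0 ff -r0' expr0n.
pose q := Num.sqrt (dotv g g).
have q0 : 0 < q by rewrite sqrtr_gt0 lt_neqAle dotv_ge0 eq_sym dotv_eq0 g0.
have q2 : q ^+ 2 = a ^+ 2 + b ^+ 2 by rewrite sqr_sqrtr ?dotv_ge0.
rewrite ff sqrtr_sqr gtr0_norm // -/q fg.
have -> : - (r * b) / (r * q) = - (b / q) by field; rewrite !gt_eqF.
pose t := acos (- (b / q)).
have bq : -1 <= - (b / q) <= 1.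
  rewrite -ler_norml normrN -(@ler_pXn2r _ 2) ?nnegrE // expr1n real_normK ?num_real //.
  by rewrite expr_div_n ler_pdivrMr ?exprn_gt0 // mul1r q2 lerDr sqr_ge0.
have ct : cos t = - (b / q) by rewrite /t acosK // in_itv.
have st : sin t = a / q.
  rewrite /t sin_acos // sqrrN.
  have -> : 1 - (b / q) ^+ 2 = (a / q) ^+ 2.
    rewrite !expr_div_n; apply/eqP; rewrite subr_eq -mulrDl -q2 divff //.
    by rewrite expf_neq0 // gt_eqF.
  by rewrite sqrtr_sqr ger0_norm // divr_ge0 // ltW.
rewrite -/t -wedge_dir; last by rewrite acos_ge0 // acos_lepi.
rewrite -(wedge_isometry _ _ iA) fA gA.
have -> : vec4 0 r 0 0 = r *: dir pi.
  by apply/rowP; apply: ord4P; rewrite /dir /vec4 !mxE /= ?sinpi ?cospi; ring.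
have -> : vec4 a b 0 0 = q *: dir t.
  apply/rowP; apply: ord4P; rewrite /dir /vec4 !mxE /= ?st ?ct ?mulr0 //.
    by rewrite mulrC divfK // gt_eqF.
  by rewrite opprK mulrC divfK // gt_eqF.
exact: wedgeZ.
Qed.

Lemma vol_trihedral f g h : f != 0 -> g != 0 -> h != 0 ->
  vol [set x | [&& 0 <= dotv f x, 0 <= dotv g x & 0 <= dotv h x]] =
  (wedge f g + wedge f h + wedge g h - vol setT / 2) / 2.
Proof.
move=> f0 g0 h0; have mh := @measurable4_hyperplane R.
have mhs := @measurable4_halfspace R.
pose Z := hyperplane f `|` hyperplane g `|` hyperplane h.
have mZ : measurable4 Z by do 2?apply: measurable4U.
have Z0 : vol Z = 0.
  apply: vol_setU_eq0; rewrite ?vol_hyperplane //; first exact: measurable4U.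
  by apply: vol_setU_eq0; rewrite ?vol_hyperplane.
have := vol_octant mZ Z0 (mhs f) (mhs g) (mhs h).
rewrite !vol_halfspace // -!/(wedge _ _) mulr2n => H.
have {H} := H _; set V := vol _; set a := wedge _ _; set b := wedge _ _;
  set c := wedge _ _ => H.
suff : V + V = vol setT - vol setT / 2 - vol setT / 2 - vol setT / 2 + a + b + c by lra.
by apply: H => x /not_orP[/not_orP[fx gx] hx]; split; exact: halfspace_opp.
Qed.

End Wedges.

(** * The five-term relation *)

Section Cones.
Context {R : realType}.
Implicit Types (C : 'M[R]_4) (u v w f g x : 'rV[R]_4).

(* The coordinates of [x] in the basis formed by the rows of [C] are the
   values of the functionals [dual_row C i]. *)
Definition dual_row C (i : 'I_4) : 'rV[R]_4 := row i (invmx C)^T.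

Lemma dotv_dual_row C i x : dotv (dual_row C i) x = (x *m invmx C) 0 i.
Proof. by rewrite dotvE mxE; apply: eq_bigr => k _; rewrite !mxE mulrC. Qed.

Lemma dual_row_neq0 C i : \det C != 0 -> dual_row C i != 0.
Proof.
move=> dC; have uC : C \in unitmx by rewrite unitmxE unitfE.
apply/eqP => d0; have := dotv_dual_row C i (row i C).
rewrite d0 dotv0l -row_mul mulmxV // !mxE eqxx /= => /eqP.
by rewrite eq_sym oner_eq0.
Qed.

Definition cone C x := [forall i, 0 <= dotv (dual_row C i) x].

Lemma measurable4_cone C : measurable4 [set x | cone C x].
Proof.
have -> : [set x | cone C x] = [set x | forall i, 0 <= dotv (dual_row C i) x].
  by apply/seteqP; split=> x /forallP.
by apply: measurable4_forall => i; exact: measurable4_halfspace.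
Qed.

Definition signed_vol C := Num.sg (\det C) * vol [set x | cone C x].

(** A degenerate tetrahedron has sign 0 on both sides. Otherwise a point of the cone in the ball is
    rescaled to the sphere, its barycentric coefficients being the values of the dual rows. *)
Lemma oriented_volume_tetraE C : oriented_volume_tetra C = 4 * signed_vol C.
Proof.
rewrite /oriented_volume_tetra /signed_vol mulrCA.
have [->|dC] := eqVneq (\det C) 0; first by rewrite sgr0 !mul0r.
have uC : C \in unitmx by rewrite unitmxE unitfE.
congr (_ * (_ * _)); rewrite vol.unlock; congr (fine (lebesgue4 _)).
have rescale x : x != 0 -> sphere3 ((Num.sqrt (dotv x x))^-1 *: x).
  move=> x0; rewrite /sphere3 /= dotvZl dotvC dotvZl mulrA -expr2 exprVn.
  by rewrite sqr_sqrtr ?dotv_ge0 // mulVf // dotv_eq0.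
apply/seteqP; split=> x; rewrite /preimage /= -/(vec4_of x).
  move=> [r [u [/andP[r0 r1] [su [t [t0 uE]]] ->]]]; split.
    apply/forallP => i; rewrite dotvC dotvZl dotvC dotv_dual_row uE mulmxK //.
    by rewrite mulr_ge0.
  by rewrite /ball4 /= dotvZl dotvC dotvZl su mulr1 mulr_ile1.
move=> [/forallP xC x1]; have [x0|x0] := eqVneq (vec4_of x) 0.
  have r0 : row 0 C != 0.
    apply/eqP => C0; have := dual_row_neq0 0 dC; rewrite -dotv_eq0.
    have := dotv_dual_row C 0 (row 0 C).
    by rewrite -row_mul mulmxV // C0 dotvC dotv0l !mxE eqxx /= => /eqP;
      rewrite eq_sym oner_eq0.
  (* At the origin the radius is 0, but a point of the tetrahedron must still be given: a normalised
     vertex. *)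
  exists 0, ((Num.sqrt (dotv (row 0 C) (row 0 C)))^-1 *: row 0 C).
  rewrite lexx ler01 scale0r x0; split => //; split; first exact: rescale.
  exists ((Num.sqrt (dotv (row 0 C) (row 0 C)))^-1 *: delta_mx 0 0).
  rewrite -scalemxAl -rowE; split => // i; rewrite mxE.
  by apply: mulr_ge0; rewrite ?invr_ge0 ?sqrtr_ge0 // mxE ler0n.
exists (Num.sqrt (dotv (vec4_of x) (vec4_of x))).
exists ((Num.sqrt (dotv (vec4_of x) (vec4_of x)))^-1 *: vec4_of x).
have n0 : Num.sqrt (dotv (vec4_of x) (vec4_of x)) != 0.
  by rewrite sqrtr_eq0 -ltNge lt_neqAle dotv_ge0 eq_sym dotv_eq0 x0.
rewrite scalerA divff // scale1r; split => //.
  by rewrite sqrtr_ge0 -[leRHS]sqrtr1 ler_wsqrtr.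
split; first exact: rescale.
exists ((Num.sqrt (dotv (vec4_of x) (vec4_of x)))^-1 *: (vec4_of x *m invmx C)).
rewrite -scalemxAl mulmxKV //; split => // i.
by rewrite mxE mulr_ge0 ?invr_ge0 ?sqrtr_ge0 // -dotv_dual_row.
Qed.

Lemma vol_exists_eq0 (I : finType) (F : I -> set 'rV[R]_4) :
  (forall i, measurable4 (F i)) -> (forall i, vol (F i) = 0) ->
  vol [set x | exists i, F i x] = 0.
Proof.
move=> mF F0.
suff sub (r : seq I) : vol [set x | exists2 i, i \in r & F i x] = 0.
  have := sub (enum I); congr (vol _ = 0); apply/seteqP; split=> x /=.
    by move=> [i _ Fi]; exists i.
  by move=> [i Fi]; exists i => //; rewrite mem_enum.
have mr (s : seq I) : measurable4 [set x | exists2 i, i \in s & F i x].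
  have -> : [set x | exists2 i, i \in s & F i x] =
      [set x | exists i, (if i \in s then F i else set0) x].
    apply/seteqP; split=> x /= [i].
      by move=> si Fi; exists i; rewrite si.
    by case: ifP => // si Fi; exists i.
  apply: measurable4_bigcup => i; case: ifP => // _.
  by rewrite -setCT; apply: measurable4C; exact: measurable4T.
elim: r => [|i r IHr].
  rewrite (_ : [set x | _] = set0); last by apply/seteqP; split=> x //= [].
  rewrite vol.unlock set0I /mu4 preimage_set0.
  by have -> : @lebesgue4 R set0 = 0%E by exact: measure0.
have -> : [set x | exists2 j, j \in i :: r & F j x] =
    F i `|` [set x | exists2 j, j \in r & F j x].
  apply/seteqP; split=> x /=.
    by move=> [j]; rewrite inE => /predU1P[-> ?|jr Fj]; [left|right; exists j].
  by move=> [Fi|[j jr Fj]]; [exists i; rewrite ?mem_head|exists j; rewrite // inE jr orbT].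
exact: vol_setU_eq0.
Qed.

(** A finite union of hyperplanes is null, whereas the whole ball has positive measure. *)
Lemma avoid_hyperplanes (I : finType) (f : I -> 'rV[R]_4) :
  (forall i, f i != 0) -> exists x, forall i, dotv (f i) x != 0.
Proof.
move=> f0; pose Z := [set x | exists i, hyperplane (f i) x].
have Z0 : vol Z = 0.
  apply: vol_exists_eq0 => i; [exact: measurable4_hyperplane|exact: vol_hyperplane].
have [[x Zx]|all] := pselect (exists x, ~ Z x).
  by exists x => i; apply/eqP => fx; apply: Zx; exists i.
have ZT : Z = setT.
  by apply/seteqP; split=> x // _; apply: contrapT => Zx; apply: all; exists x.
by have := @vol_gt0 R; rewrite -ZT Z0 ltxx.
Qed.

End Cones.

Section EndpointSigns.
Context {R : realType} (n : nat).
Variable l : 'I_n -> R.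
Hypothesis l0 : forall i, l i != 0.

(* Along a line with the direction vector [l], the coordinates [l i * (s - t i)]
   are all nonnegative on an interval of parameters [s]; the sum counts its
   left endpoint minus its right endpoint. *)
Lemma endpoint_signs (t : 'I_n -> R) : (0 < n)%N -> injective t ->
  \sum_k Num.sg (l k) * [forall i, 0 <= l i * (t k - t i)]%:R =
  [forall i, 0 < l i]%:R - [forall i, l i < 0]%:R.
Proof.
move=> n0 injt; pose P k := [forall i, 0 <= l i * (t k - t i)].
have i0 : 'I_n by case: (n) n0 => // m _; exact: ord0.
(* Without a positive [l i] the constraints describe a half-line, whose only endpoint is a right
   one, at the least [t i]. *)
have [/existsP[p p0]|] := boolP [exists i, 0 < l i]; last first.
  rewrite negb_exists => /forallP np.
  have neg i : l i < 0 by rewrite lt_neqAle l0 leNgt np.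
  have -> : [forall i, l i < 0] by apply/forallP.
  have -> : [forall i, 0 < l i] = false.
    by apply/negP => /forallP/(_ i0); apply/negP.
  pose b := [arg min_(i < i0) t i]%O.
  have bP : forall i, t b <= t i by rewrite /b; case: arg_minP => // j _ + i; apply.
  rewrite (bigD1 b) //= big1 ?addr0.
    have -> : [forall i, 0 <= l i * (t b - t i)].
      by apply/forallP => i; rewrite nmulr_rge0 // subr_le0.
    by rewrite ltr0_sg //=; ring.
  move=> k kb; have -> : [forall i, 0 <= l i * (t k - t i)] = false; last by rewrite mulr0.
  apply/negP => /forallP/(_ b); rewrite nmulr_rge0 // subr_le0 => tkb.
  by move/eqP: kb; apply; apply: injt; apply/le_anti; rewrite tkb bP.
have [/existsP[q q0]|] := boolP [exists i, l i < 0]; last first.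
  rewrite negb_exists => /forallP nq.
  have pos i : 0 < l i by rewrite lt_neqAle eq_sym l0 leNgt nq.
  have -> : [forall i, 0 < l i] by apply/forallP.
  have -> : [forall i, l i < 0] = false.
    by apply/negP => /forallP/(_ i0); apply/negP.
  pose b := [arg max_(i > i0) t i]%O.
  have bP : forall i, t i <= t b by rewrite /b; case: arg_maxP => // j _ + i; apply.
  rewrite (bigD1 b) //= big1 ?addr0.
    have -> : [forall i, 0 <= l i * (t b - t i)].
      by apply/forallP => i; rewrite pmulr_rge0 // subr_ge0.
    by rewrite gtr0_sg //=; ring.
  move=> k kb; have -> : [forall i, 0 <= l i * (t k - t i)] = false; last by rewrite mulr0.
  apply/negP => /forallP/(_ b); rewrite pmulr_rge0 // subr_ge0 => tkb.
  by move/eqP: kb; apply; apply: injt; apply/le_anti; rewrite tkb bP.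
have -> : [forall i, 0 < l i] = false.
  by apply/negP => /forallP/(_ q); rewrite ltNge ltW.
have -> : [forall i, l i < 0] = false.
  by apply/negP => /forallP/(_ p); rewrite ltNge ltW.
rewrite subrr.
(* [t a] is the greatest lower bound imposed on the parameter and [t b] the least upper bound. Both
   are counted, with opposite signs, or neither, according to whether [t a <= t b]. *)
pose a := [arg max_(i > p | 0 < l i) t i]%O.
have [la aP] : 0 < l a /\ forall i, 0 < l i -> t i <= t a.
  by rewrite /a; case: arg_maxP.
pose b := [arg min_(i < q | l i < 0) t i]%O.
have [lb bP] : l b < 0 /\ forall i, l i < 0 -> t b <= t i.
  by rewrite /b; case: arg_minP.
have Pa : P a = (t a <= t b).
  apply/forallP/idP => [/(_ b)|ab i]; first by rewrite nmulr_rge0 // subr_le0.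
  have [li|li] := ltP 0 (l i); first by rewrite pmulr_rge0 // subr_ge0 aP.
  have {}li : l i < 0 by rewrite lt_neqAle l0.
  by rewrite nmulr_rge0 // subr_le0 (le_trans ab) // bP.
have Pb : P b = (t a <= t b).
  apply/forallP/idP => [/(_ a)|ab i]; first by rewrite pmulr_rge0 // subr_ge0.
  have [li|li] := ltP 0 (l i).
    by rewrite pmulr_rge0 // subr_ge0 (le_trans _ ab) // aP.
  have {}li : l i < 0 by rewrite lt_neqAle l0.
  by rewrite nmulr_rge0 // subr_le0 bP.
have ab : b != a by apply: contraTneq lb => ->; rewrite ltNge ltW.
rewrite (bigD1 a) //= (bigD1 b) //= big1 ?addr0 => [|k /andP[ka kb]].
  by rewrite -/(P a) -/(P b) Pa Pb gtr0_sg // ltr0_sg //; ring.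
have -> : [forall i, 0 <= l i * (t k - t i)] = false; last by rewrite mulr0.
apply/negP => /forallP Pk; have [lk|lk] := ltP 0 (l k).
  have := Pk a; rewrite pmulr_rge0 // subr_ge0 => tka.
  by move/eqP: ka; apply; apply: injt; apply/le_anti; rewrite tka aP.
have {}lk : l k < 0 by rewrite lt_neqAle l0.
have := Pk b; rewrite nmulr_rge0 // subr_le0 => tkb.
by move/eqP: kb; apply; apply: injt; apply/le_anti; rewrite tkb bP.
Qed.

End EndpointSigns.

Section FiveTerms.
Context {R : realType}.
Implicit Types (C : 'M[R]_4) (W : 'M[R]_(5, 4)).

Definition minor W (k : 'I_5) : 'M[R]_4 := row' k W.

Definition cramer W (k : 'I_5) : R := (-1) ^+ k * \det (minor W k).

(** A column of [W] placed in front of [W] gives a 5 by 5 determinant with a repeated column; the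
    relation is its expansion along the first one. *)
Lemma cramer_relation W : \row_k cramer W k *m W = 0.
Proof.
apply/rowP => j; rewrite mxE [RHS]mxE.
pose M : 'M[R]_5 := row_mx (col j W) W.
have M0 k : M k 0 = W k j.
  have := row_mxEl (col j W) W k 0; rewrite [RHS]mxE => <-.
  by congr (row_mx _ _ _ _); apply/val_inj.
have MS k (l : 'I_4) : M k (lift 0 l) = W k l.
  have := row_mxEr (col j W) W k l => <-.
  by congr (row_mx _ _ _ _); apply/val_inj.
move: M M0 MS => M M0 MS.
have : \det M = 0.
  rewrite -det_tr; apply: (@determinant_alternate _ _ _ 0 (lift 0 j)) => // k.
  by rewrite !mxE M0 MS.
rewrite (expand_det_col M 0) => M_eq0; rewrite -[RHS]M_eq0; apply: eq_bigr => k _.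
rewrite mxE mulrC M0; congr (_ * _).
rewrite /cofactor addn0; congr (_ * \det _).
by apply/matrixP => i l; rewrite !mxE MS.
Qed.

Section Relation.
Variables (W : 'M[R]_(5, 4)) (dW : forall k, \det (minor W k) != 0).

Lemma minor_unit k : minor W k \in unitmx.
Proof. by rewrite unitmxE unitfE. Qed.

Lemma cramer_neq0 k : cramer W k != 0.
Proof. by rewrite mulf_neq0 // signr_eq0. Qed.

(* Coordinates of [x] on the rows of [W], the [k]-th one being zero. *)
Definition coords (k : 'I_5) (x : 'rV[R]_4) : 'rV[R]_5 :=
  \row_i (if unlift k i is Some j then (x *m invmx (minor W k)) 0 j else 0).

Lemma mulmx_row' (k : 'I_5) (v : 'rV[R]_5) : v 0 k = 0 ->
  v *m W = (\row_j v 0 (lift k j)) *m minor W k.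
Proof.
move=> vk; apply/rowP => j; rewrite !mxE (bigD1 k) //= vk mul0r add0r.
rewrite (reindex_onto (lift k) (fun i => odflt 0 (unlift k i))) /=; last first.
  by move=> i; rewrite eq_sym => /unlift_some[j' -> _]; rewrite liftK.
apply: eq_big => [i|i _]; last by rewrite !mxE.
by rewrite eq_sym neq_lift liftK /= eqxx.
Qed.

Lemma coordsK k x : coords k x *m W = x.
Proof.
rewrite (@mulmx_row' k); last by rewrite mxE unlift_none.
rewrite (_ : \row_j _ = x *m invmx (minor W k)) ?mulmxKV ?minor_unit //.
by apply/rowP => j; rewrite [LHS]mxE [LHS]mxE liftK.
Qed.

(** A combination with Cramer's relation kills the [i]-th coefficient, and the four other rows are
    independent. *)
Lemma relation_unique (v : 'rV[R]_5) : v *m W = 0 ->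
  forall i j, v 0 i * cramer W j = v 0 j * cramer W i.
Proof.
move=> vW i j; pose u := cramer W i *: v - v 0 i *: \row_k cramer W k.
have uW : u *m W = 0.
  by rewrite mulmxBl -!scalemxAl vW cramer_relation !scaler0 subrr.
have ui : u 0 i = 0 by rewrite !mxE; ring.
have : u 0 j = 0.
  have [->//|ji] := eqVneq j i.
  move: uW; rewrite (mulmx_row' ui) => /(congr1 (mulmxr (invmx (minor W i)))) /=.
  rewrite mulmxK ?minor_unit // mul0mx => /rowP u0.
  by case: (unlift_some (_ : i != j)) => [|j' -> _]; [rewrite eq_sym|move: (u0 j'); rewrite !mxE].
by rewrite !mxE => /eqP; rewrite subr_eq0 mulrC => /eqP ->; rewrite mulrC.
Qed.

(** The coefficient vectors of [x] on the five rows form a line through [coords 0 x] directed by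
    [cramer W]. Its [i]-th coefficient vanishes at the parameter [param x i], so [coords i x] is the
    point with that parameter. *)
Definition param x (i : 'I_5) : R := - coords 0 x 0 i / cramer W i.

Lemma coords_param k x i : coords k x 0 i = cramer W i * (param x k - param x i).
Proof.
have E := @relation_unique (coords k x - coords 0 x).
rewrite mulmxBl !coordsK subrr in E; have {E} := E erefl i k.
have ck : coords k x 0 k = 0 by rewrite mxE unlift_none.
have sub l : (coords k x - coords 0 x) 0 l = coords k x 0 l - coords 0 x 0 l.
  by rewrite [LHS]mxE; congr (_ + _); rewrite [LHS]mxE.
rewrite !sub ck sub0r /param.
have := cramer_neq0 k; have := cramer_neq0 i.
move: (cramer W k) (cramer W i) (coords 0 x 0 k) (coords 0 x 0 i) (coords k x 0 i).
move=> lk li ck0 ci0 ci li0 lk0 /eqP.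
move=> /eqP E; apply: (mulIf lk0); transitivity (- ck0 * li + ci0 * lk).
  by rewrite -E; ring.
by field; rewrite lk0 li0.
Qed.

Lemma cone_minor k x : cone (minor W k) x =
  [forall i, 0 <= cramer W i * (param x k - param x i)].
Proof.
apply/forallP/forallP => H i; last first.
  by rewrite dotv_dual_row; have := H (lift k i); rewrite -coords_param mxE liftK.
rewrite -coords_param mxE; case: unliftP => [j _|//].
by rewrite -dotv_dual_row.
Qed.

(** The signed number of cones containing [x] counts the endpoints of the nonnegative part of a line
    of coefficient vectors, so off the facets it does not depend on [x]. It is nonzero exactly when
    all [cramer W i] have one sign, that is, when the five cones cover E^4. *)
Lemma five_term : exists n : int,
  \sum_(k < 5) (-1) ^+ k * signed_vol (minor W k) = n%:~R * vol (setT : set 'rV[R]_4).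
Proof.
pose Z := [set x | exists kj : 'I_5 * 'I_4, hyperplane (dual_row (minor W kj.1) kj.2) x].
have d0 (kj : 'I_5 * 'I_4) : dual_row (minor W kj.1) kj.2 != 0 by exact: dual_row_neq0.
exists ([forall i, 0 < cramer W i]%:R - [forall i, cramer W i < 0]%:R).
have sgE (k : 'I_5) : (-1) ^+ k * signed_vol (minor W k) =
    Num.sg (cramer W k) * vol [set x | cone (minor W k) x].
  by rewrite /signed_vol mulrA /cramer sgrM sgrX sgrN1.
under eq_bigr => k _ do rewrite sgE.
apply: (@vol_sum R _ (fun k => Num.sg (cramer W k)) (fun k x => cone (minor W k) x) _ Z).
- by move=> k; exact: measurable4_cone.
- by apply: measurable4_bigcup => kj; exact: measurable4_hyperplane.
- apply: vol_exists_eq0 => kj; first exact: measurable4_hyperplane.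
  exact: vol_hyperplane.
move=> x _ Zx; under eq_bigr => k _ do rewrite cone_minor.
rewrite (endpoint_signs cramer_neq0) //; first by rewrite rmorphB /= !rmorph_nat.
(* Equal parameters make two coefficients of [x] vanish together, which puts [x] on a facet
   hyperplane. *)
move=> i j tij; apply/eqP/negP => /negP ij; apply: Zx.
have /unlift_some[l jl _] : i != j by [].
exists (i, l); rewrite /hyperplane /= dotv_dual_row.
have := coords_param i x j; rewrite tij subrr mulr0 => E.
by rewrite -[RHS]E [RHS]mxE jl liftK.
Qed.

End Relation.
End FiveTerms.

(** * The oriented volume of an octahedron *)

Section ApexChange.
Context {R : realType}.
Implicit Types (C : 'M[R]_4) (o z u v w x : 'rV[R]_4) (P : octahedron R).
Implicit Types e : {ffun 'I_3 -> bool}.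

Lemma coneP C x : \det C != 0 ->
  cone C x <-> exists t : 'rV[R]_4, (forall i, 0 <= t 0 i) /\ x = t *m C.
Proof.
move=> dC; have uC : C \in unitmx by rewrite unitmxE unitfE.
split=> [/forallP xC|[t [t0 ->]]].
  exists (x *m invmx C); rewrite mulmxKV //; split=> // i.
  by rewrite -dotv_dual_row.
by apply/forallP => i; rewrite dotv_dual_row mulmxK.
Qed.

Lemma det_xrow C (i j : 'I_4) : i != j -> \det (xrow i j C) = - \det C.
Proof.
move=> ij; rewrite xrowE det_mulmx /tperm_mx det_perm odd_tperm ij expr1.
by rewrite mulN1r.
Qed.

Lemma dual_row_xrow C (i j k : 'I_4) : \det C != 0 ->
  dual_row (xrow i j C) k = dual_row C (tperm i j k).
Proof.
move=> dC; have uC : C \in unitmx by rewrite unitmxE unitfE.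
have TT : tperm_mx i j *m tperm_mx i j = 1%:M :> 'M[R]_4.
  by rewrite /tperm_mx -perm_mxM tperm2 perm_mx1.
rewrite /dual_row; suff -> : invmx (xrow i j C) = xcol i j (invmx C).
  by apply/rowP => l; rewrite !mxE.
have CT : xrow i j C *m xcol i j (invmx C) = 1%:M.
  by rewrite xrowE xcolE mulmxA -(mulmxA _ C) mulmxV // mulmx1 TT.
have uT : xrow i j C \in unitmx by case/mulmx1_unit: CT.
by rewrite -[RHS]mul1mx -(mulVmx uT) -mulmxA CT mulmx1.
Qed.

Lemma cone_xrow C (i j : 'I_4) x : \det C != 0 -> cone (xrow i j C) x = cone C x.
Proof.
move=> dC; apply/forallP/forallP => H k; last by rewrite dual_row_xrow.
by have := H (tperm i j k); rewrite dual_row_xrow // tpermK.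
Qed.

Lemma signed_vol_xrow C (i j : 'I_4) : i != j ->
  signed_vol (xrow i j C) = - signed_vol C.
Proof.
move=> ij; rewrite /signed_vol det_xrow // sgrN mulNr.
have [->|dC] := eqVneq (\det C) 0; first by rewrite sgr0 !mul0r.
by congr (- (_ * vol _)); apply/seteqP; split=> x /=; rewrite cone_xrow.
Qed.

Definition mx4 u v w x : 'M[R]_4 := \matrix_(i < 4) [:: u; v; w; x]`_i.

Definition signed_vol4 u v w x := signed_vol (mx4 u v w x).

Lemma mx4_swap12 u v w x : mx4 u w v x = xrow 1 2 (mx4 u v w x).
Proof.
apply/row_matrixP; apply: ord4P; rewrite rowK /=;
  apply/rowP => j; rewrite !mxE permE /= ?mxE //.
Qed.

Lemma mx4_swap23 u v w x : mx4 u v x w = xrow 2 3 (mx4 u v w x).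
Proof.
apply/row_matrixP; apply: ord4P; rewrite rowK /=;
  apply/rowP => j; rewrite !mxE permE /= ?mxE //.
Qed.

Definition vertex P (i : 'I_3) (b : bool) : 'rV[R]_4 :=
  row (if b then rshift 3 i else lshift 3 i) P.

Definition face_tetra o P e : 'M[R]_4 :=
  mx4 o (vertex P 0 (e 0)) (vertex P 1 (e 1)) (vertex P 2 (e 2)).

Definition edge_sign e : R := (-1) ^+ (\sum_i e i)%N.

Lemma ord3P (T : 'I_3 -> Prop) : T 0 -> T 1 -> T 2 -> forall i, T i.
Proof.
move=> T0 T1 T2 [[|[|[|//]]] h].
- by have -> : Ordinal h = 0 by apply/val_inj.
- by have -> : Ordinal h = 1 by apply/val_inj.
- by have -> : Ordinal h = 2 by apply/val_inj.
Qed.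

Lemma col_mx4 o (F : 'M[R]_(3, 4)) :
  col_mx o F = mx4 o (row 0 F) (row 1 F) (row 2 F) :> 'M[R]_4.
Proof.
apply/row_matrixP; apply: ord4P; rewrite [RHS]rowK /=.
- have -> : 0 = lshift 3 (0 : 'I_1) by apply/val_inj.
  by rewrite (@rowKu _ 1 3) row_id.
- have -> : 1 = rshift 1 (0 : 'I_3) by apply/val_inj.
  by rewrite (@rowKd _ 1 3).
- have -> : 2 = rshift 1 (1 : 'I_3) by apply/val_inj.
  by rewrite (@rowKd _ 1 3).
- have -> : 3 = rshift 1 (2 : 'I_3) by apply/val_inj.
  by rewrite (@rowKd _ 1 3).
Qed.

Lemma tetra_overE o P e : tetra_over o P e =
  if odd (\sum_i e i)%N then xrow 1 2 (face_tetra o P e) else face_tetra o P e.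
Proof.
rewrite /tetra_over /positive_face; case: ifP => _; rewrite col_mx4.
  rewrite -mx4_swap12; congr mx4;
    apply/rowP => j; rewrite !mxE permE /= ?mxE //.
by congr mx4; apply/rowP => j; rewrite !mxE.
Qed.

Definition apex_sum o P := \sum_e edge_sign e * signed_vol (face_tetra o P e).

Lemma oriented_volume_sum o P :
  \sum_e oriented_volume_tetra (tetra_over o P e) = 4 * apex_sum o P.
Proof.
rewrite /apex_sum mulr_sumr; apply: eq_bigr => e _.
rewrite oriented_volume_tetraE tetra_overE /edge_sign -signr_odd.
by case: ifP => _; rewrite ?signed_vol_xrow // ?mulN1r ?mul1r.
Qed.

Lemma generic_apex_det o P e : generic_apex P o -> \det (face_tetra o P e) != 0.
Proof.
move=> [_ /(_ e)]; rewrite tetra_overE; case: ifP => // _.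
by rewrite det_xrow // oppr_eq0.
Qed.

Definition flip (j : 'I_3) e : {ffun 'I_3 -> bool} :=
  [ffun i => if i == j then ~~ e i else e i].

Lemma flipK j : involutive (flip j).
Proof. by move=> e; apply/ffunP => i; rewrite !ffunE; case: eqP; rewrite ?negbK. Qed.

Lemma edge_sign_flip j e : edge_sign (flip j e) = - edge_sign e.
Proof.
rewrite /edge_sign (bigD1 j) //= [in RHS](bigD1 j) //= ffunE eqxx.
rewrite (eq_bigr (fun i => nat_of_bool (e i))).
  by case: (e j); rewrite /= ?add0n ?add1n exprS ?mulN1r ?opprK.
by move=> i ij; rewrite ffunE (negPf ij).
Qed.

(** A function independent of [e j] is attached to an edge; the two faces through this edge carry
    opposite signs. *)
Lemma sum_edge_sign_flip j (F : {ffun 'I_3 -> bool} -> R) :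
  (forall e, F (flip j e) = F e) -> \sum_e edge_sign e * F e = 0.
Proof.
move=> Fj; set S := \sum_e _; suff : S = - S by lra.
rewrite {1}/S (reindex_inj (inv_inj (flipK j))) /= -sumrN.
by apply: eq_bigr => e _; rewrite edge_sign_flip Fj mulNr.
Qed.

Definition mx5 o u v w x : 'M[R]_(5, 4) := \matrix_(i < 5) [:: o; u; v; w; x]`_i.

Lemma minor_mx5 o u v w x :
  [/\ minor (mx5 o u v w x) 0 = mx4 u v w x, minor (mx5 o u v w x) 1 = mx4 o v w x,
      minor (mx5 o u v w x) 2 = mx4 o u w x, minor (mx5 o u v w x) 3 = mx4 o u v x &
      minor (mx5 o u v w x) 4 = mx4 o u v w].
Proof. by split; apply/matrixP; apply: ord4P => j; rewrite !mxE. Qed.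

Lemma ord5P (T : 'I_5 -> Prop) : T 0 -> T 1 -> T 2 -> T 3 -> T 4 -> forall i, T i.
Proof.
move=> T0 T1 T2 T3 T4 [[|[|[|[|[|//]]]]] h].
- by have -> : Ordinal h = 0 by apply/val_inj.
- by have -> : Ordinal h = 1 by apply/val_inj.
- by have -> : Ordinal h = 2 by apply/val_inj.
- by have -> : Ordinal h = 3 by apply/val_inj.
- by have -> : Ordinal h = 4 by apply/val_inj.
Qed.

Lemma five_term4 o z u v w :
  \det (mx4 z u v w) != 0 -> \det (mx4 o u v w) != 0 -> \det (mx4 o z v w) != 0 ->
  \det (mx4 o z u w) != 0 -> \det (mx4 o z u v) != 0 ->
  exists n : int, signed_vol4 z u v w - signed_vol4 o u v w + signed_vol4 o z v w
    - signed_vol4 o z u w + signed_vol4 o z u v = n%:~R * vol (setT : set 'rV[R]_4).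
Proof.
move=> d0 d1 d2 d3 d4; have [m0 m1 m2 m3 m4] := minor_mx5 o z u v w.
have dW k : \det (minor (mx5 o z u v w) k) != 0.
  by move: k; apply: ord5P; rewrite ?m0 ?m1 ?m2 ?m3 ?m4.
have [n nE] := five_term dW; exists n; rewrite -nE.
rewrite !big_ord_recl big_ord0 /=.
have -> : lift ord0 (ord0 : 'I_4) = 1 :> 'I_5 by apply/val_inj.
have -> : lift ord0 (lift ord0 (ord0 : 'I_3)) = 2 :> 'I_5 by apply/val_inj.
have -> : lift ord0 (lift ord0 (lift ord0 (ord0 : 'I_2))) = 3 :> 'I_5 by apply/val_inj.
have -> : lift ord0 (lift ord0 (lift ord0 (lift ord0 (ord0 : 'I_1)))) = 4 :> 'I_5.
  by apply/val_inj.
have -> : ord0 = 0 :> 'I_5 by [].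
rewrite m0 m1 m2 m3 m4 /signed_vol4 /bump /=.
rewrite !exprS expr0; ring.
Qed.

Lemma det_mx4_linear0 u v w : exists n, forall z, \det (mx4 z u v w) = dotv n z.
Proof.
exists (\row_j cofactor (mx4 0 u v w) 0 j) => z.
rewrite (expand_det_row _ 0) dotvE; apply: eq_bigr => j _.
rewrite mulrC !mxE; congr (_ * _); rewrite /cofactor; congr (_ * \det _).
by apply/matrixP; apply: ord3P => i; rewrite !mxE.
Qed.

Lemma det_mx4_linear1 u v w : exists n, forall z, \det (mx4 u z v w) = dotv n z.
Proof.
exists (\row_j cofactor (mx4 u 0 v w) 1 j) => z.
rewrite (expand_det_row _ 1) dotvE; apply: eq_bigr => j _.
rewrite mulrC !mxE; congr (_ * _); rewrite /cofactor; congr (_ * \det _).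
by apply/matrixP; apply: ord3P => i; rewrite !mxE.
Qed.

Lemma avoid_linear (I : finType) (F : I -> 'rV[R]_4 -> R) :
  (forall i, exists n, forall z, F i z = dotv n z) ->
  (forall i, exists z, F i z != 0) -> exists z, forall i, F i z != 0.
Proof.
move=> Flin F0; have [n nF] := choice Flin.
have [z zn] : exists z, forall i, dotv (n i) z != 0.
  apply: avoid_hyperplanes => i; have [z] := F0 i.
  by rewrite nF; apply: contraNneq => ->; rewrite dotv0l.
by exists z => i; rewrite nF.
Qed.

Definition edge_det o z P e (k : 'I_3) : R :=
  [:: \det (mx4 o z (vertex P 1 (e 1)) (vertex P 2 (e 2)));
      \det (mx4 o z (vertex P 0 (e 0)) (vertex P 2 (e 2)));
      \det (mx4 o z (vertex P 0 (e 0)) (vertex P 1 (e 1)))]`_k.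

(** Five-term relation for [o], [z] and each face: besides the two tetrahedra over the face, its
    terms belong to the edges of the face and cancel between adjacent faces. *)
Lemma apex_sum_generic o z P :
  (forall e, \det (face_tetra o P e) != 0) ->
  (forall e, \det (face_tetra z P e) != 0) ->
  (forall e k, edge_det o z P e k != 0) ->
  exists n : int, apex_sum z P - apex_sum o P = n%:~R * vol (setT : set 'rV[R]_4).
Proof.
move=> d1 d2 d3.
have /choice[n nE] e := five_term4 (d2 e) (d1 e) (d3 e 0) (d3 e 1) (d3 e 2).
exists (\sum_(e : {ffun 'I_3 -> bool}) (-1) ^+ (\sum_i e i)%N * n e).
rewrite rmorph_sum /= mulr_suml.
have S0 := @sum_edge_sign_flip 0 (fun e =>
  signed_vol4 o z (vertex P 1 (e 1)) (vertex P 2 (e 2))).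
have S1 := @sum_edge_sign_flip 1 (fun e =>
  signed_vol4 o z (vertex P 0 (e 0)) (vertex P 2 (e 2))).
have S2 := @sum_edge_sign_flip 2 (fun e =>
  signed_vol4 o z (vertex P 0 (e 0)) (vertex P 1 (e 1))).
transitivity (\sum_e edge_sign e * signed_vol (face_tetra z P e)
  - \sum_e edge_sign e * signed_vol (face_tetra o P e)
  + \sum_e edge_sign e * signed_vol4 o z (vertex P 1 (e 1)) (vertex P 2 (e 2))
  - \sum_e edge_sign e * signed_vol4 o z (vertex P 0 (e 0)) (vertex P 2 (e 2))
  + \sum_e edge_sign e * signed_vol4 o z (vertex P 0 (e 0)) (vertex P 1 (e 1))).
  rewrite S0 ?S1 ?S2 ?subr0 ?addr0 // => e; by rewrite !ffunE.
rewrite -!sumrN -!big_split /=; apply: eq_bigr => e _.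
rewrite rmorphM rmorphXn rmorphN1 -mulrA -nE /edge_sign /face_tetra /signed_vol4.
by ring.
Qed.

(** A tetrahedron spanned by [o1], [o2] and an edge may be degenerate, so the two apices are
    compared through a third one in general position to both. *)
Lemma apex_sum_congr o1 o2 P :
  (forall e, \det (face_tetra o1 P e) != 0) ->
  (forall e, \det (face_tetra o2 P e) != 0) ->
  exists n : int, apex_sum o1 P = apex_sum o2 P + n%:~R * vol (setT : set 'rV[R]_4).
Proof.
move=> d1 d2.
pose F (t : {ffun 'I_3 -> bool} * option (bool * 'I_3)) z := match t.2 with
  | None => \det (face_tetra z P t.1)
  | Some (b, k) => edge_det (if b then o1 else o2) z P t.1 k end.
have [z zF] : exists z, forall t, F t z != 0.
  apply: avoid_linear => -[e [[b k]|]]; rewrite /F /=.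
  - by move: k; apply: ord3P; exact: det_mx4_linear1.
  - exact: det_mx4_linear0.
  (* The condition on [z] is not void: the vertex of the face off the edge gives back, up to sign,
     the tetrahedron over the face. *)
  - have {d1 d2} : \det (face_tetra (if b then o1 else o2) P e) != 0 by case: b.
    move: (if b then _ else _) => o d; move: k; apply: ord3P.
    + by exists (vertex P 0 (e 0)).
    + by exists (vertex P 1 (e 1)); rewrite /edge_det /= mx4_swap12 det_xrow // oppr_eq0.
    + exists (vertex P 2 (e 2)); rewrite /edge_det /= mx4_swap12 det_xrow //.
      by rewrite mx4_swap23 det_xrow // opprK.
  - by exists o1.
have [n1 E1] := apex_sum_generic d1 (fun e => zF (e, None)) (fun e k => zF (e, Some (true, k))).
have [n2 E2] := apex_sum_generic d2 (fun e => zF (e, None)) (fun e k => zF (e, Some (false, k))).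
by exists (n2 - n1); rewrite rmorphB /= mulrBl -E1 -E2; ring.
Qed.

Lemma oriented_volume_countable o P :
  (forall e, \det (face_tetra o P e) != 0) -> countable (oriented_volume P).
Proof.
move=> d; pose V := vol (setT : set 'rV[R]_4).
apply: (@sub_countable _ _ _ ((fun nk : int * int =>
    4 * (apex_sum o P + nk.1%:~R * V) + nk.2%:~R * (2 * pi ^+ 2)) @` setT)).
  apply: subset_card_le => v [z [k [gz ->]]]; rewrite oriented_volume_sum.
  have [n nE] := apex_sum_congr (fun e => generic_apex_det e gz) d.
  by exists (n, k) => //=; rewrite -nE.
exact: (sub_countable (card_image_le _ _) (countableP _)).
Qed.

End ApexChange.

(** * Half-lunes *)

Section DiagonalTetrahedra.
Context {R : realType}.
Implicit Types (C : 'M[R]_4) (a b x y u v w z : 'rV[R]_4).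

Lemma det3E (M : 'M[R]_3) : \det M =
  M 0 0 * (M 1 1 * M 2 2 - M 1 2 * M 2 1) - M 0 1 * (M 1 0 * M 2 2 - M 1 2 * M 2 0)
  + M 0 2 * (M 1 0 * M 2 1 - M 1 1 * M 2 0).
Proof.
(* Indexing by natural numbers lets the ordinals produced by the expansion reduce by computation. *)
pose f i j := M (inord i) (inord j).
have fE i j : M i j = f i j by rewrite /f !inord_val.
rewrite !fE /= (expand_det_row _ ord0) !big_ord_recl big_ord0 /cofactor.
rewrite !(expand_det_row _ ord0) !big_ord_recl !big_ord0 /cofactor !det_mx11.
by rewrite !mxE !fE /= /bump /= !exprS expr0; ring.
Qed.

Lemma det4E (M : 'M[R]_4) : let m k0 k1 k2 :=
    M 1 k0 * (M 2 k1 * M 3 k2 - M 2 k2 * M 3 k1)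
    - M 1 k1 * (M 2 k0 * M 3 k2 - M 2 k2 * M 3 k0)
    + M 1 k2 * (M 2 k0 * M 3 k1 - M 2 k1 * M 3 k0) in
  \det M = M 0 0 * m 1 2 3 - M 0 1 * m 0 2 3 + M 0 2 * m 0 1 3 - M 0 3 * m 0 1 2.
Proof.
pose f i j := M (inord i) (inord j).
have fE i j : M i j = f i j by rewrite /f !inord_val.
rewrite /= !fE /= (expand_det_row _ ord0) !big_ord_recl big_ord0 /cofactor !det3E.
by rewrite !mxE !fE /= /bump /= !exprS expr0; ring.
Qed.

Lemma mul_mx4 (t : 'rV[R]_4) u v w z : t *m mx4 u v w z =
  t 0 0 *: u + t 0 1 *: v + t 0 2 *: w + t 0 3 *: z.
Proof. by apply/rowP => j; rewrite !mxE sum4 /mx4 !mxE. Qed.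

(* Cutting a tetrahedron by the bisecting plane through the diagonal. *)
Lemma cone_split a b x y k z : \det (mx4 a b x y) != 0 -> 0 < k ->
  cone (mx4 (k *: (x + y)) a b x) z <->
  cone (mx4 a b x y) z /\
  dotv (dual_row (mx4 a b x y) 3) z <= dotv (dual_row (mx4 a b x y) 2) z.
Proof.
move=> dC k0; set C := mx4 a b x y.
pose T := mx4 (vec4 0 0 k k) (vec4 1 0 0 0) (vec4 0 1 0 0) (vec4 0 0 1 0) : 'M[R]_4.
have TC : mx4 (k *: (x + y)) a b x = T *m C.
  apply/row_matrixP; apply: ord4P; rewrite row_mul /T !rowK /= /C mul_mx4 /vec4 !mxE /=;
  by rewrite ?scale0r ?scale1r ?add0r ?addr0 ?scalerDr.
have dT : \det T = - k by rewrite det4E /T /mx4 /vec4 !mxE /=; ring.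
have dTC : \det (T *m C) != 0.
  by rewrite det_mulmx mulf_neq0 // dT oppr_eq0 gt_eqF.
have uC : C \in unitmx by rewrite unitmxE unitfE.
rewrite TC; split.
  move/(coneP _ dTC) => [t [t0 zE]].
  have tT : t *m T = vec4 (t 0 1) (t 0 2) (k * t 0 0 + t 0 3) (k * t 0 0).
    rewrite mul_mx4; apply/rowP; apply: ord4P; rewrite /vec4 !mxE /=; ring.
  rewrite mulmxA tT in zE; split; last first.
    by rewrite !dotv_dual_row zE mulmxK // /vec4 !mxE /= lerDl.
  apply/(coneP _ dC); eexists; split; last exact: zE.
  by apply: ord4P; rewrite /vec4 mxE /= ?addr_ge0 ?mulr_ge0 // ltW.
rewrite !dotv_dual_row => -[/(coneP _ dC)[t [t0 zE]]].
rewrite zE mulmxK // => t32; apply/(coneP _ dTC).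
exists (vec4 (t 0 3 / k) (t 0 0) (t 0 1) (t 0 2 - t 0 3)); split.
  by apply: ord4P; rewrite /vec4 mxE /= ?subr_ge0 ?divr_ge0 // ltW.
rewrite mulmxA; congr (_ *m _); rewrite mul_mx4; apply/rowP.
apply: ord4P; rewrite /vec4 !mxE /=; field; by rewrite gt_eqF.
Qed.

Lemma mx4_swap01 u v w z : mx4 v u w z = xrow 0 1 (mx4 u v w z).
Proof.
apply/row_matrixP; apply: ord4P; rewrite rowK /=;
  apply/rowP => j; rewrite !mxE permE /= ?mxE //.
Qed.

Lemma dual_row_row C (i j : 'I_4) : \det C != 0 ->
  dotv (dual_row C i) (row j C) = (j == i)%:R.
Proof.
move=> dC; have uC : C \in unitmx by rewrite unitmxE unitfE.
by rewrite dotv_dual_row -row_mul mulmxV // !mxE.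
Qed.

Lemma dual_row_eq C (i : 'I_4) f : \det C != 0 ->
  (forall j, dotv f (row j C) = (j == i)%:R) -> f = dual_row C i.
Proof.
move=> dC fC; have uC : C \in unitmx by rewrite unitmxE unitfE.
have : C *m f^T = C *m (dual_row C i)^T.
  apply/colP => j; have := fC j; rewrite -(dual_row_row i j dC).
  by rewrite ![dotv _ (row j C)]dotvC /dotv -!row_mul ![row _ _ _ _]mxE.
by move/(can_inj (mulKmx uC))/trmx_inj.
Qed.

Lemma det_diag a b x y k :
  \det (mx4 (k *: (x + y)) a b x) = - k * \det (mx4 a b x y).
Proof. by rewrite !det4E /mx4 !mxE /=; ring. Qed.

Lemma signed_vol_diag a b x y k : \det (mx4 a b x y) != 0 -> 0 < k ->
  signed_vol4 (k *: (x + y)) a b x - signed_vol4 (k *: (x + y)) a b y =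
  - signed_vol4 a b x y.
Proof.
move=> dC k0; set C := mx4 a b x y.
have Cyx : mx4 a b y x = xrow 2 3 C by exact: mx4_swap23.
have dCyx : \det (mx4 a b y x) != 0 by rewrite Cyx det_xrow // oppr_eq0.
pose f := dual_row C 3; pose g := dual_row C 2.
have fg : g - f != 0.
  apply/eqP => fg0; have := dotvDl g (- f) (row 2 C).
  rewrite fg0 dotv0l dotvNl !dual_row_row //= subr0 => /eqP.
  by rewrite eq_sym oner_eq0.
have c1 z : cone (mx4 (k *: (x + y)) a b x) z =
    cone C z && (dotv f z <= dotv g z).
  by apply/idP/andP => /cone_split; apply.
have c2 z : cone (mx4 (k *: (x + y)) a b y) z =
    cone C z && (dotv g z <= dotv f z).
  rewrite addrC; have := @cone_split a b y x k z dCyx k0.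
  rewrite Cyx cone_xrow // !dual_row_xrow // tpermL tpermR => H.
  by apply/idP/andP => /H; apply.
have m1 := measurable4_cone (mx4 (k *: (x + y)) a b x).
have m2 := measurable4_cone (mx4 (k *: (x + y)) a b y).
have := vol_disjoint (measurable4_hyperplane (g - f)) (vol_hyperplane fg)
  (measurable4_cone C) m1 m2.
rewrite /signed_vol4 /signed_vol det_diag.
have -> : \det (mx4 (k *: (x + y)) a b y) = k * \det C.
  by rewrite addrC det_diag Cyx det_xrow // mulrNN.
rewrite mulNr sgrN !sgrM gtr0_sg // !mul1r => -> ; first by rewrite -/C; ring.
move=> z; rewrite c1 c2 /hyperplane /= dotvDl dotvNl => /eqP; rewrite subr_eq0.
by case: (cone C z) => //=; case: ltgtP.
Qed.

(* The isometry [r] maps the tetrahedron to its complement in the lune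
   bounded by the three faces through [b]. *)
Lemma vol_cone_lune a b x y r : \det (mx4 a b x y) != 0 -> isometry4 r ->
  a *m r = a -> b *m r = - b -> x *m r = y -> y *m r = x ->
  let d := dual_row (mx4 a b x y) in
  vol [set z | cone (mx4 a b x y) z] *+ 2 =
  (wedge (d 0) (d 2) + wedge (d 0) (d 3) + wedge (d 2) (d 3) - vol setT / 2) / 2.
Proof.
move=> dC ir ra rb rx ry d; set C := mx4 a b x y.
have d0 i : d i != 0 by exact: dual_row_neq0.
have uC : C \in unitmx by rewrite unitmxE unitfE.
have mC := measurable4_cone C.
rewrite -vol_trihedral // mulr2n -{2}(vol_isometry ir mC).
(* In the coordinates dual to the vertices, [r] negates the one of [b] and exchanges those of [x]
   and [y]. *)
have sgn i z : dotv (d i) (z *m r) =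
    [:: dotv (d 0) z; - dotv (d 1) z; dotv (d 3) z; dotv (d 2) z]`_i.
  rewrite !dotv_dual_row -[in LHS](mulmxKV uC z).
  move: (z *m invmx C) => t; rewrite -(mulmxA t C r).
  have -> : C *m r = mx4 a (- b) y x.
    by apply/row_matrixP; apply: ord4P; rewrite row_mul !rowK /= ?ra ?rb ?rx ?ry.
  have -> : t *m mx4 a (- b) y x = vec4 (t 0 0) (- t 0 1) (t 0 3) (t 0 2) *m C.
    rewrite !mul_mx4 /vec4 !mxE /= scalerN scaleNr -!addrA; congr (_ + (_ + _)).
    exact: addrC.
  by rewrite mulmxK // /vec4 !mxE; move: i; apply: ord4P.
have ce z : cone C z = [&& 0 <= dotv (d 0) z, 0 <= dotv (d 1) z,
    0 <= dotv (d 2) z & 0 <= dotv (d 3) z].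
  apply/forallP/idP => [H|/and4P[? ? ? ?]]; last by apply: ord4P.
  by rewrite !H.
symmetry; apply: (vol_disjoint (measurable4_hyperplane (d 1))).
- exact: vol_hyperplane.
- apply: measurable4_bool2; first exact: measurable4_halfspace.
  exact: measurable4_wedge.
- exact: mC.
- exact: (measurable4_mul r mC).
move=> z /eqP; rewrite !ce !sgn /=.
move: (dotv (d 0) z) (dotv (d 1) z) (dotv (d 2) z) (dotv (d 3) z) => p q s t.
rewrite oppr_ge0; case: (ltgtP 0 q) => // _ _; rewrite ?andbF /=.
  by rewrite addn0.
by rewrite [(0 <= t) && _]andbC.
Qed.

End DiagonalTetrahedra.

(** * Volume of a tetrahedron on the diagonal a_3 b_3 *)

Section TetrahedronValue.
Context {R : realType}.
Local Notation V4 := (vol (setT : set 'rV[R]_4)).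

Lemma sqrtr_eq (x y : R) : 0 <= x -> x ^+ 2 = y -> Num.sqrt y = x.
Proof. by move=> x0 <-; rewrite sqrtr_sqr ger0_norm. Qed.

Lemma acos_double_atan (z : R) : 0 <= z ->
  acos ((1 - z ^+ 2) / (1 + z ^+ 2)) = 2 * atan z.
Proof.
move=> z0; have z1 : 0 < 1 + z ^+ 2 by rewrite ltr_pwDl // sqr_ge0.
have -> : (1 - z ^+ 2) / (1 + z ^+ 2) = cos (2 * atan z).
  rewrite mulr_natl cos_mulr2n cos_atan exprVn sqr_sqrtr ?ltW // -[_ *+ 2]mulr_natl.
  by field; rewrite gt_eqF.
rewrite cosK // in_itv /=; have := atan_ltpi2 z.
have : 0 <= atan z by rewrite -(@atan0 R) le_atan.
by move: (pi : R) => p ? ?; lra.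
Qed.

Lemma acos_atan (t : R) : acos (t / Num.sqrt (1 + t ^+ 2)) = pi / 2 - atan t.
Proof.
have -> : t / Num.sqrt (1 + t ^+ 2) = cos (pi / 2 - atan t).
  rewrite cosB cos_pihalf sin_pihalf mul0r add0r mul1r.
  have ct : 0 < cos (atan t) by rewrite cos_gt0_pihalf // atan_gtNpi2 atan_ltpi2.
  by rewrite -cos_atan -{1}[t]atanK /tan divfK // gt_eqF.
rewrite cosK // in_itv /=; have := atan_ltpi2 t; have := atan_gtNpi2 t.
by move: (pi : R) => p ? ?; lra.
Qed.

Section Coordinates.
Variables a1 a2 b1 b2 c s : R.
Hypotheses (a12 : a1 ^+ 2 + a2 ^+ 2 = 1) (b12 : b1 ^+ 2 + b2 ^+ 2 = 1).
Hypotheses (cs1 : c ^+ 2 + s ^+ 2 = 1).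
Hypotheses (a20 : a2 != 0) (b20 : b2 != 0) (c0 : c != 0) (s0 : s != 0).

Definition diag_tetra (a1 a2 b1 b2 c s : R) : 'M[R]_4 :=
  mx4 (vec4 a1 a2 0 0) (vec4 0 0 b1 b2) (vec4 c 0 s 0) (vec4 c 0 (- s) 0).

Local Notation C := (diag_tetra a1 a2 b1 b2 c s).

Lemma det_diag_tetra : \det C = 2 * (a2 * b2 * c * s).
Proof. rewrite det4E /diag_tetra /mx4 /vec4 !mxE /=; ring. Qed.

Lemma det_diag_tetra_neq0 : \det C != 0.
Proof. by rewrite det_diag_tetra !mulf_neq0 // pnatr_eq0. Qed.

Let v := (c * a2) ^+ 2.
Let u := (s * b2) ^+ 2.

Let v0 : 0 < v. Proof. by rewrite exprn_even_gt0 //= mulf_neq0. Qed.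
Let u0 : 0 < u. Proof. by rewrite exprn_even_gt0 //= mulf_neq0. Qed.

(** With [t] the argument of the second arctangent, the lune has the dihedral angles [2 * atan z]
    and twice [pi / 2 - atan t], hence the excess [2 * (atan z - atan t)]. The tetrahedron is half
    of the lune, which gives the factor [V4 / (4 * pi)]. *)
Lemma vol_diag_tetra : let z := Num.sqrt (u / v) in
  vol [set x | cone C x] = V4 / (4 * pi) *
    (atan z - atan (a1 * c * z / Num.sqrt (1 - (b1 * s) ^+ 2))).
Proof.
move=> z.
have dC := det_diag_tetra_neq0.
have d0 : dual_row C 0 = vec4 0 (a2^-1) 0 0.
  symmetry; apply: dual_row_eq => //.
  by apply: ord4P; rewrite rowK dotv_vec4 /vec4 !mxE /=; field.
have d2 : dual_row C 2 = vec4 ((2 * c)^-1) (- a1 / (2 * a2 * c)) ((2 * s)^-1)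
    (- b1 / (2 * b2 * s)).
  symmetry; apply: dual_row_eq => //.
  by apply: ord4P; rewrite rowK dotv_vec4 /vec4 !mxE /=; field; rewrite ?a20 ?b20 ?c0 ?s0.
have d3 : dual_row C 3 = vec4 ((2 * c)^-1) (- a1 / (2 * a2 * c)) (- (2 * s)^-1)
    (b1 / (2 * b2 * s)).
  symmetry; apply: dual_row_eq => //.
  by apply: ord4P; rewrite rowK dotv_vec4 /vec4 !mxE /=; field; rewrite ?a20 ?b20 ?c0 ?s0.
have K0 : 0 < u + v by exact: addr_gt0.
have d00 : dotv (dual_row C 0) (dual_row C 0) = (a2^-1) ^+ 2.
  by rewrite d0 dotv_vec4 /vec4 !mxE /=; ring.
have d22 : dotv (dual_row C 2) (dual_row C 2) = (u + v) / (4 * u * v).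
  rewrite d2 dotv_vec4 /vec4 !mxE /= /u /v.
  transitivity (((a1 ^+ 2 + a2 ^+ 2) * (s * b2) ^+ 2 + (b1 ^+ 2 + b2 ^+ 2) * (c * a2) ^+ 2)
    / (4 * (s * b2) ^+ 2 * (c * a2) ^+ 2)); first by field; rewrite a20 b20 c0 s0.
  by rewrite a12 b12 !mul1r.
have d33 : dotv (dual_row C 3) (dual_row C 3) = (u + v) / (4 * u * v).
  by rewrite -d22 d2 d3 !dotv_vec4 /vec4 !mxE /=; ring.
have d23 : dotv (dual_row C 2) (dual_row C 3) = (u - v) / (4 * u * v).
  rewrite d2 d3 dotv_vec4 /vec4 !mxE /= /u /v.
  transitivity (((a1 ^+ 2 + a2 ^+ 2) * (s * b2) ^+ 2 - (b1 ^+ 2 + b2 ^+ 2) * (c * a2) ^+ 2)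
    / (4 * (s * b2) ^+ 2 * (c * a2) ^+ 2)); first by field; rewrite a20 b20 c0 s0.
  by rewrite a12 b12 !mul1r.
have d02 : dotv (dual_row C 0) (dual_row C 2) = - a1 / (2 * a2 ^+ 2 * c).
  rewrite d0 d2 dotv_vec4 /vec4 !mxE /=; by field; rewrite a20 b20 c0 s0.
have d03 : dotv (dual_row C 0) (dual_row C 3) = - a1 / (2 * a2 ^+ 2 * c).
  by rewrite d0 d3 dotv_vec4 /vec4 !mxE /=; field; rewrite ?a20 ?b20 ?c0 ?s0.
have z0 : 0 <= z by exact: sqrtr_ge0.
have z2 : z ^+ 2 = u / v by rewrite sqr_sqrtr // divr_ge0 // ltW.
have q0 : 0 < 1 - (b1 * s) ^+ 2.
  have -> : 1 - (b1 * s) ^+ 2 = c ^+ 2 + u.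
    rewrite /u -[1]cs1 -[X in _ + X - _]mulr1 -b12; ring.
  by rewrite ltr_wpDl // sqr_ge0.
set t := a1 * c * z / _.
have tE : - (- a1 / (2 * a2 ^+ 2 * c)) /
    (Num.sqrt ((a2^-1) ^+ 2) * Num.sqrt ((u + v) / (4 * u * v))) =
    t / Num.sqrt (1 + t ^+ 2).
  pose r := Num.sqrt (1 - (b1 * s) ^+ 2); pose D := Num.sqrt (u + v).
  have r0 : 0 < r by rewrite sqrtr_gt0.
  have D0 : 0 < D by rewrite sqrtr_gt0.
  have r2 : r ^+ 2 = 1 - (b1 * s) ^+ 2 by rewrite sqr_sqrtr // ltW.
  have D2 : D ^+ 2 = u + v by rewrite sqr_sqrtr // ltW.
  (* Absolute values appear because [a2], [b2], [c] and [s] may have any sign once vertices are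
     replaced with antipodes. *)
  have zE : z = `|s| * `|b2| / (`|c| * `|a2|).
    apply: sqrtr_eq; first by rewrite divr_ge0 // mulr_ge0.
    by rewrite !exprMn exprVn !exprMn !real_normK ?num_real // /u /v !exprMn.
  have n2 (x : R) : `|x| ^+ 2 = x ^+ 2 by rewrite real_normK ?num_real.
  have np (x : R) : x != 0 -> 0 < `|x| by rewrite normr_gt0.
  have -> : Num.sqrt ((a2^-1) ^+ 2) = `|a2|^-1.
    by apply: sqrtr_eq; [rewrite invr_ge0|rewrite !exprVn n2].
  have -> : Num.sqrt ((u + v) / (4 * u * v)) = D / (2 * (`|s| * `|b2|) * (`|c| * `|a2|)).
    apply: sqrtr_eq; first by rewrite divr_ge0 ?(ltW D0) // !mulr_ge0.
    rewrite expr_div_n D2 !exprMn !n2 /u /v; congr (_ / _); ring.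
  have -> : Num.sqrt (1 + t ^+ 2) = `|c| * D / (r * (`|c| * `|a2|)).
    apply: sqrtr_eq; first by apply: divr_ge0; do !apply: mulr_ge0 => //; exact: ltW.
    rewrite /t -/r zE !exprMn !exprVn !exprMn !n2 D2 /u /v.
    have -> : r ^+ 2 = c ^+ 2 + (s * b2) ^+ 2.
      have b22 : b2 ^+ 2 = 1 - b1 ^+ 2 by rewrite -b12 addrC addKr.
      have c2 : c ^+ 2 = 1 - s ^+ 2 by rewrite -cs1 addrK.
      by rewrite r2 exprMn [in RHS]exprMn b22 c2; ring.
    have -> : a1 ^+ 2 = 1 - a2 ^+ 2 by rewrite -a12 addrK.
    field; rewrite a20 c0 !andbT gt_eqF // ltr_pwDl ?sqr_ge0 //.
    by rewrite exprn_even_gt0.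
  rewrite /t -/r zE.
  have cc : c / `|c| = `|c| / c by apply/eqP; rewrite eqr_div ?normr_eq0 // -!expr2 n2.
  transitivity (a1 * `|s| * `|b2| / D * (`|c| / c)).
    rewrite -(n2 a2); field; rewrite ?normr_eq0 ?a20 ?b20 ?c0 ?s0 ?gt_eqF //.
  rewrite -cc; field; rewrite ?normr_eq0 ?a20 ?b20 ?c0 ?s0 ?gt_eqF //.
have p0 := pi_gt0 R.
have dn i : dual_row C i != 0 by exact: dual_row_neq0.
have ir : isometry4 (flip_coord 2 *m flip_coord 3 : 'M[R]_4).
  by apply: isometry4M; exact: isometry4_flip.
have /= : let d := dual_row C in vol [set x | cone C x] *+ 2 =
    (wedge (d 0) (d 2) + wedge (d 0) (d 3) + wedge (d 2) (d 3) - V4 / 2) / 2.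
  by apply: (vol_cone_lune dC ir); apply/rowP; apply: ord4P;
    rewrite mulmxA !flip_coordE /vec4 !mxE //= ?oppr0 ?opprK.
rewrite !wedgeE // d00 d22 d33 d23 d02 d03 tE acos_atan.
rewrite -expr2 sqr_sqrtr; last first.
  apply: divr_ge0; [exact: ltW|apply: mulr_ge0; last exact: ltW].
  by apply: mulr_ge0 => //; exact: ltW.
have -> : - ((u - v) / (4 * u * v)) / ((u + v) / (4 * u * v)) =
    (1 - z ^+ 2) / (1 + z ^+ 2).
  rewrite z2; move: u v u0 v0 {K0 d22 d33 d23 z z0 z2 t tE} => x y x0 y0.
  by field; rewrite !gt_eqF // addr_gt0.
rewrite acos_double_atan //.
move: (vol [set x | cone C x]) (atan z) (atan t) pi p0 V4 => W x y p {}p0 V; rewrite mulr2n => E.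
have -> : W = (W + W) / 2 by field.
by rewrite E; field; rewrite gt_eqF.
Qed.

End Coordinates.
End TetrahedronValue.

(** * The volume as a function of cos^2 theta *)

Section FlexFunction.
Context {R : realType}.
Implicit Types (p q C x : R).

(* Up to a constant factor, the volume of a tetrahedron a_i b_j a_3 b_3 of the
   flexible octahedron, as a function of [C = cos theta ^+ 2]. *)
Definition flex_term p q C : R :=
  let z := Num.sqrt ((1 - q ^+ 2 - C) / (C - p ^+ 2)) in
  atan z - atan (p * z / Num.sqrt (1 - q ^+ 2)).

Lemma is_derive_flex_term p q C : p ^+ 2 < C -> C < 1 - q ^+ 2 ->
  is_derive C 1 (flex_term p q) (- (C - p * Num.sqrt (1 - q ^+ 2)) /
    (2 * C * (Num.sqrt (1 - q ^+ 2 - C) * Num.sqrt (C - p ^+ 2)))).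
Proof.
move=> pC Cq; pose r := Num.sqrt (1 - q ^+ 2).
have C0 : 0 < C by apply: le_lt_trans pC; exact: sqr_ge0.
have v0 : 0 < C - p ^+ 2 by rewrite subr_gt0.
have u0 : 0 < 1 - q ^+ 2 - C by rewrite subr_gt0.
have r20 : 0 < 1 - q ^+ 2 by exact: lt_trans C0 Cq.
pose g x := (1 - q ^+ 2 - x) / (x - p ^+ 2).
have g0 : 0 < g C by rewrite divr_gt0.
have dg : is_derive C 1 g (- (1 - q ^+ 2 - p ^+ 2) / (C - p ^+ 2) ^+ 2).
  have d1 : is_derive C 1 (fun x : R => 1 - q ^+ 2 - x) (-1).
    have -> : (fun x : R => 1 - q ^+ 2 - x) = cst (1 - q ^+ 2) - id by apply/funext.
    by apply: is_derive_eq; rewrite sub0r.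
  have d2 : is_derive C 1 (fun x : R => x - p ^+ 2) 1.
    have -> : (fun x : R => x - p ^+ 2) = id - cst (p ^+ 2) by apply/funext.
    by apply: is_derive_eq; rewrite subr0.
  have d3 : is_derive C 1 (fun x : R => (x - p ^+ 2)^-1) (- (C - p ^+ 2) ^- 2 * 1).
    by apply: is_deriveV; rewrite gt_eqF.
  have -> : g = (fun x => 1 - q ^+ 2 - x) * (fun x => (x - p ^+ 2)^-1) by apply/funext.
  apply: is_derive_eq; rewrite /GRing.scale /=; field; exact: lt0r_neq0.
pose z x := Num.sqrt (g x).
have dz : is_derive C 1 z ((2 * z C)^-1 * (- (1 - q ^+ 2 - p ^+ 2) / (C - p ^+ 2) ^+ 2)).
  have ds := is_derive1_sqrt g0.
  by have := @is_derive1_comp R (@Num.sqrt R) g C _ _ ds dg.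
have d1 := @is_derive1_comp R (@atan R) z C _ _ (is_derive1_atan _) dz.
have dkz : is_derive C 1 ((p / r) \*: z) ((p / r) *: ((2 * z C)^-1 *
    (- (1 - q ^+ 2 - p ^+ 2) / (C - p ^+ 2) ^+ 2))) by exact: is_deriveZ.
have d2 := @is_derive1_comp R (@atan R) _ C _ _ (is_derive1_atan _) dkz.
have -> : flex_term p q = (atan \o z) - (atan \o ((p / r) \*: z)).
  apply/funext => x; rewrite /flex_term /= -/(g x) -/(z x) -/r.
  by congr (atan _ - atan _); rewrite /GRing.scale /= mulrAC.
apply: is_derive_eq.
rewrite /GRing.scale /= -/r.
set u := Num.sqrt (1 - q ^+ 2 - C); set w := Num.sqrt (C - p ^+ 2).
have u2 : u ^+ 2 = 1 - q ^+ 2 - C by rewrite sqr_sqrtr // ltW.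
have w2 : w ^+ 2 = C - p ^+ 2 by rewrite sqr_sqrtr // ltW.
have r2 : r ^+ 2 = 1 - q ^+ 2 by rewrite sqr_sqrtr // ltW.
have up : 0 < u by rewrite sqrtr_gt0.
have wp : 0 < w by rewrite sqrtr_gt0.
have rp : 0 < r by rewrite sqrtr_gt0.
have -> : z C = u / w by rewrite /z /g sqrtrM ?ltW // sqrtrV ?ltW.
(* [k] equals [1 - q ^+ 2 - p ^+ 2]. It is a factor of the numerators of both [1 + z ^+ 2] and its
   analogue for the second arctangent, and cancels against the derivative of [z ^+ 2]. *)
pose k := u ^+ 2 + w ^+ 2; have kp : 0 < k by rewrite addr_gt0 ?exprn_gt0.
have -> : 1 - q ^+ 2 - p ^+ 2 = k by rewrite /k u2 w2; ring.
have -> : (1 + (u / w) ^+ 2)^-1 = w ^+ 2 / k.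
  have -> : 1 + (u / w) ^+ 2 = k / w ^+ 2 by rewrite /k; field; rewrite gt_eqF.
  by rewrite invf_div.
have -> : (1 + (p / r * (u / w)) ^+ 2)^-1 = r ^+ 2 * w ^+ 2 / (k * C).
  have CE : C = w ^+ 2 + p ^+ 2 by rewrite w2 subrK.
  have rE : r ^+ 2 = u ^+ 2 + C by rewrite r2 u2 subrK.
  have -> : 1 + (p / r * (u / w)) ^+ 2 = (k * C) / (r ^+ 2 * w ^+ 2).
    transitivity ((r ^+ 2 * w ^+ 2 + p ^+ 2 * u ^+ 2) / (r ^+ 2 * w ^+ 2)).
      by field; rewrite !gt_eqF.
    by rewrite rE /k CE; congr (_ / _); ring.
  by rewrite invf_div.
rewrite -w2; clearbody u w r k.
by field; rewrite !gt_eqF.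
Qed.

Definition flex_fun (p q sp sq : bool -> R) C : R :=
  \sum_i \sum_j sp i * sq j * flex_term (p i) (q j) C.

Lemma roots_seq (P : {poly R}) : P != 0 -> exists s : seq R, forall x, root P x -> x \in s.
Proof.
have [n] := ubnP (size P); elim: n P => // n IHn P sP P0.
have [[x Px]|noroot] := pselect (exists x, root P x); last first.
  by exists [::] => x Px; case: noroot; exists x.
have /factor_theorem[Q PQ] := Px.
have Q0 : Q != 0 by apply: contra_neq P0 => Q0; rewrite PQ Q0 mul0r.
have [|s sE] := IHn Q _ Q0.
  by move: sP; rewrite PQ size_Mmonic ?monicXsubC // size_XsubC addn2.
exists (x :: s) => y; rewrite PQ rootM root_XsubC inE => /orP[/sE ->|->] //.
by rewrite orbT.
Qed.

Section SignsFixed.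
Variables p q sp sq : bool -> R.
Hypotheses (sp1 : forall i, sp i ^+ 2 = 1) (sq1 : forall j, sq j ^+ 2 = 1).
Hypotheses (hp : p false ^+ 2 != p true ^+ 2) (hq : q false ^+ 2 != q true ^+ 2).

Let dom C := (forall i, p i ^+ 2 < C) /\ (forall j, C < 1 - q j ^+ 2).

Let r j := Num.sqrt (1 - q j ^+ 2).

(** After the first squaring, the equation for a zero of the slope still contains the product of the
    two roots in [q]. Up to sign and a factor 2, [D1] is its coefficient; [E1] collects the
    remaining terms. *)
Let D1 (x : R) := (x - p true ^+ 2) * ((x - p false * r false) * (x - p false * r true))
  - (x - p false ^+ 2) * ((x - p true * r false) * (x - p true * r true)).

Let E1 (x : R) := (x - p true ^+ 2) *
    ((x - p false * r false) ^+ 2 * (r true ^+ 2 - x)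
     + (x - p false * r true) ^+ 2 * (r false ^+ 2 - x))
  - (x - p false ^+ 2) *
    ((x - p true * r false) ^+ 2 * (r true ^+ 2 - x)
     + (x - p true * r true) ^+ 2 * (r false ^+ 2 - x)).

Let flex_slope x := \sum_i \sum_j sp i * sq j * (- (x - p i * r j) /
    (2 * x * (Num.sqrt (1 - q j ^+ 2 - x) * Num.sqrt (x - p i ^+ 2)))).

Lemma is_derive_flex_fun x : dom x -> is_derive x 1 (flex_fun p q sp sq) (flex_slope x).
Proof.
move=> [px qx].
have -> : flex_fun p q sp sq =
   (sp true * sq true) \*: flex_term (p true) (q true)
   + (sp true * sq false) \*: flex_term (p true) (q false)
   + ((sp false * sq true) \*: flex_term (p false) (q true)
   + (sp false * sq false) \*: flex_term (p false) (q false)).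
  by apply/funext => y; rewrite /flex_fun !big_bool.
rewrite /flex_slope !big_bool /=.
have h i j := is_derive_flex_term (px i) (qx j).
exact: (is_deriveD
  (is_deriveD (is_deriveZ _ (h true true)) (is_deriveZ _ (h true false)))
  (is_deriveD (is_deriveZ _ (h false true)) (is_deriveZ _ (h false false)))).
Qed.

(* Squaring twice removes the four square roots. *)
Lemma flex_slope_eq0 x : dom x -> flex_slope x = 0 ->
  E1 x ^+ 2 = 4 * D1 x ^+ 2 * ((r true ^+ 2 - x) * (r false ^+ 2 - x)).
Proof.
move=> [px qx]; rewrite /flex_slope !big_bool /=.
have x0 : 0 < x by apply: le_lt_trans (px true); exact: sqr_ge0.
have r2 j : r j ^+ 2 = 1 - q j ^+ 2.
  by rewrite sqr_sqrtr // ltW // (lt_trans x0).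
pose Y j := Num.sqrt (1 - q j ^+ 2 - x); pose X i := Num.sqrt (x - p i ^+ 2).
have Y2 j : Y j ^+ 2 = r j ^+ 2 - x by rewrite sqr_sqrtr ?r2 // subr_ge0 ltW.
have X2 i : X i ^+ 2 = x - p i ^+ 2 by rewrite sqr_sqrtr ?r2 // subr_ge0 ltW.
have Y0 j : Y j != 0 by rewrite gt_eqF // sqrtr_gt0 subr_gt0.
have X0 i : X i != 0 by rewrite gt_eqF // sqrtr_gt0 subr_gt0.
rewrite -!/(Y _) -!/(X _) => S0.
pose U i := sq false * (x - p i * r false) * Y true + sq true * (x - p i * r true) * Y false.
have S1 : sp false * X true * U false = - (sp true * X false * U true).
  apply/eqP; rewrite -addr_eq0; apply/eqP.
  rewrite -[RHS](mulr0 (- (2 * x * (Y true * Y false * X true * X false)))) -S0.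
  by rewrite /U; field; rewrite ?Y0 ?X0 ?gt_eqF.
have S2 : X true ^+ 2 * U false ^+ 2 = X false ^+ 2 * U true ^+ 2.
  have := congr1 (fun y => y ^+ 2) S1; rewrite /= sqrrN !exprMn !sp1 !mul1r.
  by [].
have U2 i : U i ^+ 2 = (x - p i * r false) ^+ 2 * (r true ^+ 2 - x)
    + (x - p i * r true) ^+ 2 * (r false ^+ 2 - x)
    + 2 * (sq false * sq true) * ((x - p i * r false) * (x - p i * r true))
      * (Y true * Y false).
  rewrite -!Y2 /U; transitivity (sq false ^+ 2 * ((x - p i * r false) ^+ 2 * Y true ^+ 2)
    + sq true ^+ 2 * ((x - p i * r true) ^+ 2 * Y false ^+ 2)
    + 2 * (sq false * sq true) * ((x - p i * r false) * (x - p i * r true))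
      * (Y true * Y false)); first by ring.
  by rewrite !sq1; ring.
have E : E1 x = - (2 * (sq false * sq true) * (Y true * Y false)) * D1 x.
  apply/eqP; rewrite -subr_eq0; apply/eqP.
  move/eqP: S2; rewrite -subr_eq0 => /eqP <-; rewrite !U2 !X2 /E1 /D1; ring.
rewrite E -!Y2; transitivity (sq false ^+ 2 * sq true ^+ 2 *
  (4 * D1 x ^+ 2 * (Y true ^+ 2 * Y false ^+ 2))); first by ring.
by rewrite !sq1; ring.
Qed.

Let Dp : {poly R} := ('X - (p true ^+ 2)%:P) *
   (('X - (p false * r false)%:P) * ('X - (p false * r true)%:P))
  - ('X - (p false ^+ 2)%:P) * (('X - (p true * r false)%:P) * ('X - (p true * r true)%:P)).

Let Ep : {poly R} := ('X - (p true ^+ 2)%:P) *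
    (('X - (p false * r false)%:P) ^+ 2 * ((r true ^+ 2)%:P - 'X)
     + ('X - (p false * r true)%:P) ^+ 2 * ((r false ^+ 2)%:P - 'X))
  - ('X - (p false ^+ 2)%:P) *
    (('X - (p true * r false)%:P) ^+ 2 * ((r true ^+ 2)%:P - 'X)
     + ('X - (p true * r true)%:P) ^+ 2 * ((r false ^+ 2)%:P - 'X)).

Let Qp : {poly R} := Ep ^+ 2 - 4%:P * Dp ^+ 2 * (((r true ^+ 2)%:P - 'X) * ((r false ^+ 2)%:P - 'X)).

Lemma flex_poly_horner x : Qp.[x] =
  E1 x ^+ 2 - 4 * D1 x ^+ 2 * ((r true ^+ 2 - x) * (r false ^+ 2 - x)).
Proof. rewrite /Qp /Ep /Dp /E1 /D1 !hornerE /=; ring. Qed.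

(** If [Qp] were zero, [Dp] would have infinitely many roots between the two values of [r j ^+ 2],
    which are distinct by [hq]; but [Dp] is nonzero by [hp]. *)
Lemma flex_poly_neq0 x0 : dom x0 -> Qp != 0.
Proof.
move=> [px qx].
have x00 : 0 < x0 by apply: le_lt_trans (px true); exact: sqr_ge0.
have r2 j : r j ^+ 2 = 1 - q j ^+ 2.
  by rewrite sqr_sqrtr // ltW // (lt_trans x00).
have rp j : 0 < r j by rewrite sqrtr_gt0 (lt_trans x00).
have pr i j : p i - r j != 0.
  rewrite lt_eqF // subr_lt0; apply: (le_lt_trans (ler_norm _)).
  rewrite -(@ltr_pXn2r _ 2) ?nnegrE ?(ltW (rp _)) // real_normK ?num_real //.
  by rewrite r2 (lt_trans (px i)).
have Dx x : Dp.[x] = D1 x by rewrite /Dp /D1 !hornerE.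
have Dp0 : Dp != 0.
  apply/eqP => D0.
  (* At [p i ^+ 2] one of the two products of [D1] vanishes and the other factors completely. Its
     only factor that can vanish is [p i], since [p i < r j]. *)
  have Z i : p i = 0.
    apply/eqP; have := Dx (p i ^+ 2); rewrite D0 horner0 /D1 => /eqP.
    have F0 : p false ^+ 2 - p true ^+ 2 != 0 by rewrite subr_eq0.
    case: i; rewrite eq_sym.
      have -> : (p true ^+ 2 - p true ^+ 2) *
        ((p true ^+ 2 - p false * r false) * (p true ^+ 2 - p false * r true)) -
        (p true ^+ 2 - p false ^+ 2) *
        ((p true ^+ 2 - p true * r false) * (p true ^+ 2 - p true * r true)) =
        (p false ^+ 2 - p true ^+ 2) * (p true * p true) *
        ((p true - r false) * (p true - r true)) by ring.
      by rewrite !mulf_eq0 (negPf F0) !(negPf (pr _ _)) !orbF orbb.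
    have -> : (p false ^+ 2 - p true ^+ 2) *
        ((p false ^+ 2 - p false * r false) * (p false ^+ 2 - p false * r true)) -
        (p false ^+ 2 - p false ^+ 2) *
        ((p false ^+ 2 - p true * r false) * (p false ^+ 2 - p true * r true)) =
        (p false ^+ 2 - p true ^+ 2) * (p false * p false) *
        ((p false - r false) * (p false - r true)) by ring.
    by rewrite !mulf_eq0 (negPf F0) !(negPf (pr _ _)) !orbF orbb.
  by move: hp; rewrite !Z eqxx.
have [s sP] := roots_seq Dp0.
apply/eqP => Q0.
(* Between r_1^2 and r_2^2 the identity E^2 = 4 D^2 (r_1^2 - x)(r_2^2 - x)
   forces D to vanish. *)
have Dneg x : (r true ^+ 2 - x) * (r false ^+ 2 - x) < 0 -> x \in s.
  move=> neg; apply: sP; rewrite /root Dx.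
  have := flex_poly_horner x; rewrite Q0 horner0 => /eqP; rewrite eq_sym subr_eq0 => /eqP E.
  apply/negPn/negP => D0.
  have : E1 x ^+ 2 < 0 by rewrite E pmulr_rlt0 // pmulr_rgt0 // exprn_even_gt0.
  by rewrite ltNge sqr_ge0.
have rne : r true ^+ 2 != r false ^+ 2.
  by rewrite !r2 (inj_eq (addrI _)) eqr_opp eq_sym.
(* An infinite family of points; [n.+2] keeps them strictly between the ends. *)
pose y (n : nat) := r true ^+ 2 + (r false ^+ 2 - r true ^+ 2) / n.+2%:R.
have yinj : injective y.
  move=> m n /addrI /mulfI; rewrite subr_eq0 eq_sym => /(_ rne)/invr_inj/eqP.
  by rewrite eqr_nat => /eqP[].
have ys n : y n \in s.
  apply: Dneg.
  have n2 : 1 < n.+2%:R :> R by rewrite ltr1n.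
  have -> : (r true ^+ 2 - y n) * (r false ^+ 2 - y n) =
    - ((r false ^+ 2 - r true ^+ 2) ^+ 2 * (n.+2%:R^-1 * (1 - n.+2%:R^-1))).
    by rewrite /y; move: (n.+2%:R^-1) => m; ring.
  rewrite oppr_lt0 mulr_gt0 ?exprn_even_gt0 //= ?subr_eq0 1?eq_sym //.
  by rewrite mulr_gt0 ?invr_gt0 // subr_gt0 invf_lt1 // (lt_trans ltr01).
have := @uniq_leq_size _ (map y (iota 0 (size s).+1)) s.
rewrite map_inj_uniq // iota_uniq size_map size_iota ltnn => /(_ isT) H.
by have : false by apply: H => _ /mapP[n _ ->].
Qed.

Lemma flex_fun_preimage_countable (K : set R) : countable K ->
  countable [set x | dom x /\ K (flex_fun p q sp sq x)].
Proof.
move=> /countable_injP[k kinj].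
have [[x0 [x0d _]]|no] := pselect (exists x, dom x /\ K (flex_fun p q sp sq x)); last first.
  rewrite (_ : [set x | _] = set0) //; apply/seteqP; split=> x // xd.
  by case: no; exists x.
have [s sP] := roots_seq (flex_poly_neq0 x0d).
(* By Rolle's theorem, a point is determined by the value of the function and
   the number of roots in [s] below the point. *)
apply/countable_injP.
exists (fun x => choice.pickle (k (flex_fun p q sp sq x), count (fun z : R => (z < x)%R) s)).
suff lt_count x y : dom x -> dom y -> x < y ->
    flex_fun p q sp sq x = flex_fun p q sp sq y ->
    (count (fun z : R => (z < x)%R) s < count (fun z : R => (z < y)%R) s)%N.
  move=> x y; rewrite !inE => -[dx Kx] [dy Ky] /(pcan_inj choice.pickleK)[Fxy cxy].
  have {}Fxy : flex_fun p q sp sq x = flex_fun p q sp sq y by apply: kinj; rewrite ?inE.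
  have [xy|xy|//] := ltgtP x y.
    by have := lt_count x y dx dy xy Fxy; rewrite cxy ltnn.
  by have := lt_count y x dy dx xy (esym Fxy); rewrite cxy ltnn.
move=> [px qx] [py qy] xy Fxy.
have din z : x <= z <= y -> dom z.
  move=> /andP[xz zy]; split=> i; first exact: lt_le_trans (px i) xz.
  exact: le_lt_trans zy (qy i).
have [| |z zxy dz] := Rolle xy _ _ Fxy.
- move=> z; rewrite in_itv /= => /andP[xz zy].
  have dz : dom z by apply: din; rewrite !ltW.
  by have [] := is_derive_flex_fun dz.
- apply: derivable_within_continuous => z; rewrite in_itv /= => /din dz.
  by have [] := is_derive_flex_fun dz.
move: zxy; rewrite in_itv /= => /andP[xz zy].
have domz : dom z by apply: din; rewrite !ltW.
have zs : z \in s.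
  apply: sP; rewrite /root flex_poly_horner subr_eq0; apply/eqP/flex_slope_eq0 => //.
  have [_ <-] := is_derive_flex_fun domz.
  by have [_ ->] := dz.
rewrite [ltnRHS](_ : _ = (count (fun w : R => (w < x)%R) s + count (fun w : R => (x <= w < y)%R) s)%N).
  by rewrite -[ltnLHS]addn0 ltn_add2l -has_count; apply/hasP; exists z => //; rewrite ltW.
elim: (s) => //= w t ->; rewrite addnACA; congr (_ + _)%N.
have [wx|xw] := ltP w x; first by rewrite (lt_trans wx xy).
by rewrite add0n.
Qed.

End SignsFixed.
End FlexFunction.

(** * Octahedron volumes seen from an apex on the bisector *)

Section OctahedronValue.
Context {R : realType}.
Implicit Types (C : 'M[R]_4) (P : octahedron R) (u v w x y z : 'rV[R]_4).
Local Notation V4 := (vol (setT : set 'rV[R]_4)).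

Lemma signed_vol_isometry C (A : 'M[R]_4) : isometry4 A -> \det A = 1 ->
  \det C != 0 -> signed_vol (C *m A) = signed_vol C.
Proof.
move=> iA dA dC; rewrite /signed_vol det_mulmx dA mulr1; congr (_ * _).
have dCA : \det (C *m A) != 0 by rewrite det_mulmx dA mulr1.
have dual i : dual_row (C *m A) i = dual_row C i *m A.
  symmetry; apply: dual_row_eq => // j.
  by rewrite row_mul iA.2 dual_row_row.
rewrite -(vol_isometry iA (measurable4_cone _)).
congr vol; apply/seteqP; split=> x /forallP xC; apply/forallP => i;
  by have := xC i; rewrite dual iA.2.
Qed.

Definition swap_planes : 'M[R]_4 :=
  mx4 (vec4 0 0 1 0) (vec4 0 0 0 1) (vec4 1 0 0 0) (vec4 0 1 0 0).

Lemma mulmx_swap_planes u : u *m swap_planes = vec4 (u 0 2) (u 0 3) (u 0 0) (u 0 1).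
Proof.
rewrite mul_mx4; apply/rowP; apply: ord4P; rewrite /vec4 !mxE /=; ring.
Qed.

Lemma det_swap_planes : \det swap_planes = 1.
Proof. rewrite det4E /swap_planes /mx4 /vec4 !mxE /=; ring. Qed.

Lemma isometry4_swap_planes : isometry4 swap_planes.
Proof.
have -> : swap_planes = givens 0 2 0 1 *m flip_coord 0 *m (givens 1 3 0 1 *m flip_coord 1).
  apply: mulmx_rowP => u; rewrite mulmx_swap_planes !mulmxA; apply/rowP.
  by apply: ord4P; rewrite /vec4 !flip_coordE !givensE // !flip_coordE !givensE //= mxE /=; ring.
have h : (0 : R) ^+ 2 + 1 ^+ 2 = 1 by ring.
by apply: isometry4M; apply: isometry4M; [exact: isometry4_givens|exact: isometry4_flip
  |exact: isometry4_givens|exact: isometry4_flip].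
Qed.

Lemma sum_ffun3 (F : bool -> bool -> bool -> R) :
  \sum_(e : {ffun 'I_3 -> bool}) F (e 0) (e 1) (e 2) =
  \sum_i \sum_j \sum_k F i j k.
Proof.
pose h (t : bool * bool * bool) : {ffun 'I_3 -> bool} :=
  [ffun i : 'I_3 => nth false [:: t.1.1; t.1.2; t.2] i].
pose h' (e : {ffun 'I_3 -> bool}) := (e 0, e 1, e 2).
rewrite (reindex h) /=; last first.
  exists h' => [[[i j] k] _|e _]; first by rewrite /h' /h !ffunE.
  by apply/ffunP; apply: ord3P; rewrite /h /h' !ffunE.
by rewrite !pair_big /=; apply: eq_bigr => -[[i j] k] _; rewrite /h !ffunE.
Qed.

(** Faces are grouped by their edge u_1 u_2, so that for an apex on the bisector each bracket
    becomes a single tetrahedron on the diagonal. *)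
Lemma apex_sumE o P : apex_sum o P =
  \sum_(i : bool) \sum_(j : bool) (-1) ^+ (i + j)%N *
  (signed_vol4 o (vertex P 0 i) (vertex P 1 j) (vertex P 2 false)
   - signed_vol4 o (vertex P 0 i) (vertex P 1 j) (vertex P 2 true)).
Proof.
rewrite /apex_sum.
transitivity (\sum_(e : {ffun 'I_3 -> bool}) (-1) ^+ (e 0%R + e 1%R + e 2%R)%N *
  signed_vol4 o (vertex P 0 (e 0)) (vertex P 1 (e 1)) (vertex P 2 (e 2))).
  apply: eq_bigr => e _; congr (_ ^+ _ * _); rewrite !big_ord_recr big_ord0 /= add0n.
  by congr (_ (e _) + _ (e _) + _ (e _))%N; apply/val_inj.
rewrite (@sum_ffun3 (fun i j k : bool => (-1) ^+ (i + j + k)%N *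
  signed_vol4 o (vertex P 0 i) (vertex P 1 j) (vertex P 2 k))).
apply: eq_bigr => i _; apply: eq_bigr => j _.
by rewrite big_bool /= addn1 addn0 exprS; ring.
Qed.

Section Coordinates.
Variables (P : octahedron R) (a a' b b' : bool -> R) (c s : R).
Hypotheses (aP : forall i, vertex P 0 i = vec4 (a i) (a' i) 0 0)
  (bP : forall j, vertex P 1 j = vec4 0 0 (b j) (b' j))
  (a1 : forall i, a i ^+ 2 + a' i ^+ 2 = 1) (b1 : forall i, b i ^+ 2 + b' i ^+ 2 = 1)
  (cs1 : c ^+ 2 + s ^+ 2 = 1) (c0 : c != 0) (s0 : s != 0)
  (a0 : forall i, a' i != 0) (b0 : forall i, b' i != 0).

(** Along the flexion these products stay constant: up to sign they are the p_i and, for [qP], the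
    q_j. *)
Let pP i := a i * c.
Let qP j := b j * s.
Let sgP i : R := (-1) ^+ nat_of_bool i * Num.sg (a' i).
Let sgQ j : R := (-1) ^+ nat_of_bool j * Num.sg (b' j).

Lemma signed_vol_diag_tetra i j : signed_vol (diag_tetra (a i) (a' i) (b j) (b' j) c s) =
  Num.sg (a' i) * Num.sg (b' j) * Num.sg (c * s) * (V4 / (4 * pi)) *
  flex_term (pP i) (qP j) (c ^+ 2).
Proof.
rewrite /signed_vol vol_diag_tetra // det_diag_tetra.
have -> : Num.sg (2 * (a' i * b' j * c * s)) =
    Num.sg (a' i) * Num.sg (b' j) * Num.sg (c * s).
  by rewrite !sgrM gtr0_sg // mul1r !mulrA.
rewrite mulrA; congr (_ * _); rewrite /flex_term /pP /qP.
have -> : (s * b' j) ^+ 2 = 1 - (b j * s) ^+ 2 - c ^+ 2.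
  have -> : c ^+ 2 = 1 - s ^+ 2 by rewrite -cs1 addrK.
  have -> : (s * b' j) ^+ 2 = s ^+ 2 * (1 - b j ^+ 2) by rewrite -(b1 j); ring.
  ring.
have -> : (c * a' i) ^+ 2 = c ^+ 2 - (a i * c) ^+ 2.
  have -> : (c * a' i) ^+ 2 = c ^+ 2 * (1 - a i ^+ 2) by rewrite -(a1 i); ring.
  ring.
by [].
Qed.

Lemma apex_sum_caseI : vertex P 2 false = vec4 c 0 s 0 ->
    vertex P 2 true = vec4 c 0 (- s) 0 ->
  let o := vec4 (Num.sg c) 0 0 0 in
  (forall e, \det (face_tetra o P e) != 0) /\
  apex_sum o P = - (Num.sg (c * s) * (V4 / (4 * pi))) * flex_fun pP qP sgP sgQ (c ^+ 2).
Proof.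
move=> xP yP o.
have k0 : 0 < (2 * `|c|)^-1 by rewrite invr_gt0 mulr_gt0 // normr_gt0.
(* The multiple of the sum of the two ends must be positive for the cutting lemma; hence the sign of
   [c] in [o]. *)
have oE : o = (2 * `|c|)^-1 *: (vec4 c 0 s 0 + vec4 c 0 (- s) 0).
  apply/rowP; apply: ord4P; rewrite /o /vec4 !mxE /=; try ring.
  have -> : (2 * `|c|)^-1 * (c + c) = c / `|c| by field; rewrite normr_eq0.
  by rewrite [X in _ = X / _]numEsg mulfK ?normr_eq0.
have dC i j : \det (diag_tetra (a i) (a' i) (b j) (b' j) c s) != 0.
  exact: det_diag_tetra_neq0.
split=> [e|].
  rewrite /face_tetra aP bP; case: (e 2); rewrite ?xP ?yP oE.
    rewrite addrC det_diag mx4_swap23 det_xrow // mulrNN.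
    by apply: mulf_neq0; [rewrite gt_eqF|exact: dC].
  by rewrite det_diag; apply: mulf_neq0; [rewrite oppr_eq0 gt_eqF|exact: dC].
rewrite apex_sumE /flex_fun mulr_sumr; apply: eq_bigr => i _.
rewrite mulr_sumr; apply: eq_bigr => j _.
rewrite aP bP xP yP oE signed_vol_diag //; last exact: dC.
have -> : signed_vol4 (vec4 (a i) (a' i) 0 0) (vec4 0 0 (b j) (b' j)) (vec4 c 0 s 0)
  (vec4 c 0 (- s) 0) = signed_vol (diag_tetra (a i) (a' i) (b j) (b' j) c s) by [].
by rewrite signed_vol_diag_tetra /sgP /sgQ exprD; ring.
Qed.

End Coordinates.

(* The exchange of the two coordinate planes reduces this case to the
   previous one. *)
Lemma apex_sum_caseII P (a a' b b' : bool -> R) (c s : R) :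
  (forall i, vertex P 0 i = vec4 (a i) (a' i) 0 0) ->
  (forall j, vertex P 1 j = vec4 0 0 (b j) (b' j)) ->
  (forall i, a i ^+ 2 + a' i ^+ 2 = 1) -> (forall i, b i ^+ 2 + b' i ^+ 2 = 1) ->
  c ^+ 2 + s ^+ 2 = 1 -> c != 0 -> s != 0 ->
  (forall i, a' i != 0) -> (forall i, b' i != 0) ->
  vertex P 2 false = vec4 c 0 s 0 -> vertex P 2 true = vec4 (- c) 0 s 0 ->
  let o := vec4 0 0 (Num.sg s) 0 in
  (forall e, \det (face_tetra o P e) != 0) /\
  apex_sum o P = Num.sg (c * s) * (V4 / (4 * pi)) *
    flex_fun (fun j => b j * s) (fun i => a i * c)
      (fun j => (-1) ^+ nat_of_bool j * Num.sg (b' j))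
      (fun i => (-1) ^+ nat_of_bool i * Num.sg (a' i)) (s ^+ 2).
Proof.
move=> aP bP a1 b1 cs1 c0 s0 a0 b0 xP yP o.
have sc1 : s ^+ 2 + c ^+ 2 = 1 by rewrite addrC.
have k0 : 0 < (2 * `|s|)^-1 by rewrite invr_gt0 mulr_gt0 // normr_gt0.
have oE : o = (2 * `|s|)^-1 *: (vec4 c 0 s 0 + vec4 (- c) 0 s 0).
  apply/rowP; apply: ord4P; rewrite /o /vec4 !mxE /=; try ring.
  have -> : (2 * `|s|)^-1 * (s + s) = s / `|s| by field; rewrite normr_eq0.
  by rewrite [X in _ = X / _]numEsg mulfK ?normr_eq0.
pose D i j := diag_tetra (b j) (b' j) (a i) (a' i) s c.
have dD i j : \det (D i j) != 0 by exact: det_diag_tetra_neq0.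
pose T i j := mx4 (vec4 (a i) (a' i) 0 0) (vec4 0 0 (b j) (b' j)) (vec4 c 0 s 0)
  (vec4 (- c) 0 s 0).
(* Exchanging the planes puts the vertex with index [j] first, so two rows are transposed as well;
   this is the sign in [vT]. *)
have TD i j : T i j = xrow 0 1 (D i j *m swap_planes).
  rewrite /T mx4_swap01; congr xrow; apply/row_matrixP.
  by apply: ord4P; rewrite row_mul !rowK /= mulmx_swap_planes /vec4 !mxE.
have dDS i j : \det (D i j *m swap_planes) != 0.
  by rewrite det_mulmx det_swap_planes mulr1.
have dT i j : \det (T i j) != 0 by rewrite TD det_xrow // oppr_eq0.
have vT i j : signed_vol (T i j) = - signed_vol (D i j).
  rewrite TD signed_vol_xrow // signed_vol_isometry //.
    exact: isometry4_swap_planes.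
  exact: det_swap_planes.
split=> [e|].
  rewrite /face_tetra aP bP; case: (e 2); rewrite ?xP ?yP oE.
    rewrite addrC det_diag mx4_swap23 det_xrow // mulrNN.
    by apply: mulf_neq0; [rewrite gt_eqF|exact: dT].
  by rewrite det_diag; apply: mulf_neq0; [rewrite oppr_eq0 gt_eqF|exact: dT].
rewrite apex_sumE /flex_fun exchange_big mulr_sumr; apply: eq_bigr => j _.
rewrite mulr_sumr; apply: eq_bigr => i _.
rewrite aP bP xP yP oE signed_vol_diag //; last exact: dT.
rewrite /signed_vol4 -/(T i j) vT opprK /D.
rewrite (@signed_vol_diag_tetra b b' a a' s c b1 a1 sc1 s0 c0 b0 a0).
by rewrite exprD [s * c]mulrC; ring.
Qed.

End OctahedronValue.

(** * The flexible octahedron *)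

Section FlexGeometry.
Context {R : realType}.
Implicit Types t : R.
Variables p1 p2 q1 q2 : R.
Hypotheses (hp : `|p1| != `|p2|) (hq : `|q1| != `|q2|)
  (hpq : Num.max (p1 ^+ 2) (p2 ^+ 2) + Num.max (q1 ^+ 2) (q2 ^+ 2) < 1).

Local Notation flex := (flex_octahedron p1 p2 q1 q2).
Local Notation tmin := (theta_min q1 q2).
Local Notation tmax := (theta_max p1 p2).

Let mp : R := Num.max `|p1| `|p2|.
Let mq : R := Num.max `|q1| `|q2|.

Definition sel (T : Type) (x y : T) (b : bool) : T := if b then y else x.

Let p : bool -> R := sel p1 p2.
Let q : bool -> R := sel q1 q2.

Lemma max_sqr (x y : R) : Num.max `|x| `|y| ^+ 2 = Num.max (x ^+ 2) (y ^+ 2).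
Proof.
have h : (`|x| <= `|y|) = (x ^+ 2 <= y ^+ 2).
  by rewrite -(@ler_pXn2r _ 2) ?nnegrE // !real_normK ?num_real.
by rewrite !maxEle h; case: ifP => _; rewrite real_normK ?num_real.
Qed.

Lemma mpq_lt1 : mp ^+ 2 + mq ^+ 2 < 1.
Proof. by rewrite /mp /mq !max_sqr. Qed.

(** With distinct absolute values the two numbers are not both 0. This keeps [cos] and [sin]
    positive up to the ends of the parameter interval. *)
Lemma max_norm_gt0 (x y : R) : `|x| != `|y| -> 0 < Num.max `|x| `|y|.
Proof.
move=> xy; rewrite lt_max !normr_gt0; apply/negPn; rewrite negb_or !negbK.
by apply: contraNN xy => /andP[/eqP -> /eqP ->].
Qed.

Lemma mp_gt0 : 0 < mp. Proof. exact: max_norm_gt0. Qed.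
Lemma mq_gt0 : 0 < mq. Proof. exact: max_norm_gt0. Qed.

Lemma mp_lt1 : mp < 1.
Proof.
have := mpq_lt1; have := sqr_ge0 mq; rewrite -(expr1n _ 2) => ? ?.
rewrite -(@ltr_pXn2r _ 2) ?nnegrE ?ler01 ?ltW ?mp_gt0 //; lra.
Qed.

Lemma mq_lt1 : mq < 1.
Proof.
have := mpq_lt1; have := sqr_ge0 mp; rewrite -(expr1n _ 2) => ? ?.
rewrite -(@ltr_pXn2r _ 2) ?nnegrE ?ler01 ?ltW ?mq_gt0 //; lra.
Qed.

Lemma norm_p i : `|p i| <= mp.
Proof. by case: i; rewrite /p /= le_max lexx ?orbT. Qed.

Lemma norm_q i : `|q i| <= mq.
Proof. by case: i; rewrite /q /= le_max lexx ?orbT. Qed.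

Lemma sin_tmin : sin tmin = mq.
Proof. by rewrite asinK // in_itv /= (le_trans _ (ltW mq_gt0)) ?lerN10 // ltW // mq_lt1. Qed.

Lemma cos_tmax : cos tmax = mp.
Proof. by rewrite acosK // in_itv /= (le_trans _ (ltW mp_gt0)) ?lerN10 // ltW // mp_lt1. Qed.

Lemma tmin_bounds : 0 < tmin < pi / 2.
Proof.
have m1 : -1 <= mq <= 1 by rewrite (le_trans _ (ltW mq_gt0)) ?lerN10 // ltW // mq_lt1.
have m2 : -1 <= mq < 1 by rewrite (le_trans _ (ltW mq_gt0)) ?lerN10 // mq_lt1.
rewrite asin_ltpi2 // andbT; have p0 := pi_gt0 R.
rewrite -ltr_sin ?sin_tmin ?sin0 ?mq_gt0 // in_itv /=.
  by move: (pi : R) p0 => P P0; apply/andP; split; lra.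
by rewrite asin_geNpi2 ?asin_lepi2.
Qed.

Lemma tmax_bounds : 0 < tmax < pi / 2.
Proof.
have m1 : -1 <= mp <= 1 by rewrite (le_trans _ (ltW mp_gt0)) ?lerN10 // ltW // mp_lt1.
have m2 : -1 <= mp < 1 by rewrite (le_trans _ (ltW mp_gt0)) ?lerN10 // mp_lt1.
rewrite acos_gt0 //=; have p0 := pi_gt0 R.
rewrite -ltr_cos ?cos_tmax ?cos_pihalf ?mp_gt0 // in_itv /=.
  by rewrite acos_ge0 ?acos_lepi.
by move: (pi : R) p0 => P P0; apply/andP; split; lra.
Qed.

Lemma theta_bounds t : tmin <= t <= tmax -> 0 < t < pi / 2.
Proof.
move=> /andP[t1 t2]; have /andP[m0 _] := tmin_bounds; have /andP[_ M1] := tmax_bounds.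
by rewrite (lt_le_trans m0 t1) (le_lt_trans t2 M1).
Qed.

Lemma in_sin_itv t : 0 < t < pi / 2 -> t \in `[- (pi / 2), pi / 2].
Proof.
move=> /andP[t0 t1]; rewrite in_itv /=.
by move: (pi : R) t1 => P t1; apply/andP; split; lra.
Qed.

Lemma in_cos_itv t : 0 < t < pi / 2 -> t \in `[0, pi].
Proof.
move=> /andP[t0 t1]; rewrite in_itv /=.
by move: (pi : R) t1 => P t1; apply/andP; split; lra.
Qed.

Lemma tmin_lt_tmax : tmin < tmax.
Proof.
have b1 := tmin_bounds; have b2 := tmax_bounds.
rewrite -ltr_sin ?in_sin_itv // sin_tmin.
have s0 : 0 <= sin tmax.
  by apply: sin_ge0_pi; have := in_cos_itv b2; rewrite in_itv.
rewrite -(@ltr_pXn2r _ 2) ?nnegrE ?(ltW mq_gt0) // sin2cos2 cos_tmax.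
by have := mpq_lt1; lra.
Qed.

Lemma sin_gt_mq t : tmin < t <= tmax -> mq < sin t.
Proof.
move=> /andP[t1 t2]; rewrite -sin_tmin ltr_sin // in_sin_itv ?tmin_bounds //.
by rewrite theta_bounds // (ltW t1).
Qed.

Lemma cos_gt_mp t : tmin <= t < tmax -> mp < cos t.
Proof.
move=> /andP[t1 t2]; rewrite -cos_tmax ltr_cos // in_cos_itv ?tmax_bounds //.
by rewrite theta_bounds // t1 ltW.
Qed.

Lemma sin_ge_mq t : tmin <= t <= tmax -> mq <= sin t.
Proof.
move=> /andP[]; rewrite le_eqVlt => /predU1P[<- _|t1 t2]; first by rewrite sin_tmin.
by rewrite ltW // sin_gt_mq // t1.
Qed.

Lemma cos_ge_mp t : tmin <= t <= tmax -> mp <= cos t.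
Proof.
move=> /andP[t1]; rewrite le_eqVlt => /predU1P[->|t2]; first by rewrite cos_tmax.
by rewrite ltW // cos_gt_mp // t1.
Qed.

Lemma sin_flex_gt0 t : tmin <= t <= tmax -> 0 < sin t.
Proof. by move=> /sin_ge_mq; apply: lt_le_trans; exact: mq_gt0. Qed.

Lemma cos_flex_gt0 t : tmin <= t <= tmax -> 0 < cos t.
Proof. by move=> /cos_ge_mp; apply: lt_le_trans; exact: mp_gt0. Qed.

Definition coord_p t i : R := p i / cos t.
Definition coord_p' (d : bool -> bool) t i : R :=
  (-1) ^+ d i * Num.sqrt (1 - p i ^+ 2 / cos t ^+ 2).
Definition coord_q t i : R := q i / sin t.
Definition coord_q' (e : bool -> bool) t i : R :=
  (-1) ^+ e i * Num.sqrt (1 - q i ^+ 2 / sin t ^+ 2).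

Lemma sqr_le_norm (x m c : R) : `|x| <= m -> m <= c -> x ^+ 2 <= c ^+ 2.
Proof.
move=> xm mc; have c0 : 0 <= c by apply: le_trans mc; apply: le_trans xm.
rewrite -[leLHS]real_normK ?num_real // ler_pXn2r ?nnegrE //.
exact: le_trans xm mc.
Qed.

Lemma sqr_lt_norm (x m c : R) : `|x| <= m -> m < c -> x ^+ 2 < c ^+ 2.
Proof.
move=> xm mc; have c0 : 0 <= c by apply: le_trans (ltW mc); apply: le_trans xm.
rewrite -[ltLHS]real_normK ?num_real // ltr_pXn2r ?nnegrE //.
exact: le_lt_trans xm mc.
Qed.

Lemma sqr_signed_sqrt (b : bool) (x c : R) : 0 < c -> x ^+ 2 <= c ^+ 2 ->
  ((-1) ^+ b * Num.sqrt (1 - x ^+ 2 / c ^+ 2)) ^+ 2 = 1 - x ^+ 2 / c ^+ 2.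
Proof.
move=> c0 xc; rewrite exprMn sqrr_sign mul1r sqr_sqrtr //.
by rewrite subr_ge0 ler_pdivrMr ?exprn_gt0 // mul1r.
Qed.

Lemma coord_pE d t i : tmin <= t <= tmax ->
  coord_p t i ^+ 2 + coord_p' d t i ^+ 2 = 1.
Proof.
move=> tb; rewrite /coord_p' sqr_signed_sqrt ?cos_flex_gt0 //; last first.
  exact: sqr_le_norm (norm_p i) (cos_ge_mp tb).
by rewrite /coord_p expr_div_n; ring.
Qed.

Lemma coord_qE e t i : tmin <= t <= tmax ->
  coord_q t i ^+ 2 + coord_q' e t i ^+ 2 = 1.
Proof.
move=> tb; rewrite /coord_q' sqr_signed_sqrt ?sin_flex_gt0 //; last first.
  exact: sqr_le_norm (norm_q i) (sin_ge_mq tb).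
by rewrite /coord_q expr_div_n; ring.
Qed.

Lemma vertex_flex d1 d2 e1 e2 t b : let P := flex d1 d2 e1 e2 t in
  [/\ vertex P 0 b = vec4 (coord_p t b) (coord_p' (sel d1 d2) t b) 0 0,
      vertex P 1 b = vec4 0 0 (coord_q t b) (coord_q' (sel e1 e2) t b) &
      vertex P 2 b = vec4 (cos t) 0 ((-1) ^+ b * sin t) 0].
Proof.
move=> P; rewrite /vertex /P /flex_octahedron; case: b;
  split; rewrite ?rowKd ?rowKu rowK //= ?mulN1r ?expr1 ?expr0 ?mul1r //.
Qed.

Lemma row_vertex (P : octahedron R) (i : 'I_(3 + 3)) :
  exists k b, row i P = vertex P k b /\ (i %% 3)%N = k.
Proof.
case: (splitP i) => k ik; exists k; [exists false|exists true]; split.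
- by congr row; apply/val_inj.
- by rewrite ik modn_small.
- by congr row; apply/val_inj.
- by rewrite ik modnDl modn_small.
Qed.

(** The denominators cancel, and neither [t] nor any of the four signs remains in the table: the
    edge lengths are constant. *)
Lemma dotv_vertex_edge d1 d2 e1 e2 t k l b c : tmin <= t <= tmax -> k != l ->
  dotv (vertex (flex d1 d2 e1 e2 t) k b) (vertex (flex d1 d2 e1 e2 t) l c) =
  nth 0 (nth [::] [:: [:: 0; 0; p b]; [:: 0; 0; (-1) ^+ c * q b];
    [:: p c; (-1) ^+ b * q c; 0]] k) l.
Proof.
move=> tb; have [c0 s0] := (cos_flex_gt0 tb, sin_flex_gt0 tb).
have [v0 v1 v2] := vertex_flex d1 d2 e1 e2 t b.
have [w0 w1 w2] := vertex_flex d1 d2 e1 e2 t c.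
move: k l; do 2!apply: ord3P => //=; move=> _;
  rewrite ?v0 ?v1 ?v2 ?w0 ?w1 ?w2 dotv_vec4 /vec4 !mxE /= /coord_p /coord_q;
  rewrite ?mulr0 ?mul0r ?addr0 ?add0r //.
- by field; rewrite gt_eqF.
- by rewrite mulrCA divfK ?gt_eqF.
- by field; rewrite gt_eqF.
- by rewrite -mulrA [X in _ * X]mulrC divfK ?gt_eqF.
Qed.

End FlexGeometry.

Section FlexibleFamily.
Context {R : realType}.

Lemma continuous_matrix (T : topologicalType) (m n : nat) (f : T -> 'M[R]_(m, n)) (x : T) :
  (forall i j, {for x, continuous (fun y => f y i j)}) -> {for x, continuous f}.
Proof.
move=> fc A [B nB BA].
have H : \forall y \near x, forall ij : 'I_m * 'I_n, B ij.1 ij.2 (f y ij.1 ij.2).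
  by apply: filter_forall => -[i j] /=; exact: (fc i j _ (nB i j)).
by apply: filterS H => y yB; apply: BA => i j; exact: (yB (i, j)).
Qed.

Implicit Types t : R.
Variables p1 p2 q1 q2 : R.
Hypotheses (hp : `|p1| != `|p2|) (hq : `|q1| != `|q2|)
  (hpq : Num.max (p1 ^+ 2) (p2 ^+ 2) + Num.max (q1 ^+ 2) (q2 ^+ 2) < 1).
Variables d1 d2 e1 e2 : bool.

Local Notation flex := (flex_octahedron p1 p2 q1 q2 d1 d2 e1 e2).
Local Notation tmin := (theta_min q1 q2).
Local Notation tmax := (theta_max p1 p2).

Let p : bool -> R := sel p1 p2.
Let q : bool -> R := sel q1 q2.
Let d := sel d1 d2.
Let e := sel e1 e2.

Let A t i : R := coord_p p1 p2 t i.
Let A' t i : R := coord_p' p1 p2 d t i.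
Let B t i : R := coord_q q1 q2 t i.
Let B' t i : R := coord_q' q1 q2 e t i.

Let v0 t b : vertex (flex t) 0 b = vec4 (A t b) (A' t b) 0 0.
Proof. by have [] := vertex_flex p1 p2 q1 q2 d1 d2 e1 e2 t b. Qed.
Let v1 t b : vertex (flex t) 1 b = vec4 0 0 (B t b) (B' t b).
Proof. by have [] := vertex_flex p1 p2 q1 q2 d1 d2 e1 e2 t b. Qed.
Let v2 t b : vertex (flex t) 2 b = vec4 (cos t) 0 ((-1) ^+ b * sin t) 0.
Proof. by have [] := vertex_flex p1 p2 q1 q2 d1 d2 e1 e2 t b. Qed.
Let AA t b (tb : tmin <= t <= tmax) : A t b ^+ 2 + A' t b ^+ 2 = 1.
Proof. exact: (coord_pE hp hq hpq). Qed.
Let BB t b (tb : tmin <= t <= tmax) : B t b ^+ 2 + B' t b ^+ 2 = 1.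
Proof. exact: (coord_qE hp hq hpq). Qed.

Lemma sphere_vertex t k b : tmin <= t <= tmax -> sphere3 (vertex (flex t) k b).
Proof.
move=> tb; rewrite /sphere3 /=; move: k; apply: ord3P.
- by rewrite v0 dotv_vec4 /vec4 !mxE /= -(AA b tb); ring.
- by rewrite v1 dotv_vec4 /vec4 !mxE /= -(BB b tb); ring.
- rewrite v2 dotv_vec4 /vec4 !mxE /= -[RHS](cos2Dsin2 t).
  by case: b; rewrite /= ?expr0 ?expr1; ring.
Qed.

(** Otherwise [p b ^+ 2 + q c ^+ 2] would be 1. This keeps the faces nondegenerate even at the ends
    of the interval, where one of the two coordinates may vanish. *)
Lemma coords_not_both0 t b c : tmin <= t <= tmax -> A' t b = 0 -> B' t c = 0 -> False.
Proof.
move=> tb a0 b0; have [c0 s0] := (cos_flex_gt0 hp hq hpq tb, sin_flex_gt0 hp hq hpq tb).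
have := AA b tb; have := BB c tb; rewrite a0 b0 expr0n /= !addr0 /A /B.
rewrite /coord_p /coord_q !expr_div_n => /divr1_eq qE /divr1_eq pE.
have := mpq_lt1 hpq; have := sqr_le_norm (norm_p p1 p2 b) (lexx _).
have := sqr_le_norm (norm_q q1 q2 c) (lexx _).
by have := cos2Dsin2 t; rewrite -pE -qE; lra.
Qed.

Lemma face_row_free t f : tmin <= t <= tmax -> row_free (face (flex t) f).
Proof.
move=> tb; have [c0 s0] := (cos_flex_gt0 hp hq hpq tb, sin_flex_gt0 hp hq hpq tb).
apply: inj_row_free => u uF.
have E : u 0 0 *: vertex (flex t) 0 (f 0) + u 0 1 *: vertex (flex t) 1 (f 1)
    + u 0 2 *: vertex (flex t) 2 (f 2) = 0.
  rewrite -uF; apply/rowP => j; rewrite !mxE !big_ord_recr big_ord0 /= add0r.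
  have w0 : widen_ord (leqnSn 2) (widen_ord (leqnSn 1) ord_max) = 0 :> 'I_3 by apply/val_inj.
  have w1 : widen_ord (leqnSn 2) ord_max = 1 :> 'I_3 by apply/val_inj.
  have w2 : ord_max = 2 :> 'I_3 by apply/val_inj.
  by rewrite w0 w1 w2 !mxE.
rewrite v0 v1 v2 in E.
have := congr1 (fun w : 'rV[R]_4 => (w 0 0, w 0 1, w 0 2, w 0 3)) E.
rewrite /vec4 !mxE /= !mulr0 !addr0 !add0r => -[E0 E1 E2 E3].
have sg1 : (-1) ^+ f 2 * sin t != 0 by rewrite mulf_neq0 ?signr_eq0 ?gt_eqF.
have [a0|a0] := eqVneq (A' t (f 0)) 0.
  have b0 : B' t (f 1) != 0 by apply/eqP => /(coords_not_both0 tb a0).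
  have u1 : u 0 1 = 0 by apply/eqP; move/eqP: E3; rewrite mulf_eq0 (negPf b0) orbF.
  have u2 : u 0 2 = 0.
    by apply/eqP; move/eqP: E2; rewrite u1 mul0r add0r mulf_eq0 (negPf sg1) orbF.
  have An : A t (f 0) != 0.
    apply/eqP => An; have := AA (f 0) tb; rewrite a0 An expr0n addr0 => /eqP.
    by rewrite eq_sym oner_eq0.
  have u0 : u 0 0 = 0.
    by apply/eqP; move/eqP: E0; rewrite u2 mul0r addr0 mulf_eq0 (negPf An) orbF.
  by apply/rowP; apply: ord3P; rewrite mxE.
have u0 : u 0 0 = 0 by apply/eqP; move/eqP: E1; rewrite mulf_eq0 (negPf a0) orbF.
have u2 : u 0 2 = 0.
  by apply/eqP; move/eqP: E0; rewrite u0 mul0r add0r mulf_eq0 (gt_eqF c0) orbF.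
have u1 : u 0 1 = 0.
  have : u 0 1 * (B t (f 1) ^+ 2 + B' t (f 1) ^+ 2) = 0.
    transitivity (u 0 1 * B t (f 1) * B t (f 1) + u 0 1 * B' t (f 1) * B' t (f 1)).
      by ring.
    by move: E2; rewrite E3 u2 mul0r addr0 => ->; rewrite !mul0r addr0.
  by rewrite BB // mulr1.
by apply/rowP; apply: ord3P; rewrite mxE.
Qed.

Lemma continuous_flex t : tmin <= t <= tmax -> {for t, continuous flex}.
Proof.
move=> tb; have [c0 s0] := (cos_flex_gt0 hp hq hpq tb, sin_flex_gt0 hp hq hpq tb).
have cc : {for t, continuous (@cos R)} by exact: continuous_cos.
have cs : {for t, continuous (@sin R)} by exact: continuous_sin.
have ccst (x : R) : {for t, continuous (fun _ : R => x)} by exact: cvg_cst.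
have cdiv (x : R) (g : R -> R) : {for t, continuous g} -> g t != 0 ->
    {for t, continuous (fun y => x / g y)}.
  by move=> cg g0; apply: cvgM; [exact: cvg_cst|exact: cvgV].
have csqr (x : R) (g : R -> R) (b : bool) : {for t, continuous g} -> g t != 0 ->
    {for t, continuous (fun y => (-1) ^+ b * Num.sqrt (1 - x ^+ 2 / g y ^+ 2))}.
  move=> cg g0; apply: cvgM; first exact: cvg_cst.
  apply: (@continuous_comp _ _ _ (fun y => 1 - x ^+ 2 / g y ^+ 2) Num.sqrt);
    last exact: sqrt_continuous.
  apply: cvgB; first exact: cvg_cst.
  apply: (cdiv _ (fun y => g y ^+ 2)); last by rewrite expf_neq0.
  exact: cvgM.
have ct : cos t != 0 by rewrite gt_eqF.
have st : sin t != 0 by rewrite gt_eqF.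
apply: continuous_matrix => i j.
have [k [b [rE _]]] : exists k b, (forall y, row i (flex y) = vertex (flex y) k b) /\ True.
  case: (splitP i) => k ik; exists k; [exists false|exists true]; split => // y;
  by congr row; apply/val_inj.
have -> : (fun y => flex y i j) = (fun y => vertex (flex y) k b 0 j).
  by apply/funext => y; rewrite -rE [RHS]mxE.
move: k {rE}; apply: ord3P.
- have -> : (fun y => vertex (flex y) 0 b 0 j) = (fun y => vec4 (A y b) (A' y b) 0 0 0 j).
    by apply/funext => y; rewrite v0.
  move: j; apply: ord4P; under [X in {for _, continuous X}]eq_fun do rewrite mxE /=.
  + exact: cdiv.
  + exact: csqr.
  + exact: ccst.
  + exact: ccst.
- have -> : (fun y => vertex (flex y) 1 b 0 j) = (fun y => vec4 0 0 (B y b) (B' y b) 0 j).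
    by apply/funext => y; rewrite v1.
  move: j; apply: ord4P; under [X in {for _, continuous X}]eq_fun do rewrite mxE /=.
  + exact: ccst.
  + exact: ccst.
  + exact: cdiv.
  + exact: csqr.
- have -> : (fun y => vertex (flex y) 2 b 0 j) =
     (fun y => vec4 (cos y) 0 ((-1) ^+ b * sin y) 0 0 j).
    by apply/funext => y; rewrite v2.
  move: j; apply: ord4P; under [X in {for _, continuous X}]eq_fun do rewrite mxE /=.
  + exact: cc.
  + exact: ccst.
  + by apply: cvgM => //; exact: cvg_cst.
  + exact: ccst.
Qed.

Lemma edge_length_flex t u i j : tmin <= t <= tmax -> tmin <= u <= tmax -> edge i j ->
  edge_length (flex t) i j = edge_length (flex u) i j.
Proof.
move=> tb ub ij; rewrite /edge_length /sphere_dist; congr acos.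
have vtx (l : 'I_(3 + 3)) : exists k b, (forall y, row l (flex y) = vertex (flex y) k b)
    /\ (l %% 3)%N = k.
  case: (splitP l) => k lk; exists k; [exists false|exists true]; split => //.
  - by move=> z; congr row; apply/val_inj.
  - by rewrite lk modn_small.
  - by move=> z; congr row; apply/val_inj.
  - by rewrite lk modnDl modn_small.
have [k [b [iE ik]]] := vtx i; have [l [c [jE jl]]] := vtx j.
have kl : k != l by move: ij; rewrite /edge ik jl.
by rewrite !iE !jE !(dotv_vertex_edge hp hq hpq).
Qed.

Lemma dotv_diagonal t : dotv (vertex (flex t) 2 false) (vertex (flex t) 2 true) =
  2 * cos t ^+ 2 - 1.
Proof.
rewrite !v2 dotv_vec4 /vec4 !mxE /= expr0 expr1 -[X in _ - X](cos2Dsin2 t); ring.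
Qed.

End FlexibleFamily.

Section Invariant.
Context {R : realType}.
Variables p1 p2 q1 q2 : R.
Hypotheses (hp : `|p1| != `|p2|) (hq : `|q1| != `|q2|)
  (hpq : Num.max (p1 ^+ 2) (p2 ^+ 2) + Num.max (q1 ^+ 2) (q2 ^+ 2) < 1).
Local Notation tmin := (theta_min q1 q2).
Local Notation tmax := (theta_max p1 p2).

(* The parameter is recovered from the length of the diagonal a_3 b_3. *)
Lemma isometric_flex d1 d2 e1 e2 d1' d2' e1' e2' (t u : R) :
  tmin <= t <= tmax -> tmin <= u <= tmax ->
  isometric (flex_octahedron p1 p2 q1 q2 d1 d2 e1 e2 t)
    (flex_octahedron p1 p2 q1 q2 d1' d2' e1' e2' u) -> t = u.
Proof.
move=> tb ub [M [MM PE]].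
have := dotv_diagonal p1 p2 q1 q2 d1' d2' e1' e2' u.
rewrite PE /vertex !row_mul -!/(vertex _ _ _) /dotv trmx_mul mulmxA -(mulmxA _ M) MM mulmx1.
rewrite -/(dotv _ _) dotv_diagonal => E.
have c2 : cos t ^+ 2 = cos u ^+ 2 by lra.
have /eqP := c2; rewrite eqrXn2 ?(ltW (cos_flex_gt0 hp hq hpq _)) // => /eqP.
apply: cos_inj; apply: in_cos_itv; exact: (theta_bounds hp hq hpq).
Qed.

Lemma flexible_flex d1 d2 e1 e2 :
  flexible tmin tmax (flex_octahedron p1 p2 q1 q2 d1 d2 e1 e2).
Proof.
split.
- exact: tmin_lt_tmax.
- apply: continuous_in_subspaceT => t; rewrite inE /= in_itv => tb.
  exact: continuous_flex.
- move=> t; rewrite in_itv => tb; split=> [i|f]; last exact: face_row_free.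
  by have [k [b [-> _]]] := row_vertex (flex_octahedron p1 p2 q1 q2 d1 d2 e1 e2 t) i;
    exact: sphere_vertex.
- move=> t u; rewrite !in_itv => tb ub i j; exact: edge_length_flex.
- move=> t u; rewrite !in_itv => tb ub /eqP tu /(isometric_flex tb ub); exact: tu.
Qed.

End Invariant.

(** * Countability of the level sets *)

Section Countability.
Context {R : realType}.

Lemma countable_preimage (T U : Type) (A : set T) (B : set U) (f : T -> U) :
  countable B -> {in A &, injective f} -> (forall x, A x -> B (f x)) -> countable A.
Proof.
move=> /countable_injP[g gB] fA AB; apply/countable_injP; exists (g \o f).
move=> x y xA yA /= /gB E; apply: fA => //; apply: E; rewrite inE; apply: AB;
  by rewrite -inE.
Qed.

Lemma countable_image (T U : Type) (A : set T) (f : T -> U) :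
  countable A -> countable (f @` A).
Proof. by move=> cA; exact: sub_countable (card_image_le _ _) cA. Qed.

Lemma countable_setU (T : Type) (A B : set T) :
  countable A -> countable B -> countable (A `|` B).
Proof.
move=> cA cB; rewrite -bigcup2inE; apply: bigcup_countable => // i _.
by rewrite /bigcup2; case: ifP => // _; case: ifP.
Qed.

Lemma uncountable_itv (a b : R) : a < b -> ~ countable [set x | a <= x <= b].
Proof.
move=> ab /countable_lebesgue_measure0.
have -> : [set x | a <= x <= b] = `[a, b]%classic.
  by apply/seteqP; split=> x /=; rewrite in_itv.
by rewrite lebesgue_measure_itv /= lte_fin ab -EFinB => -[] /eqP; rewrite subr_eq0 gt_eqF.
Qed.

End Countability.

Section VolumeAlongFlex.
Context {R : realType}.
Implicit Types t : R.
Variables p1 p2 q1 q2 : R.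
Hypotheses (hp : `|p1| != `|p2|) (hq : `|q1| != `|q2|)
  (hpq : Num.max (p1 ^+ 2) (p2 ^+ 2) + Num.max (q1 ^+ 2) (q2 ^+ 2) < 1).
Local Notation tmin := (theta_min q1 q2).
Local Notation tmax := (theta_max p1 p2).
Local Notation V4 := (vol (setT : set 'rV[R]_4)).

Section FixedSigns.
Variables (d1 d2 e1 e2 : bool) (A : {set 'I_(3 + 3)}).

Local Notation flex := (flex_octahedron p1 p2 q1 q2 d1 d2 e1 e2).

Let k i (b : bool) : R := (-1) ^+ ((if b then rshift 3 i else lshift 3 i) \in A).

Let k2 i b : k i b ^+ 2 = 1. Proof. exact: sqrr_sign. Qed.

Lemma vertex_antipodes (P : octahedron R) i b :
  vertex (antipodes A P) i b = k i b *: vertex P i b.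
Proof.
rewrite /vertex /antipodes /k; apply/rowP => j; rewrite !mxE.
by case: ifP => _; rewrite !mxE ?expr1 ?expr0 ?mulN1r ?mul1r.
Qed.

(** The sign of a_3' is absorbed into the pair [s * cos t], [s * sin t], which gives a_3' the shape
    assumed in both cases. Its comparison with the sign of b_3' selects the case. *)
Let s := k 2 false.

Let a t i := k 0 i * coord_p p1 p2 t i.
Let a' t i := k 0 i * coord_p' p1 p2 (sel d1 d2) t i.
Let b t i := k 1 i * coord_q q1 q2 t i.
Let b' t i := k 1 i * coord_q' q1 q2 (sel e1 e2) t i.

Let P i := s * k 0 i * sel p1 p2 i.
Let Q i := s * k 1 i * sel q1 q2 i.
Let sP (i : bool) : R := (-1) ^+ nat_of_bool i * (k 0 i * (-1) ^+ sel d1 d2 i).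
Let sQ (i : bool) : R := (-1) ^+ nat_of_bool i * (k 1 i * (-1) ^+ sel e1 e2 i).

(** At either end some [a'] or [b'] vanishes, and tetrahedra over the apex on the bisector
    degenerate; the ends are therefore set aside. *)
Let interior t := tmin < t < tmax.

Let int_in t : interior t -> tmin <= t <= tmax.
Proof. by move=> /andP[? ?]; rewrite !ltW. Qed.

Lemma sg_sign_mul (m n : bool) (x : R) : 0 < x -> Num.sg ((-1) ^+ m * ((-1) ^+ n * x)) =
  (-1) ^+ m * (-1) ^+ n.
Proof.
move=> x0; have x1 := gtr0_sg x0.
by case: m; case: n; rewrite !(expr0, expr1, mul1r, mulN1r, opprK, sgrN, x1).
Qed.

Lemma apex_value : exists K : R, K != 0 /\ forall t, interior t ->
  exists o, [/\ sphere3 o, forall e, \det (face_tetra o (antipodes A (flex t)) e) != 0 &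
    apex_sum o (antipodes A (flex t)) = K *
     (if k 2 true == s then flex_fun P Q sP sQ (cos t ^+ 2)
      else flex_fun Q P sQ sP (sin t ^+ 2))].
Proof.
have V0 : V4 / (4 * pi) != 0.
  by rewrite mulf_neq0 ?gt_eqF ?vol_gt0 // invr_gt0 mulr_gt0 ?pi_gt0.
have s2 : s ^+ 2 = 1 by exact: k2.
have s0 : s != 0 by rewrite /s /k signr_eq0.
exists (if k 2 true == s then - (V4 / (4 * pi)) else V4 / (4 * pi)).
split; first by case: ifP; rewrite ?oppr_eq0.
move=> t ti; have tb := int_in ti.
have ct := cos_flex_gt0 hp hq hpq tb; have st := sin_flex_gt0 hp hq hpq tb.
have c0 : s * cos t != 0 by rewrite mulf_neq0 // gt_eqF.
have st0 : s * sin t != 0 by rewrite mulf_neq0 // gt_eqF.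
have cs1 : (s * cos t) ^+ 2 + (s * sin t) ^+ 2 = 1.
  by rewrite !exprMn s2 !mul1r cos2Dsin2.
have vf i := vertex_flex p1 p2 q1 q2 d1 d2 e1 e2 t i.
have v0 i : vertex (antipodes A (flex t)) 0 i = vec4 (a t i) (a' t i) 0 0.
  have [E _ _] := vf i; rewrite vertex_antipodes E.
  by apply/rowP; apply: ord4P; rewrite /vec4 !mxE /= ?mulr0.
have v1 i : vertex (antipodes A (flex t)) 1 i = vec4 0 0 (b t i) (b' t i).
  have [_ E _] := vf i; rewrite vertex_antipodes E.
  by apply/rowP; apply: ord4P; rewrite /vec4 !mxE /= ?mulr0.
have v2 i : vertex (antipodes A (flex t)) 2 i =
    vec4 (k 2 i * cos t) 0 (k 2 i * ((-1) ^+ i * sin t)) 0.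
  have [_ _ E] := vf i; rewrite vertex_antipodes E.
  by apply/rowP; apply: ord4P; rewrite /vec4 !mxE /= ?mulr0.
have a1 i : a t i ^+ 2 + a' t i ^+ 2 = 1.
  transitivity (k 0 i ^+ 2 * (coord_p p1 p2 t i ^+ 2 + coord_p' p1 p2 (sel d1 d2) t i ^+ 2)).
    by rewrite /a /a'; ring.
  by rewrite k2 mul1r (coord_pE hp hq hpq).
have b1 i : b t i ^+ 2 + b' t i ^+ 2 = 1.
  transitivity (k 1 i ^+ 2 * (coord_q q1 q2 t i ^+ 2 + coord_q' q1 q2 (sel e1 e2) t i ^+ 2)).
    by rewrite /b /b'; ring.
  by rewrite k2 mul1r (coord_qE hp hq hpq).
have root0 (x c : R) : x ^+ 2 < c ^+ 2 -> 0 < c -> 0 < Num.sqrt (1 - x ^+ 2 / c ^+ 2).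
  move=> xc cc; rewrite sqrtr_gt0 subr_gt0 ltr_pdivrMr ?exprn_gt0 //.
  by rewrite mul1r.
have rp i : 0 < Num.sqrt (1 - sel p1 p2 i ^+ 2 / cos t ^+ 2).
  apply: root0 => //; apply: sqr_lt_norm (norm_p p1 p2 i) _.
  by apply: (cos_gt_mp hp hq hpq); case/andP: ti => ? ->; rewrite andbT ltW.
have rq i : 0 < Num.sqrt (1 - sel q1 q2 i ^+ 2 / sin t ^+ 2).
  apply: root0 => //; apply: sqr_lt_norm (norm_q q1 q2 i) _.
  by apply: (sin_gt_mq hp hq hpq); case/andP: ti => -> ?; rewrite /= ltW.
have a0 i : a' t i != 0 by rewrite !mulf_neq0 ?signr_eq0 // gt_eqF.
have b0 i : b' t i != 0 by rewrite !mulf_neq0 ?signr_eq0 // gt_eqF.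
have PE : (fun i => a t i * (s * cos t)) = P.
  apply/funext => i; rewrite /a /P /coord_p; field; exact: lt0r_neq0.
have QE : (fun i => b t i * (s * sin t)) = Q.
  apply/funext => i; rewrite /b /Q /coord_q; field; exact: lt0r_neq0.
have sPE : (fun i : bool => (-1) ^+ nat_of_bool i * Num.sg (a' t i)) = sP.
  by apply/funext => i; rewrite /sP /a' /coord_p' /k sg_sign_mul.
have sQE : (fun i : bool => (-1) ^+ nat_of_bool i * Num.sg (b' t i)) = sQ.
  by apply/funext => i; rewrite /sQ /b' /coord_q' /k sg_sign_mul.
have sg1 : Num.sg (s * cos t * (s * sin t)) = 1.
  by rewrite mulrACA -expr2 s2 mul1r gtr0_sg // mulr_gt0.
have sgsph (x : R) : x != 0 -> Num.sg x * Num.sg x = 1.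
  by move=> x0; rewrite -expr2 sqr_sg x0.
have xE : vertex (antipodes A (flex t)) 2 false = vec4 (s * cos t) 0 (s * sin t) 0.
  by rewrite v2 expr0 mul1r.
case: ifPn => ks.
  have yE : vertex (antipodes A (flex t)) 2 true = vec4 (s * cos t) 0 (- (s * sin t)) 0.
    by rewrite v2 (eqP ks) expr1 mulN1r mulrN.
  have [dE vE] := apex_sum_caseI v0 v1 a1 b1 cs1 c0 st0 a0 b0 xE yE.
  exists (vec4 (Num.sg (s * cos t)) 0 0 0); split=> //.
    by rewrite /sphere3 /= dotv_vec4 /vec4 !mxE /= !mul0r !addr0 sgsph.
  rewrite vE sg1 PE QE sPE sQE mul1r; congr (_ * flex_fun _ _ _ _ _).
  by rewrite exprMn s2 mul1r.
have ks' : k 2 true = - s.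
  by move: ks; rewrite /s /k; do 2!case: (_ \in A); rewrite ?expr0 ?expr1 ?eqxx ?opprK.
have yE : vertex (antipodes A (flex t)) 2 true = vec4 (- (s * cos t)) 0 (s * sin t) 0.
  by rewrite v2 ks' expr1 mulN1r mulrNN mulNr.
have [dE vE] := apex_sum_caseII v0 v1 a1 b1 cs1 c0 st0 a0 b0 xE yE.
exists (vec4 0 0 (Num.sg (s * sin t)) 0); split=> //.
  by rewrite /sphere3 /= dotv_vec4 /vec4 !mxE /= !mul0r !addr0 add0r sgsph.
rewrite vE sg1 PE QE sPE sQE mul1r; congr (_ * flex_fun _ _ _ _ _).
by rewrite exprMn s2 mul1r.
Qed.

Lemma oriented_volume_flex_countable t : interior t ->
  countable (oriented_volume (antipodes A (flex t))).
Proof.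
move=> ti; have [K [_ /(_ t ti) [ o [_ dE _]]]] := apex_value.
exact: oriented_volume_countable dE.
Qed.

Let P2 i : P i ^+ 2 = sel p1 p2 i ^+ 2.
Proof. by rewrite /P !exprMn !k2 !mul1r. Qed.

Let Q2 i : Q i ^+ 2 = sel q1 q2 i ^+ 2.
Proof. by rewrite /Q !exprMn !k2 !mul1r. Qed.

Let sP2 i : sP i ^+ 2 = 1.
Proof. by rewrite /sP !exprMn k2 !sqrr_sign !mul1r. Qed.

Let sQ2 i : sQ i ^+ 2 = 1.
Proof. by rewrite /sQ !exprMn k2 !sqrr_sign !mul1r. Qed.

(** The explicit apex exhibits one element of the oriented volume, [4 * apex_sum], which the
    inclusion forces into [K]; the value of [flex_fun] then lies in a countable set. Inclusion
    rather than equality lets [K] unite the volumes of several octahedra. *)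
Lemma flex_level_countable (K : set R) : countable K ->
  countable [set t | interior t /\ oriented_volume (antipodes A (flex t)) `<=` K].
Proof.
move=> cK; have [c [c0 cE]] := apex_value.
pose K' := [set y | K (4 * (c * y))].
have cK' : countable K'.
  apply: (@countable_preimage _ _ K' K (fun y => 4 * (c * y))) => // x y _ _.
  by move=> /mulfI-/(_ _)/mulfI; apply; rewrite ?pnatr_eq0.
have sqr_neq (x y : R) : `|x| != `|y| -> x ^+ 2 != y ^+ 2.
  by apply: contra_neq => xy; rewrite -!sqrtr_sqr xy.
have hp' : P false ^+ 2 != P true ^+ 2 by rewrite !P2 sqr_neq.
have hq' : Q false ^+ 2 != Q true ^+ 2 by rewrite !Q2 sqr_neq.
have value t : interior t -> oriented_volume (antipodes A (flex t)) `<=` K ->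
    K' (if k 2 true == s then flex_fun P Q sP sQ (cos t ^+ 2)
      else flex_fun Q P sQ sP (sin t ^+ 2)).
  move=> ti VK; have [ o [so dE vE]] := cE t ti; apply: VK.
  exists o, 0; split; last by rewrite oriented_volume_sum vE mul0r addr0.
  split=> // e; rewrite tetra_overE; case: ifP => // _.
  by rewrite det_xrow // oppr_eq0.
have cp t i : interior t -> P i ^+ 2 < cos t ^+ 2.
  move=> /andP[t1 t2]; rewrite P2; apply: sqr_lt_norm (norm_p p1 p2 i) _.
  by apply: (cos_gt_mp hp hq hpq); rewrite t2 ltW.
have cq t i : interior t -> Q i ^+ 2 < sin t ^+ 2.
  move=> /andP[t1 t2]; rewrite Q2; apply: sqr_lt_norm (norm_q q1 q2 i) _.
  by apply: (sin_gt_mq hp hq hpq); rewrite t1 ltW.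
have cinj t u : interior t -> interior u -> cos t ^+ 2 = cos u ^+ 2 -> t = u.
  move=> /int_in tb /int_in ub /eqP.
  rewrite eqrXn2 ?(ltW (cos_flex_gt0 hp hq hpq _)) // => /eqP.
  by apply: cos_inj; apply: in_cos_itv; exact: (theta_bounds hp hq hpq).
have [ks|ks] := boolP (k 2 true == s).
  have cI := flex_fun_preimage_countable sP2 sQ2 hp' hq' cK'.
  apply: (countable_preimage (f := fun t => cos t ^+ 2) cI).
    by move=> t u /set_mem[ti _] /set_mem[ui _]; exact: cinj.
  move=> t [ti VK]; split; last by have := value t ti VK; rewrite ks.
  split=> i; first exact: cp.
  by rewrite ltrBrDr -ltrBrDl -sin2cos2 cq.
have cI := flex_fun_preimage_countable sQ2 sP2 hq' hp' cK'.
apply: (countable_preimage (f := fun t => sin t ^+ 2) cI).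
  move=> t u /set_mem[ti _] /set_mem[ui _]; rewrite !sin2cos2 => E.
  by apply: cinj => //; lra.
move=> t [ti VK]; split; last by have := value t ti VK; rewrite (negPf ks).
split=> i; first exact: cq.
by rewrite ltrBrDr -ltrBrDl -cos2sin2 cp.
Qed.

End FixedSigns.

Lemma class_of_isometric (X Y : octahedron R) : class_of X = class_of Y -> isometric X Y.
Proof.
by move=> /eqmodP/asboolP[M [MM _ YE]]; exists M.
Qed.

End VolumeAlongFlex.

Section Counterexample.
Context {R : realType}.
Variables p1 p2 q1 q2 : R.
Hypotheses (hp : `|p1| != `|p2|) (hq : `|q1| != `|q2|)
  (hpq : Num.max (p1 ^+ 2) (p2 ^+ 2) + Num.max (q1 ^+ 2) (q2 ^+ 2) < 1).
Local Notation tmin := (theta_min q1 q2).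
Local Notation tmax := (theta_max p1 p2).
Local Notation signs := (bool * bool * bool * bool)%type.

Let flex (d : signs) : R -> octahedron R :=
  flex_octahedron p1 p2 q1 q2 d.1.1.1 d.1.1.2 d.1.2 d.2.

Lemma segment_uncountable (G S : set (octahedron_class R)) : segment G S -> ~ countable S.
Proof.
move=> [c [_ cinj SE _]] cS; apply: (@uncountable_itv R 0 1) => //.
apply: (countable_preimage (f := c) cS) => [x y /set_mem x01 /set_mem y01 E|x x01].
  by apply: cinj => //; rewrite inE /= in_itv.
by rewrite SE; exists x => //=; rewrite in_itv.
Qed.

Lemma segment_nonconstant (A : {set 'I_(3 + 3)}) (S : set (octahedron_class R)) :
  segment (Gamma p1 p2 q1 q2) S ->
  nonconstant_on p1 p2 q1 q2 S (fun P => oriented_volume (antipodes A P)).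
Proof.
move=> segS; have unS := segment_uncountable segS.
have SG : S `<=` Gamma p1 p2 q1 q2 by case: segS => c [].
have flexE P : flex_octahedra p1 p2 q1 q2 P ->
    exists d t, tmin <= t <= tmax /\ P = flex d t.
  by move=> [d1 [d2 [e1 [e2 [t [tb ->]]]]]]; exists (d1, d2, e1, e2), t.
pose E : set (signs * R) := setT `*` [set tmin; tmax].
have cE : countable E by apply: finite_set_countable; apply: finite_setX.
have itv_cases t : tmin <= t <= tmax -> [set tmin; tmax] t \/ tmin < t < tmax.
  move=> /andP[]; rewrite !le_eqVlt => /predU1P[->|t1] /predU1P[->|t2]; rewrite ?t1 ?t2;
    by [left; left|left; right|right].
(* The classes with a parameter at an end are finitely many, so they cannot exhaust [S]. *)
have [y0 [d0 [t0 [Sy0 ti0 y0E]]]] : exists y d t,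
    [/\ S y, tmin < t < tmax & y = class_of (flex d t)].
  apply: contrapT => none; apply: unS.
  apply: sub_countable (countable_image (fun dt => class_of (flex dt.1 dt.2)) cE).
  apply: subset_card_le => x Sx; have [P /flexE[d [t [tb PE]]] Px] := SG x Sx.
  have [te|ti] := itv_cases t tb; first by exists (d, t) => //; rewrite -PE.
  by case: none; exists x, d, t; rewrite -PE.
have tb0 : tmin <= t0 <= tmax by case/andP: ti0 => ? ?; rewrite !ltW.
(* Every representative of [y0] has the parameter [t0], but possibly other signs, so all sixteen
   choices are united. *)
pose K := \bigcup_(d in [set: signs]) oriented_volume (antipodes A (flex d t0)).
have cK : countable K.
  by apply: bigcup_countable => // d _; exact: (oriented_volume_flex_countable hp hq hpq).
pose L d := [set t | tmin < t < tmax /\ oriented_volume (antipodes A (flex d t)) `<=` K].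
have cL : countable (\bigcup_(d in [set: signs]) [set x | exists2 t, L d t & x = (d, t)]).
  apply: bigcup_countable => // d _.
  apply: (countable_preimage (f := snd) (flex_level_countable hp hq hpq d.1.1.1 d.1.1.2
    d.1.2 d.2 A cK)) => [x y /set_mem[t _ ->] /set_mem[u _ ->] /= -> //|x [t Lt ->]].
  exact: Lt.
(* If no point of [S] forms a witness with [y0], each one has a representative that lies at an end
   or has its oriented volume inside [K]; there are countably many such classes. *)
apply: contrapT => const; apply: unS.
apply: sub_countable (countable_image (fun dt => class_of (flex dt.1 dt.2))
  (countable_setU cE cL)).
apply: subset_card_le => x Sx.
have [P [Q [[d [t [tb PE]]] [d' [t' [tb' QE]]] Px Qy PQ]]] : exists P Q,
    [/\ exists d t, tmin <= t <= tmax /\ P = flex d t,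
        exists d t, tmin <= t <= tmax /\ Q = flex d t, class_of P = x, class_of Q = y0 &
        oriented_volume (antipodes A P) = oriented_volume (antipodes A Q)].
  apply: contrapT => none; apply: const; exists x, y0; split; [exact: Sx|exact: Sy0|].
  move=> P Q PO QO Px Qy PQ; apply: none; exists P, Q.
  by split; [exact: flexE|exact: flexE|exact: Px|exact: Qy|exact: PQ].
exists (d, t); last by rewrite -PE.
have [te|ti] := itv_cases t tb; first exact: or_introl (conj I te).
right; exists d; first exact: I.
exists t; [split; first exact: ti|reflexivity].
rewrite -PE PQ QE.
suff -> : t' = t0 by exact: (bigcup_sup (i := d')).
have /class_of_isometric iso : class_of (flex d' t') = class_of (flex d0 t0).
  exact: etrans (congr1 class_of (esym QE)) (etrans Qy y0E).
exact: (isometric_flex hp hq hpq tb' tb0 iso).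
Qed.

Lemma not_modified_bellows (d : signs) : ~ satisfies_modified_bellows tmin tmax (flex d).
Proof.
move=> [A [V VE]]; have lt_t := tmin_lt_tmax hp hq hpq.
have volE t : tmin < t < tmax -> oriented_volume (antipodes A (flex d t)) = V.
  by move=> /andP[t1 t2]; apply: VE; rewrite in_itv /= !ltW.
(* The middle third stays away from the ends and is still uncountable. *)
pose a := (2 * tmin + tmax) / 3; pose b := (tmin + 2 * tmax) / 3.
have ab : a < b by rewrite /a /b; lra.
have abI t : a <= t <= b -> tmin < t < tmax.
  by rewrite /a /b => /andP[t1 t2]; apply/andP; split; lra.
have cV : countable V.
  rewrite -(volE a); last by apply: abI; rewrite lexx ltW.
  apply: (oriented_volume_flex_countable hp hq hpq).
  by apply: abI; rewrite lexx ltW.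
apply: (uncountable_itv ab).
apply: sub_countable (flex_level_countable hp hq hpq d.1.1.1 d.1.1.2 d.1.2 d.2 A cV).
apply: subset_card_le => t /abI ti; split; first exact: ti.
by move=> v; rewrite (volE t ti).
Qed.

End Counterexample.

Theorem theorem6p5 (R : realType) (p1 p2 q1 q2 : R)
  (hp : `|p1| != `|p2|) (hq : `|q1| != `|q2|)
  (hpq : Num.max (p1 ^+ 2) (p2 ^+ 2) + Num.max (q1 ^+ 2) (q2 ^+ 2) < 1) :
  (forall (A : {set 'I_(3 + 3)}) (S : set (octahedron_class R)),
     segment (Gamma p1 p2 q1 q2) S ->
     nonconstant_on p1 p2 q1 q2 S (fun P => oriented_volume (antipodes A P))) /\
  (forall d1 d2 e1 e2 : bool,
     modified_bellows_counterexample (theta_min q1 q2) (theta_max p1 p2)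
       (flex_octahedron p1 p2 q1 q2 d1 d2 e1 e2)).
Proof.
split=> [A S|d1 d2 e1 e2]; first exact: segment_nonconstant.
split; first exact: flexible_flex.
exact: (not_modified_bellows hp hq hpq (d := (d1, d2, e1, e2))).
Qed.
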